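(* Let $K_4 = P_4/Z(P_4)$, viewed as a subgroup of index $48$ in $\operatorname{Aut}(F_2)$. Then $K_4$ admits $5$ inequivalent extensions as an $F_3$-by-$F_2$ group: there are five short exact sequences $1\to F_3\to K_4\to F_2\to 1$ whose fibers (the kernels $F_3$) are pairwise distinct normal subgroups of $K_4$. Only $4$ of these five arise from the strand-forgetting maps on $P_4$.
   Context: $F_k$ is the free group of rank $k$; $B_4$ and $P_4$ are the braid group and the pure braid group on $4$ strands; $Z(\cdot)$ denotes the center, and $Z(P_4)=Z(B_4)$. Embedding of $K_4$ in $\operatorname{Aut}(F_2)$: write $B_4=\langle\sigma_1,\sigma_2,\sigma_3\mid \sigma_1\sigma_2\sigma_1=\sigma_2\sigma_1\sigma_2,\ \sigma_2\sigma_3\sigma_2=\sigma_3\sigma_2\sigma_3,\ \sigma_1\sigma_3=\sigma_3\sigma_1\rangle$. The elements $a=\sigma_1\sigma_3^{-1}$ and $b=\sigma_2\sigma_1\sigma_3^{-1}\sigma_2^{-1}$ generate a normal free subgroup $F_2\unlhd B_4$ of rank $2$. The conjugation action $x\mapsto gxg^{-1}$ of $B_4$ on this subgroup induces an isomorphism (Dyer–Formanek–Grossman) of $B_4/Z(B_4)$ onto $\operatorname{Aut}^{+}(F_2)$, the index-$2$ subgroup of $\operatorname{Aut}(F_2)$ of automorphisms acting with determinant $1$ on $H_1(F_2;\mathbb{Z})$. Then $K_4=P_4/Z(P_4)\leq B_4/Z(B_4)\cong\operatorname{Aut}^{+}(F_2)\leq\operatorname{Aut}(F_2)$. Strand-forgetting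 maps: for $1\leq i\leq 4$, $\Theta_i\colon P_4\to P_3$ is the epimorphism removing the $i$-th strand. It restricts to an isomorphism $Z(P_4)\to Z(P_3)$, hence descends to an epimorphism $\theta_i\colon K_4\to K_3:=P_3/Z(P_3)\cong F_2$ with kernel isomorphic to $F_3$. An extension of $K_4$ arises from a strand-forgetting map on $P_4$ if its fiber is $\ker\theta_i$ for some $i$. Two extensions are inequivalent if their fibers are distinct subgroups of $K_4$. *)

(* Defs.v *)
From HB Require Import structures.
From mathcomp Require Import all_boot zify.
From mathcomp Require Import boolp classical_sets.

Set Implicit Arguments.
Unset Strict Implicit.
Unset Printing Implicit Defensive.

Local Open Scope group_scope.
Local Open Scope quotient_scope.

(* A word over X: the letter (x, false) stands for x, (x, true) for x^-1. *)
Notation word X := (seq (X * bool)%type).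

Definition inv_letter (X : Type) (l : X * bool) : X * bool := (l.1, ~~ l.2).

Definition inv_word (X : Type) (w : word X) : word X :=
  rev (map (@inv_letter X) w).

(* The least congruence on words containing the relations u = v, R u v, and *)
(* the free cancellations.                                                  *)
Inductive pres_eq (X : Type) (R : word X -> word X -> Prop) :
    word X -> word X -> Prop :=
| PresRefl u : pres_eq R u u
| PresSym u v : pres_eq R u v -> pres_eq R v u
| PresTrans u v w : pres_eq R u v -> pres_eq R v w -> pres_eq R u w
| PresRel s u v t : R u v -> pres_eq R (s ++ u ++ t) (s ++ v ++ t)
| PresCancel s l t : pres_eq R (s ++ [:: l; inv_letter l] ++ t) (s ++ t).

Section Presented.
Variables (X : choiceType) (R : word X -> word X -> Prop).
Implicit Types u v w : word X.

Lemma inv_letterK : involutive (@inv_letter X).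
Proof. by case=> x b; rewrite /inv_letter /= negbK. Qed.

Lemma pres_eq_cat u u' v v' :
  pres_eq R u u' -> pres_eq R v v' -> pres_eq R (u ++ v) (u' ++ v').
Proof.
move=> uu' vv'; apply: (@PresTrans _ _ _ (u' ++ v)).
  elim: uu' => {u u' vv'} [u|u u' _|u u' w _ H1 _ H2|s u u' t|s l t].
  - exact: PresRefl.
  - exact: PresSym.
  - exact: PresTrans H1 H2.
  - by move=> Ruu'; rewrite -!catA; apply: PresRel.
  - by rewrite -!catA; apply: PresCancel.
elim: vv' => {v v' uu'} [v|v v' _|v v' w _ H1 _ H2|s v v' t|s l t].
- exact: PresRefl.
- exact: PresSym.
- exact: PresTrans H1 H2.
- by move=> Rvv'; rewrite [u' ++ _]catA [X in pres_eq _ _ X]catA; apply: PresRel.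
- by rewrite [u' ++ _]catA [X in pres_eq _ _ X]catA; apply: PresCancel.
Qed.

Lemma inv_word_cat u v : inv_word (u ++ v) = inv_word v ++ inv_word u.
Proof. by rewrite /inv_word map_cat rev_cat. Qed.

Lemma inv_wordK : involutive (@inv_word X).
Proof.
move=> u; rewrite /inv_word map_rev revK -map_comp -[RHS]map_id.
by apply: eq_map => l /=; rewrite inv_letterK.
Qed.

Lemma pres_eq_mulV u : pres_eq R (u ++ inv_word u) [::].
Proof.
elim: u => [|l u IH]; first exact: PresRefl.
rewrite -(cat1s l u) inv_word_cat -catA [u ++ _]catA.
have H : pres_eq R ((u ++ inv_word u) ++ inv_word [:: l]) (inv_word [:: l]).
  by rewrite -[X in pres_eq _ _ X]cat0s; apply: pres_eq_cat => //; apply: PresRefl.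
apply: PresTrans (pres_eq_cat (PresRefl R [:: l]) H) _.
exact: (PresCancel R [::] l [::]).
Qed.

Lemma pres_eq_mulVl u : pres_eq R (inv_word u ++ u) [::].
Proof. by rewrite -[X in _ ++ X]inv_wordK; apply: pres_eq_mulV. Qed.

Lemma pres_eq_inv u v : pres_eq R u v -> pres_eq R (inv_word u) (inv_word v).
Proof.
move=> uv; apply: (@PresTrans _ _ _ (inv_word u ++ (v ++ inv_word v))).
  rewrite -[X in pres_eq R X _]cats0; apply: pres_eq_cat; first exact: PresRefl.
  exact/PresSym/pres_eq_mulV.
rewrite catA -[X in pres_eq R _ X]cat0s; apply: pres_eq_cat; last exact: PresRefl.
apply: PresTrans (pres_eq_mulVl u).
by apply: pres_eq_cat; [exact: PresRefl | exact: PresSym].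
Qed.

Definition pres_eqb u v : bool := `[< pres_eq R u v >].

Lemma pres_eqb_refl : reflexive pres_eqb.
Proof. by move=> u; apply/asboolP; apply: PresRefl. Qed.
Lemma pres_eqb_sym : symmetric pres_eqb.
Proof. by move=> u v; apply/asboolP/asboolP; apply: PresSym. Qed.
Lemma pres_eqb_trans : transitive pres_eqb.
Proof. by move=> v u w /asboolP uv /asboolP vw; apply/asboolP/(PresTrans uv). Qed.

Canonical pres_equiv := EquivRel pres_eqb pres_eqb_refl pres_eqb_sym pres_eqb_trans.

Definition presented := {eq_quot pres_equiv}.
HB.instance Definition _ := Choice.on presented.
HB.instance Definition _ := Quotient.on presented.

Definition word_class (w : word X) : presented := \pi_presented w.

Definition gen (x : X) : presented := word_class [:: (x, false)].

Lemma word_classP u v : word_class u = word_class v <-> pres_eq R u v.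
Proof.
split; first by move=> /eqmodP/asboolP.
by move=> uv; apply/eqmodP/asboolP.
Qed.

Lemma word_class_repr (g : presented) : word_class (repr g) = g.
Proof. exact: reprK. Qed.

Lemma pres_eq_repr w : pres_eq R (repr (word_class w)) w.
Proof. by apply/word_classP; rewrite word_class_repr. Qed.

Definition pres_mul (g h : presented) : presented :=
  word_class (repr g ++ repr h).
Definition pres_inv (g : presented) : presented :=
  word_class (inv_word (repr g)).
Definition pres_one : presented := word_class [::].

Lemma pres_mulE u v :
  pres_mul (word_class u) (word_class v) = word_class (u ++ v).
Proof. by apply/word_classP/pres_eq_cat; apply: pres_eq_repr. Qed.

Lemma pres_invE u : pres_inv (word_class u) = word_class (inv_word u).
Proof. exact/word_classP/pres_eq_inv/pres_eq_repr. Qed.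

Lemma presW (P : presented -> Prop) :
  (forall w, P (word_class w)) -> forall g, P g.
Proof. by move=> Pw g; rewrite -(word_class_repr g). Qed.

Lemma pres_mulA : associative pres_mul.
Proof.
by elim/presW=> u; elim/presW=> v; elim/presW=> w; rewrite !pres_mulE catA.
Qed.
Lemma pres_mul1 : left_id pres_one pres_mul.
Proof. by elim/presW=> u; rewrite pres_mulE. Qed.
Lemma pres_mulr1 : right_id pres_one pres_mul.
Proof. by elim/presW=> u; rewrite pres_mulE cats0. Qed.
Lemma pres_mulVg : left_inverse pres_one pres_inv pres_mul.
Proof.
elim/presW=> u; rewrite pres_invE pres_mulE.
exact/word_classP/pres_eq_mulVl.
Qed.
Lemma pres_mulgV : right_inverse pres_one pres_inv pres_mul.
Proof.
elim/presW=> u; rewrite pres_invE pres_mulE.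
exact/word_classP/pres_eq_mulV.
Qed.

HB.instance Definition _ := isGroup.Build presented
  pres_mulA pres_mul1 pres_mulr1 pres_mulVg pres_mulgV.

Lemma word_class_cat u v : word_class (u ++ v) = word_class u * word_class v.
Proof. by rewrite -pres_mulE. Qed.

Lemma word_class_inv u : word_class (inv_word u) = (word_class u)^-1.
Proof. by rewrite -pres_invE. Qed.

End Presented.

Definition free_group (k : nat) := presented (fun _ _ : word 'I_k => False).
HB.instance Definition _ k := Group.on (free_group k).

Definition kernel (G H : groupType) (f : G -> H) : set G :=
  [set x | f x = 1]%classic.

Definition short_exact (N G Q : groupType) (f : {multiplicative N -> G})
    (p : {multiplicative G -> Q}) : Prop :=
  [/\ injective f, range f = kernel p & forall q, exists g, p g = q].

(* The left cosets of the subgroup H have a transversal indexed by 'I_k. *)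
Definition has_index (G : groupType) (H : set G) (k : nat) : Prop :=
  exists t : 'I_k -> G, forall g, exists! i, H ((t i)^-1 * g).

Record normal_subgroup (G : groupType) := NormalSubgroup {
  nsg_set :> G -> Prop;
  nsg1 : nsg_set 1;
  nsgM : forall x y, nsg_set x -> nsg_set y -> nsg_set (x * y);
  nsgV : forall x, nsg_set x -> nsg_set x^-1;
  nsgJ : forall g x, nsg_set x -> nsg_set (g * x * g^-1)
}.

Section Quotient.
Variables (G : groupType) (N : normal_subgroup G).
Implicit Types x y z : G.

Definition coset_eq x y : bool := `[< N (x^-1 * y) >].

Lemma coset_eq_refl : reflexive coset_eq.
Proof. by move=> x; apply/asboolP; rewrite mulVg; apply: nsg1. Qed.

Lemma coset_eq_sym : symmetric coset_eq.
Proof.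
by move=> x y; apply/asboolP/asboolP => /nsgV; rewrite invgM invgK.
Qed.

Lemma coset_eq_trans : transitive coset_eq.
Proof.
move=> y x z /asboolP xy /asboolP yz; apply/asboolP.
by rewrite -(mulVKg y z) mulgA; apply: nsgM.
Qed.

Canonical coset_equiv := EquivRel coset_eq coset_eq_refl coset_eq_sym coset_eq_trans.

Definition quotient_group := {eq_quot coset_equiv}.
HB.instance Definition _ := Choice.on quotient_group.
HB.instance Definition _ := Quotient.on quotient_group.

Definition proj x : quotient_group := \pi_quotient_group x.

Lemma projP x y : proj x = proj y <-> N (x^-1 * y).
Proof.
split; first by move=> /eqmodP/asboolP.
by move=> xy; apply/eqmodP/asboolP.
Qed.

Lemma proj_repr (q : quotient_group) : proj (repr q) = q.
Proof. exact: reprK. Qed.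

Lemma repr_projP x : N ((repr (proj x))^-1 * x).
Proof. by apply/projP; rewrite proj_repr. Qed.

Lemma projW (P : quotient_group -> Prop) :
  (forall x, P (proj x)) -> forall q, P q.
Proof. by move=> Px q; rewrite -(proj_repr q). Qed.

Definition quo_mul (p q : quotient_group) := proj (repr p * repr q).
Definition quo_inv (q : quotient_group) := proj (repr q)^-1.

Lemma quo_mulE x y : quo_mul (proj x) (proj y) = proj (x * y).
Proof.
apply/projP; rewrite invgM.
have := nsgM (repr_projP y) (nsgJ y^-1 (repr_projP x)).
by rewrite !invgK !mulgA mulgK.
Qed.

Lemma quo_invE x : quo_inv (proj x) = proj x^-1.
Proof.
apply/projP; rewrite invgK.
have := nsgJ x (nsgV (repr_projP x)).
by rewrite invgM invgK !mulgA mulgV mul1g.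
Qed.

Lemma quo_mulA : associative quo_mul.
Proof.
by elim/projW=> u; elim/projW=> v; elim/projW=> w; rewrite !quo_mulE mulgA.
Qed.
Lemma quo_mul1 : left_id (proj 1) quo_mul.
Proof. by elim/projW=> u; rewrite quo_mulE mul1g. Qed.
Lemma quo_mulr1 : right_id (proj 1) quo_mul.
Proof. by elim/projW=> u; rewrite quo_mulE mulg1. Qed.
Lemma quo_mulVg : left_inverse (proj 1) quo_inv quo_mul.
Proof. by elim/projW=> u; rewrite quo_invE quo_mulE mulVg. Qed.
Lemma quo_mulgV : right_inverse (proj 1) quo_inv quo_mul.
Proof. by elim/projW=> u; rewrite quo_invE quo_mulE mulgV. Qed.

HB.instance Definition _ := isGroup.Build quotient_group
  quo_mulA quo_mul1 quo_mulr1 quo_mulVg quo_mulgV.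

Lemma projM : {morph proj : x y / x * y}.
Proof. by move=> x y; rewrite -quo_mulE. Qed.
HB.instance Definition _ := isMultiplicative.Build G quotient_group proj projM.

End Quotient.

Section Center.
Variable G : groupType.

Definition center_set (z : G) : Prop := forall x, z * x = x * z.

Lemma center1 : center_set 1.
Proof. by move=> x; rewrite mul1g mulg1. Qed.
Lemma centerM x y : center_set x -> center_set y -> center_set (x * y).
Proof.
by move=> zx zy g; rewrite -mulgA zy mulgA (zx g) mulgA.
Qed.
Lemma centerV x : center_set x -> center_set x^-1.
Proof.
move=> zx g; apply: (can_inj (mulKg x)); apply: (can_inj (mulgK x)).
by rewrite mulVKg mulgA zx mulgK -zx.
Qed.
Lemma centerJ g x : center_set x -> center_set (g * x * g^-1).
Proof. by move=> zx; rewrite -zx mulgK. Qed.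

Definition center := NormalSubgroup center1 centerM centerV centerJ.

End Center.

Record automorphism (G : groupType) := Automorphism {
  aut_fun :> G -> G;
  aut_inv : G -> G;
  aut_morph : {morph aut_fun : x y / x * y};
  aut_funK : cancel aut_fun aut_inv;
  aut_invK : cancel aut_inv aut_fun
}.

HB.instance Definition _ G := gen_eqMixin (automorphism G).
HB.instance Definition _ G := gen_choiceMixin (automorphism G).

Section AutGroup.
Variable G : groupType.
Implicit Types f g h : automorphism G.

Lemma aut_eqP f g : (f =1 g) -> f = g.
Proof.
case: f g => [f f' fM fK f'K] [g g' gM gK g'K] /= /funext fg.
case: _ / fg in gM gK g'K *.
have fg' : f' = g' by apply/funext=> x; rewrite -{1}(g'K x) fK.
case: _ / fg' in gK g'K *.
by congr Automorphism; apply: Prop_irrelevance.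
Qed.

Definition aut_one : automorphism G :=
  @Automorphism G id id (fun _ _ => erefl) (fun _ => erefl) (fun _ => erefl).

Lemma aut_mul_morph f g : {morph f \o g : x y / x * y}.
Proof. by move=> x y; rewrite /= !aut_morph. Qed.

(* (f * g) x = f (g x), so that g |-> (x |-> g x g^-1) is a morphism. *)
Definition aut_mul f g : automorphism G :=
  Automorphism (@aut_mul_morph f g)
    (can_comp (aut_funK f) (aut_funK g)) (can_comp (aut_invK g) (aut_invK f)).

Lemma aut_inv_morph f : {morph aut_inv f : x y / x * y}.
Proof.
by move=> x y; apply: (can_inj (aut_funK f)); rewrite aut_morph !aut_invK.
Qed.

Definition aut_V f : automorphism G :=
  Automorphism (@aut_inv_morph f) (aut_invK f) (aut_funK f).

Lemma aut_mulA : associative aut_mul.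
Proof. by move=> f g h; apply: aut_eqP. Qed.
Lemma aut_mul1 : left_id aut_one aut_mul.
Proof. by move=> f; apply: aut_eqP. Qed.
Lemma aut_mulr1 : right_id aut_one aut_mul.
Proof. by move=> f; apply: aut_eqP. Qed.
Lemma aut_mulVg : left_inverse aut_one aut_V aut_mul.
Proof. by move=> f; apply: aut_eqP => x /=; rewrite aut_funK. Qed.
Lemma aut_mulgV : right_inverse aut_one aut_V aut_mul.
Proof. by move=> f; apply: aut_eqP => x /=; rewrite aut_invK. Qed.

HB.instance Definition _ := isGroup.Build (automorphism G)
  aut_mulA aut_mul1 aut_mulr1 aut_mulVg aut_mulgV.

End AutGroup.

(* Strands and positions are numbered from 0, so the ordinal i is the       *)
(* generator sigma_(i+1) of the braid group on n strands.                   *)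
Inductive braid_rel (n : nat) : word 'I_n.-1 -> word 'I_n.-1 -> Prop :=
| BraidFar (i j : 'I_n.-1) : i.+1 < j ->
    braid_rel [:: (i, false); (j, false)] [:: (j, false); (i, false)]
| BraidNear (i j : 'I_n.-1) : j = i.+1 :> nat ->
    braid_rel [:: (i, false); (j, false); (i, false)]
              [:: (j, false); (i, false); (j, false)].

Definition braid (n : nat) := presented (@braid_rel n).
HB.instance Definition _ n := Group.on (braid n).

(* The position, after the crossing of positions j and j+1, of the strand   *)
(* that was in position p.                                                  *)
Definition cross (j p : nat) : nat :=
  if p == j then j.+1 else if p == j.+1 then j else p.

(* The final position of the strand that starts in position p; words are    *)
(* read from left to right.                                                 *)
Fixpoint strand_end (m p : nat) (w : word 'I_m) : nat :=
  if w is (j, _) :: w' then strand_end (cross j p) w' else p.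

Lemma crossK j : involutive (cross j).
Proof. by move=> p; rewrite /cross; do !case: eqP; lia. Qed.

Lemma strand_end_cat m p (u v : word 'I_m) :
  strand_end p (u ++ v) = strand_end (strand_end p u) v.
Proof. by elim: u p => [|[j e] u IH] p //=. Qed.

Lemma strand_end_inv m p (w : word 'I_m) :
  strand_end (strand_end p w) (inv_word w) = p.
Proof.
elim: w p => [|[j e] w IH] p //.
by rewrite -cat1s inv_word_cat !strand_end_cat IH /= crossK.
Qed.

Lemma strand_end_pres n p (u v : word 'I_n.-1) :
  pres_eq (@braid_rel n) u v -> strand_end p u = strand_end p v.
Proof.
move=> uv; elim: uv p => {u v} // [u v w _ H1 _ H2|s u v t Ruv|s [j e] t] p.
- by rewrite H1 H2.
- rewrite !strand_end_cat; congr strand_end.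
  move: (strand_end p s) => {}p.
  by case: Ruv => i j ij /=; rewrite /cross; do !case: eqP; lia.
- by rewrite !strand_end_cat /= crossK.
Qed.

Definition pure_word n (w : word 'I_n.-1) : bool :=
  [forall p : 'I_n, strand_end p w == p].

Definition is_pure n (b : braid n) : bool := pure_word (repr b).

Lemma pure_wordP n (w : word 'I_n.-1) :
  reflect (forall p, p < n -> strand_end p w = p) (pure_word w).
Proof.
apply: (iffP forallP) => [H p pn|H p]; first exact: (eqP (H (Ordinal pn))).
exact/eqP/H.
Qed.

Lemma pure_word_pres n (u v : word 'I_n.-1) :
  pres_eq (@braid_rel n) u v -> pure_word u = pure_word v.
Proof.
by move=> uv; apply: eq_forallb => p; rewrite (strand_end_pres p uv).
Qed.

Lemma is_pureE n (w : word 'I_n.-1) :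
  is_pure (word_class (@braid_rel n) w) = pure_word w.
Proof. exact/pure_word_pres/pres_eq_repr. Qed.

Lemma is_pure_closed n : group_closed (@is_pure n : {pred braid n}).
Proof.
have H1 : is_pure (word_class (@braid_rel n) [::]).
  by rewrite is_pureE; apply/pure_wordP.
split; first exact: H1.
elim/presW=> u; elim/presW=> v; rewrite -!topredE /=.
rewrite -word_class_inv -word_class_cat !is_pureE => /pure_wordP Hu /pure_wordP Hv.
apply/pure_wordP=> p pn; rewrite strand_end_cat Hu //.
by rewrite -{1}(Hv p pn) strand_end_inv.
Qed.

Record pure_braid (n : nat) := PureBraid {
  braid_of :> braid n;
  _ : is_pure braid_of
}.

HB.instance Definition _ n := [isSub of pure_braid n for @braid_of n].
HB.instance Definition _ n := [Choice of pure_braid n by <:].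
HB.instance Definition _ n :=
  SubChoice_isSubGroup.Build _ (@is_pure n) (pure_braid n) (@is_pure_closed n).

Definition pure_quotient (n : nat) := quotient_group (center (pure_braid n)).
HB.instance Definition _ n := Group.on (pure_quotient n).

(* Erase the strand that starts in position i: its crossings disappear, and *)
(* a crossing of positions j, j+1 to its right becomes one of j-1, j. The   *)
(* insub never fails as long as i <= m.                                     *)
Fixpoint forget_word (m i : nat) (w : word 'I_m) : word 'I_m.-1 :=
  if w is (j, e) :: w' then
    let rest := forget_word (cross j i) w' in
    if (i == j) || (i == j.+1) then rest
    else if insub (unbump i j) is Some j' then (j', e) :: rest else rest
  else [::].

Lemma forget_cat m i (u v : word 'I_m) :
  forget_word i (u ++ v) = forget_word i u ++ forget_word (strand_end i u) v.
Proof.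
elim: u i => [|[j e] u IH] i //=; rewrite IH.
by case: ifP => // _; case: insubP.
Qed.

Lemma unbump_lt m i (j : 'I_m) :
  i <= m -> i <> j :> nat -> i <> j.+1 :> nat -> unbump i j < m.-1.
Proof. by rewrite /unbump; have := ltn_ord j; case: ltnP; lia. Qed.

Lemma forget_letter m i (j : 'I_m) e (w : word 'I_m) : i <= m ->
  [\/ i = j /\ forget_word i ((j, e) :: w) = forget_word j.+1 w,
      i = j.+1 /\ forget_word i ((j, e) :: w) = forget_word j w,
      i < j /\ exists j' : 'I_m.-1, j = j'.+1 :> nat /\
        forget_word i ((j, e) :: w) = (j', e) :: forget_word i w
    | j.+1 < i /\ exists j' : 'I_m.-1, j = j' :> nat /\
        forget_word i ((j, e) :: w) = (j', e) :: forget_word i w].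
Proof.
move=> im /=; rewrite /cross.
have [ij|/eqP ij] := eqVneq i j; first by constructor 1.
have [ij1|/eqP ij1] := eqVneq i j.+1; first by constructor 2.
have [ltij|leji] := ltnP i j; [constructor 3 | constructor 4];
  (split; first lia); exists (Ordinal (unbump_lt im ij ij1));
  rewrite (insubT (fun k => k < m.-1) (unbump_lt im ij ij1)); split=> //=;
  rewrite /unbump; lia.
Qed.

Lemma cross_le m i (j : 'I_m) : i <= m -> cross j i <= m.
Proof. by rewrite /cross; have := ltn_ord j; do !case: eqP; lia. Qed.

Lemma strand_end_le m i (w : word 'I_m) : i <= m -> strand_end i w <= m.
Proof. by elim: w i => [|[j e] w IH] i //= im; apply/IH/cross_le. Qed.

Ltac forget_step n :=
  match goal with |- context [@forget_word _ ?p ((?x, ?e) :: ?w)] =>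
    let lepn := fresh "lepn" in
    (have lepn : p <= n by lia);
    let E := fresh "E" in let F := fresh "F" in let x' := fresh "x" in
    let E' := fresh "G" in
    case: (@forget_letter n p x e w lepn) =>
      [[E F]|[E F]|[E [x' [E' F]]]|[E [x' [E' F]]]]; rewrite F {F lepn};
    try (exfalso; lia)
  end.

Lemma ordE (m : nat) (x y : 'I_m) : x = y :> nat -> x = y.
Proof. exact: val_inj. Qed.

Lemma braid_relE n a b : @braid_rel n a b -> pres_eq (@braid_rel n) a b.
Proof. by move=> /(@PresRel _ _ [::] _ _ [::]); rewrite !cats0. Qed.

Lemma forget_rel n i (u v : word 'I_n) : i <= n -> @braid_rel n.+1 u v ->
  pres_eq (@braid_rel n) (forget_word i u) (forget_word i v).
Proof.
(* n.+1.-1 must be reduced for lia to identify the ordinals. *)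
move=> ile; case; rewrite [n.+1.-1]/= => j k jk;
  have ltj := ltn_ord j; have ltk := ltn_ord k.
- repeat forget_step n; rewrite /=;
    match goal with
    | |- pres_eq _ [:: (?a, _)] [:: (?b, _)] =>
        have -> : a = b by apply: ordE; lia
    | |- pres_eq _ [:: (?a, _); (?b, _)] [:: (?c, _); (?d, _)] =>
        (have -> : c = b by apply: ordE; lia);
        (have -> : d = a by apply: ordE; lia)
    end; try exact: PresRefl; apply/braid_relE/BraidFar; lia.
- repeat forget_step n; rewrite /=;
    match goal with
    | |- pres_eq _ [:: (?a, _)] [:: (?b, _)] =>
        have -> : a = b by apply: ordE; lia
    | |- pres_eq _ [:: (?a, _); (?b, _); (?c, _)]
                   [:: (?d, _); (?e, _); (?f, _)] =>
        (have -> : c = a by apply: ordE; lia);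
        (have -> : e = a by apply: ordE; lia);
        (have -> : d = b by apply: ordE; lia);
        (have -> : f = b by apply: ordE; lia)
    end; try exact: PresRefl; apply/braid_relE/BraidNear; lia.
Qed.

Lemma forget_pres n i (u v : word 'I_n) : i <= n ->
  pres_eq (@braid_rel n.+1) u v ->
  pres_eq (@braid_rel n) (forget_word i u) (forget_word i v).
Proof.
move=> ile uv; elim: uv i ile => {u v} [u|u v _ H|u v w _ H1 _ H2|s u v t Ruv|s l t] i ile.
- exact: PresRefl.
- exact/PresSym/H.
- exact: PresTrans (H1 _ ile) (H2 _ ile).
- have ple := strand_end_le s ile.
  have Ev := strand_end_pres (strand_end i s) (braid_relE Ruv).
  rewrite !forget_cat Ev; apply: pres_eq_cat; first exact: PresRefl.
  by apply: pres_eq_cat; [exact: forget_rel | exact: PresRefl].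
- have ple := strand_end_le s ile.
  rewrite !forget_cat; apply: pres_eq_cat; first exact: PresRefl.
  move: (strand_end i s) ple => p ple {s i ile}.
  rewrite -[X in pres_eq _ _ X]cat0s; apply: pres_eq_cat; last first.
    by case: l => j e; rewrite /= crossK; apply: PresRefl.
  case: l => j e; rewrite /inv_letter [(j, e).1]/= [(j, e).2]/=.
  rewrite [n.+1.-1]/= in j *; have ltj := ltn_ord j.
  repeat forget_step n; rewrite /=; try exact: PresRefl.
    rewrite (@ordE _ x0 x); last lia.
    exact: (PresCancel _ [::] (x, e) [::]).
  rewrite (@ordE _ x0 x); last lia.
  exact: (PresCancel _ [::] (x, e) [::]).
Qed.

(* Strand p of w is strand unbump i p of the braid with strand i erased. *)
Lemma strand_end_forget m i p (w : word 'I_m) : i <= m -> p <> i ->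
  strand_end (unbump i p) (forget_word i w)
    = unbump (strand_end i w) (strand_end p w).
Proof.
elim: w i p => [|[j e] w IH] i p ile pi //.
have ltj := ltn_ord j.
have Hc : cross j p <> cross j i by move/(can_inj (crossK j)).
rewrite [in RHS]/= -(IH _ _ (cross_le j ile) Hc) {IH}.
have [[E ->]|[E ->]|[E [x [Ex ->]]]|[E [x [Ex ->]]]] := @forget_letter m i j e w ile.
- have -> : cross j i = j.+1 by rewrite /cross E eqxx.
  congr strand_end; rewrite /cross /unbump; do !case: eqP; lia.
- have -> : cross j i = j by rewrite /cross E; do !case: eqP; lia.
  congr strand_end; rewrite /cross /unbump; do !case: eqP; lia.
- have -> : cross j i = i by rewrite /cross; do !case: eqP; lia.
  rewrite [LHS]/=; congr strand_end; rewrite /cross /unbump; do !case: eqP; lia.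
- have -> : cross j i = i by rewrite /cross; do !case: eqP; lia.
  rewrite [LHS]/=; congr strand_end; rewrite /cross /unbump; do !case: eqP; lia.
Qed.

Lemma forget_pure n (i : 'I_n.+1) (w : word 'I_n) :
  pure_word (n := n.+1) w -> pure_word (n := n) (forget_word i w).
Proof.
move=> /pure_wordP Pw; apply/pure_wordP=> q qn.
have ltb : bump i q < n.+1 by rewrite /bump; lia.
have := @strand_end_forget n i (bump i q) w (ltn_ord i).
rewrite bumpK (Pw _ ltb) (Pw _ (ltn_ord i)) bumpK; apply.
by rewrite /bump; lia.
Qed.

Lemma forget_is_pure n (i : 'I_n.+1) (b : pure_braid n.+1) :
  is_pure (word_class (@braid_rel n) (forget_word i (repr (braid_of b)))).
Proof. by rewrite is_pureE; apply: forget_pure; apply: (valP b). Qed.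

(* Theta_i; forget_strandE shows that any word for b may be used. *)
Definition forget_strand n (i : 'I_n.+1) (b : pure_braid n.+1) : pure_braid n :=
  PureBraid (forget_is_pure i b).

Lemma forget_strandE n (i : 'I_n.+1) (b : pure_braid n.+1) (w : word 'I_n) :
  braid_of b = word_class _ w ->
  braid_of (forget_strand i b) = word_class _ (forget_word i w).
Proof.
move=> bw; apply/word_classP/forget_pres; first exact: (ltn_ord i).
by rewrite bw; apply: pres_eq_repr.
Qed.

Lemma forget_strandM n (i : 'I_n.+1) : {morph @forget_strand n i : x y / x * y}.
Proof.
move=> x y; apply: val_inj.
have xyE : braid_of (x * y) =
    word_class _ (repr (braid_of x) ++ repr (braid_of y)).
  by rewrite word_class_cat !word_class_repr; apply: valM.
rewrite [LHS](forget_strandE i xyE) forget_cat word_class_cat.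
have /pure_wordP -> // : pure_word (n := n.+1) (repr (braid_of x)).
exact: (valP x).
Qed.

HB.instance Definition _ n i :=
  isMultiplicative.Build _ _ _ (@forget_strandM n i).

(* Any pure word is obtained by erasing strand i of some pure word. *)
Lemma forget_word_onto n i (w : word 'I_n.-1) : i < n.+1 -> pure_word w ->
  exists2 u : word 'I_n, pure_word (n := n.+1) u & forget_word i u = w.
Proof.
case: n w => [|m] w.
  move=> _ _; exists [::]; first by apply/pure_wordP.
  by case: w => // -[[]].
elim: i => [|i IH] ile Pw.
  exists [seq (lift ord0 l.1, l.2) | l <- w].
    have shiftE p : strand_end p.+1 [seq (lift ord0 l.1, l.2) | l <- w]
                    = (strand_end p w).+1.
      elim: w p {Pw} => [|[j e] w IHw] p //=.
      rewrite -IHw; congr strand_end; rewrite /cross /= /bump /=.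
      by do !case: eqP; lia.
    have shift0 : strand_end 0 [seq (lift ord0 l.1, l.2) | l <- w] = 0.
      by elim: (w) => [|[j e] w' IHw] //=.
    apply/pure_wordP=> -[|p] pn //; rewrite shiftE.
    by move/pure_wordP: Pw => -> //; lia.
  elim: w {Pw} => [|[j e] w IHw] //.
  have := @forget_letter m.+1 0 (lift ord0 j) e [seq (lift ord0 l.1, l.2) | l <- w] isT.
  rewrite /= /bump /= => -[[]|[]|[_ [x [xj E]]]|[]] //.
  have ex : x = j by apply: ordE => /=; lia.
  by rewrite [LHS]E IHw ex.
have im : i < m.+1 by lia.
have [u Pu Eu] := IH (ltnW ile) Pw.
pose s := Ordinal im.
exists ([:: (s, false)] ++ u ++ [:: (s, true)]).
  apply/pure_wordP=> p pn; rewrite !strand_end_cat /=.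
  move/pure_wordP: Pu => ->; first by rewrite crossK.
  exact: (@cross_le m.+1 p s).
rewrite !forget_cat.
have -> : forget_word i.+1 [:: (s, false)] = [::].
  by rewrite /= eqxx orbT.
have -> : strand_end i.+1 [:: (s, false)] = i.
  by rewrite /= /cross; do !case: eqP => /=; lia.
have /pure_wordP/(_ _ (ltnW im)) -> := Pu.
by rewrite Eu /= eqxx cats0.
Qed.

Lemma multiplicativeV (G H : groupType) (f : {multiplicative G -> H}) x :
  f x^-1 = (f x)^-1.
Proof.
have f1 : f 1 = 1 by apply: (can_inj (mulKg (f 1))); rewrite -gmulfM !mulg1.
by apply: (can_inj (mulKg (f x))); rewrite -gmulfM !mulgV.
Qed.

Lemma forget_strand_onto n (i : 'I_n.+1) (b : pure_braid n) :
  exists b', forget_strand i b' = b.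
Proof.
have Pb : pure_word (repr (braid_of b)) := valP b.
have [u Pu Eu] := forget_word_onto (ltn_ord i) Pb.
have Pu' : is_pure (word_class (@braid_rel n.+1) u) by rewrite is_pureE.
exists (PureBraid Pu'); apply: val_inj.
by rewrite [LHS](@forget_strandE _ _ _ u) // Eu word_class_repr.
Qed.

Lemma forget_strand_center n (i : 'I_n.+1) (z : pure_braid n.+1) :
  center (pure_braid n.+1) z -> center (pure_braid n) (forget_strand i z).
Proof.
move=> Zz x; have [y <-] := forget_strand_onto i x.
by rewrite -!gmulfM Zz.
Qed.

(* theta_i; forget_quotientE shows that it is induced by Theta_i. *)
Definition forget_quotient n (i : 'I_n.+1) (k : pure_quotient n.+1) :
    pure_quotient n :=
  proj (center (pure_braid n)) (forget_strand i (repr k)).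

Lemma forget_quotientE n (i : 'I_n.+1) (b : pure_braid n.+1) :
  forget_quotient i (proj _ b) = proj _ (forget_strand i b).
Proof.
apply/projP; have := forget_strand_center i (repr_projP (center _) b).
by rewrite gmulfM multiplicativeV.
Qed.

Lemma forget_quotientM n (i : 'I_n.+1) :
  {morph @forget_quotient n i : x y / x * y}.
Proof.
elim/projW=> x; elim/projW=> y.
by rewrite -projM !forget_quotientE gmulfM projM.
Qed.

HB.instance Definition _ n i :=
  isMultiplicative.Build _ _ _ (@forget_quotientM n i).

Definition free_gen (k : nat) (i : 'I_k) : free_group k := gen _ i.

Definition sigma (n : nat) (i : 'I_n.-1) : braid n := gen _ i.

Definition sigma1 : braid 4 := @sigma 4 (@Ordinal 3 0 isT).
Definition sigma2 : braid 4 := @sigma 4 (@Ordinal 3 1 isT).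
Definition sigma3 : braid 4 := @sigma 4 (@Ordinal 3 2 isT).

Definition dfg_a : braid 4 := sigma1 * sigma3^-1.
Definition dfg_b : braid 4 := sigma2 * sigma1 * sigma3^-1 * sigma2^-1.

Definition K4 := pure_quotient 4.
HB.instance Definition _ := Group.on K4.

(* iota identifies F_2 with the normal subgroup <a, b> of B_4, and rho is    *)
(* the conjugation action of K_4 on it (in particular iota and rho are       *)
(* uniquely determined).                                                     *)
Definition conjugation_action (iota : {multiplicative free_group 2 -> braid 4})
    (rho : {multiplicative K4 -> automorphism (free_group 2)}) : Prop :=
  [/\ iota (free_gen (@Ordinal 2 0 isT)) = dfg_a /\
      iota (free_gen (@Ordinal 2 1 isT)) = dfg_b,
      injective iota,
      forall (g : braid 4) w, exists w', g * iota w * g^-1 = iota w'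
    & forall (p : pure_braid 4) w,
        iota (rho (proj _ p) w) = braid_of p * iota w * (braid_of p)^-1].

Definition arises_from_strand_forgetting (N : set K4) : Prop :=
  exists i : 'I_4, N = kernel (@forget_quotient 3 i).

(* Main.v *)
(** The conjugation action alpha of B_4 on F_2 = <a, b> satisfies
    alpha (x) = inner (x) for x in F_2, so F_2 embeds in B_4. Since
    B_4 = F_2 . <sigma_1, sigma_2>, the kernel of alpha reduces to the kernel
    of <sigma_1, sigma_2> -> SL_2(Z), which is generated by the square of the
    full twist: up to powers of the full twist, every 3-braid is a positive
    word in sigma_1, sigma_2^-1 times a torsion element, and such words act by
    nonnegative matrices. Hence ker alpha = Z(B_4). A Nielsen reduction shows
    that alpha (B_4), together with one orientation-reversing automorphism,
    gives all of Aut(F_2), so that P_4 / Z(P_4) has index 2 * 24.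

    For the extensions, the loops of the last strand around the others
    generate the kernel of the map forgetting it (the coset table of
    P_4 in B_4), and freely so because the Hurwitz action on a rack records
    the word; the other strands follow by conjugation. The fifth map is
    induced by the homomorphism B_4 -> B_3 sending sigma_1, sigma_2, sigma_3
    to sigma_1, sigma_2, sigma_1. Its kernel is generated by the full twists
    of three strands; these generate a free group because Artin's action on
    <x1, ..., x4 | x1 x2 x3 x4> sends them to the conjugations by the x_i.
    The full twist of the strands other than i lies in the fifth kernel and
    is killed by forgetting strand j exactly when j = i, which separates the
    five kernels. *)

Require Import Defs.
From HB Require Import structures.
From mathcomp Require Import all_boot ssralg ssrnum ssrint zify ring.
From mathcomp Require Import boolp classical_sets.

Set Implicit Arguments.
Unset Strict Implicit.
Unset Printing Implicit Defensive.

Local Open Scope group_scope.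

(** * Presented groups and free reduction *)

(** Equality of braids comes with no decision procedure, so every concrete braid identity is settled
    by computation, running Dehornoy's word reversing on explicit words; only its soundness is
    proved. Free groups get a genuine normal form. Two obstacles shape the rest. First, [K4] is a
    quotient by the center of P_4, whereas the kernel of [alpha] is computed in B_4, and [a], [b]
    are not pure. That [alpha] kills the center of P_4 uses that the squares of [a] and [b] are
    pure, and that a basis element of a free group is the only square root of its square. Second,
    all kernels are taken modulo centers: a braid in such a kernel maps to some power of the full
    twist on three strands, not necessarily to 1. For each of the five maps this twist is lifted to
    B_4 and rewritten as a fiber element times a power of the full twist on four strands. The fibers
    survive the passage to [K4] because an embedded free group of rank at least two meets the center
    trivially. *)

Section MultiplicativeTheory.
Variables (G H : groupType) (h : {multiplicative G -> H}).

Lemma multiplicative1 : h 1 = 1.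
Proof. by apply: (can_inj (mulKg (h 1))); rewrite -gmulfM !mulg1. Qed.

Lemma multiplicative_inj : (forall x, h x = 1 -> x = 1) -> injective h.
Proof.
move=> h1 x y hxy; apply/divg1_eq/h1.
by rewrite gmulfM multiplicativeV hxy mulgV.
Qed.

End MultiplicativeTheory.

Section Eval.
Variables (X : Type) (G : groupType).
Implicit Types (f : X -> G) (u v w : word X).

Definition eval_letter f (l : X * bool) : G := if l.2 then (f l.1)^-1 else f l.1.

Definition eval f w : G := foldr (fun l g => eval_letter f l * g) 1 w.

Lemma eval_cat f u v : eval f (u ++ v) = eval f u * eval f v.
Proof. by elim: u => [|l u IH] /=; rewrite ?mul1g // IH mulgA. Qed.

Lemma eval_inv_letter f l : eval_letter f (inv_letter l) = (eval_letter f l)^-1.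
Proof. by case: l => x [] /=; rewrite /eval_letter //= invgK. Qed.

Lemma eval_pres f (R : word X -> word X -> Prop) u v :
  (forall u v, R u v -> eval f u = eval f v) ->
  pres_eq R u v -> eval f u = eval f v.
Proof.
move=> fR; elim=> {u v} // [u v w _ -> _ ->|s u v t /fR uv|s l t] //.
  by rewrite !eval_cat uv.
by rewrite !eval_cat /= eval_inv_letter mulg1 mulgV mul1g.
Qed.

Lemma eq_eval f g w : f =1 g -> eval f w = eval g w.
Proof. by move=> fg; elim: w => //= l w ->; rewrite /eval_letter !fg. Qed.

End Eval.

Lemma eval_morph (X : Type) (G H : groupType) (h : {multiplicative G -> H})
  (f : X -> G) w : h (eval f w) = eval (fun x => h (f x)) w.
Proof.
elim: w => [|[x []] w IH] /=; first exact: multiplicative1.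
  by rewrite gmulfM IH /eval_letter /= multiplicativeV.
by rewrite gmulfM IH.
Qed.

Section Lift.
Variables (X : choiceType) (R : word X -> word X -> Prop).

Lemma word_class_eval w : word_class R w = eval (gen R) w.
Proof.
elim: w => [|[x b] w IH] //; rewrite -cat1s word_class_cat IH /=.
by congr (_ * _); case: b; rewrite /eval_letter //= /gen -word_class_inv.
Qed.

Lemma presented_ext (G : groupType) (h k : {multiplicative presented R -> G}) :
  (forall x, h (gen R x) = k (gen R x)) -> h =1 k.
Proof.
move=> hk; elim/presW=> w; rewrite word_class_eval !eval_morph.
exact: eq_eval.
Qed.

Lemma presented_ind (P : presented R -> Prop) :
  P 1 -> (forall x, P (gen R x)) -> (forall g h, P g -> P h -> P (g * h)) ->
  (forall g, P g -> P g^-1) -> forall g, P g.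
Proof.
move=> P1 Pgen PM PV; elim/presW=> w; rewrite word_class_eval.
elim: w => //= -[x b] w IH; apply: PM => //.
by case: b; [apply: PV | ]; apply: Pgen.
Qed.

Variables (G : groupType) (f : X -> G).
Hypothesis fR : forall u v, R u v -> eval f u = eval f v.

Definition pres_lift of (forall u v, R u v -> eval f u = eval f v) :
  presented R -> G := fun g => eval f (repr g).

Lemma pres_liftE w : pres_lift fR (word_class R w) = eval f w.
Proof. exact/(eval_pres fR)/pres_eq_repr. Qed.

Lemma pres_liftM : {morph pres_lift fR : x y / x * y}.
Proof.
elim/presW=> u; elim/presW=> v.
by rewrite -word_class_cat !pres_liftE eval_cat.
Qed.

HB.instance Definition _ :=
  isMultiplicative.Build (presented R) G (pres_lift fR) pres_liftM.

Lemma pres_lift_gen x : pres_lift fR (gen R x) = f x.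
Proof. by rewrite pres_liftE /= mulg1. Qed.

End Lift.

Definition word_subst (X Y : Type) (f : X -> word Y) (w : word X) : word Y :=
  flatten [seq (if l.2 then inv_word (f l.1) else f l.1) | l <- w].

Lemma eval_word_class (X : Type) (Y : choiceType) (R : word Y -> word Y -> Prop)
    (f : X -> word Y) (w : word X) :
  eval (fun x => word_class R (f x)) w = word_class R (word_subst f w).
Proof.
elim: w => //= -[x b] w ->; rewrite word_class_cat; congr (_ * _).
by case: b; rewrite // word_class_inv.
Qed.

(* Locked, so that a product of group elements never unifies with the class *)
(* of an unknown word.                                                       *)
Fact class_key : unit. Proof. by []. Qed.

Section FreeClass.
Variable k : nat.
Implicit Types u v w : word 'I_k.

Definition free_class w : free_group k := locked_with class_key (word_class _ w).
Canonical free_class_unlockable w := [unlockable of free_class w].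

Lemma freeW (P : free_group k -> Prop) :
  (forall w, P (free_class w)) -> forall g, P g.
Proof. by move=> Pw; elim/presW=> w; have := Pw w; rewrite unlock. Qed.

Lemma free_class_eval w : free_class w = eval (@free_gen k) w.
Proof. by rewrite unlock; apply: word_class_eval. Qed.

Lemma free_class_cat u v : free_class (u ++ v) = free_class u * free_class v.
Proof. by rewrite !free_class_eval eval_cat. Qed.

Lemma free_class_inv u : free_class (inv_word u) = (free_class u)^-1.
Proof. by rewrite !unlock; apply: word_class_inv. Qed.

Lemma free_class_letter i b :
  free_class [:: (i, b)] = if b then (free_gen i)^-1 else free_gen i.
Proof. by rewrite free_class_eval /= mulg1; case: b. Qed.

Lemma free_gen_class i : free_gen i = free_class [:: (i, false)].
Proof. by rewrite free_class_letter. Qed.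

Lemma eval_free_class (X : Type) (f : X -> word 'I_k) (w : word X) :
  eval (fun x => free_class (f x)) w = free_class (word_subst f w).
Proof.
rewrite [in RHS]unlock -eval_word_class; apply: eq_eval => x.
by rewrite unlock.
Qed.

End FreeClass.

Section FreeLift.
Variables (k : nat) (G : groupType).

Lemma free_lift_subproof (f : 'I_k -> G) (u v : word 'I_k) :
  False -> eval f u = eval f v.
Proof. by []. Qed.

Definition free_lift (f : 'I_k -> G) : free_group k -> G :=
  pres_lift (free_lift_subproof f).
HB.instance Definition _ f := Multiplicative.on (free_lift f).

Lemma free_liftE f w : free_lift f (free_class w) = eval f w.
Proof. by rewrite unlock; apply: pres_liftE. Qed.

Lemma free_lift_gen f i : free_lift f (free_gen i) = f i.
Proof. exact: pres_lift_gen. Qed.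

Lemma free_ext (h h' : {multiplicative free_group k -> G}) :
  (forall i, h (free_gen i) = h' (free_gen i)) -> h =1 h'.
Proof. exact: presented_ext. Qed.

End FreeLift.

Section BraidClass.
Variable n : nat.
Implicit Types (i j : 'I_n.-1) (u v w : word 'I_n.-1).

Definition braid_class w : braid n := locked_with class_key (word_class _ w).
Canonical braid_class_unlockable w := [unlockable of braid_class w].

Lemma braidW (P : braid n -> Prop) :
  (forall w, P (braid_class w)) -> forall g, P g.
Proof. by move=> Pw; elim/presW=> w; have := Pw w; rewrite unlock. Qed.

Lemma braid_class_eval w : braid_class w = eval (@sigma n) w.
Proof. by rewrite unlock; apply: word_class_eval. Qed.

Lemma braid_classP u v : braid_class u = braid_class v <-> pres_eq (@braid_rel n) u v.
Proof. by rewrite !unlock; apply: word_classP. Qed.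

Lemma braid_class_nil : braid_class [::] = 1.
Proof. exact: braid_class_eval. Qed.

Lemma braid_class_cat u v : braid_class (u ++ v) = braid_class u * braid_class v.
Proof. by rewrite !braid_class_eval eval_cat. Qed.

Lemma braid_class_inv u : braid_class (inv_word u) = (braid_class u)^-1.
Proof. by rewrite !unlock; apply: word_class_inv. Qed.

Lemma braid_class_letter i b :
  braid_class [:: (i, b)] = if b then (sigma i)^-1 else sigma i.
Proof. by rewrite braid_class_eval /= mulg1; case: b. Qed.

Lemma sigma_class i : sigma i = braid_class [:: (i, false)].
Proof. by rewrite braid_class_letter. Qed.

Lemma eval_braid_class (X : Type) (f : X -> word 'I_n.-1) (w : word X) :
  eval (fun x => braid_class (f x)) w = braid_class (word_subst f w).
Proof.
rewrite [in RHS]unlock -eval_word_class; apply: eq_eval => x.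
by rewrite unlock.
Qed.

End BraidClass.

Section BraidLift.
Variables (n : nat) (G : groupType) (f : 'I_n.-1 -> G).
Hypothesis f_far : forall i j : 'I_n.-1, i.+1 < j -> f i * f j = f j * f i.
Hypothesis f_near : forall i j : 'I_n.-1, j = i.+1 :> nat ->
  f i * f j * f i = f j * f i * f j.

Lemma braid_lift_subproof u v : braid_rel u v -> eval f u = eval f v.
Proof.
case=> i j ij; rewrite /= /eval_letter /= !mulg1; first exact: f_far.
by rewrite 2!mulgA; apply: f_near.
Qed.

Definition braid_lift : braid n -> G := pres_lift braid_lift_subproof.
HB.instance Definition _ := Multiplicative.on braid_lift.

Lemma braid_liftE w : braid_lift (braid_class w) = eval f w.
Proof. by rewrite unlock; apply: pres_liftE. Qed.

Lemma braid_lift_sigma i : braid_lift (sigma i) = f i.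
Proof. exact: pres_lift_gen. Qed.

End BraidLift.

Section FreeReduction.
Variable k : nat.
Implicit Types (l : 'I_k * bool) (u v w : word 'I_k).

Definition cancelling l l' := l' == inv_letter l.

Definition reduced w := sorted (fun l l' => ~~ cancelling l l') w.

Definition fcons l w :=
  if w is l' :: w' then if cancelling l l' then w' else l :: w else [:: l].

Definition fred w := foldr fcons [::] w.

Lemma cancelling_sym l l' : cancelling l l' = cancelling l' l.
Proof.
rewrite /cancelling; apply/eqP/eqP => ->; exact/esym/inv_letterK.
Qed.

Lemma cancelling_inv l l' :
  cancelling (inv_letter l) (inv_letter l') = cancelling l l'.
Proof. by rewrite /cancelling (inj_eq (can_inj (@inv_letterK _))). Qed.

Lemma reduced_fcons l w : reduced w -> reduced (fcons l w).
Proof.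
case: w => [|l' w] //=; rewrite -/(path _ _ _); case: ifP => [_|ll'].
  by case: w => //= l2 w /andP[].
by move=> rw /=; rewrite ll'.
Qed.

Lemma reduced_fred w : reduced (fred w).
Proof. by elim: w => //= l w; apply: reduced_fcons. Qed.

(** Letters act on reduced words by permutations, which makes [fred] invariant under free
    cancellation without any confluence argument. *)
Lemma fconsK l w : reduced w -> fcons l (fcons (inv_letter l) w) = w.
Proof.
case: w => [|l' w] /=; first by rewrite /cancelling eqxx.
rewrite {2}/cancelling inv_letterK; case: eqP => [->|_].
  by case: w => //= l2 w; case/andP=> /negPf ->.
by rewrite /= /cancelling eqxx.
Qed.

Lemma fred_cat u v : fred (u ++ v) = foldr fcons (fred v) u.
Proof. exact: foldr_cat. Qed.

Lemma fred_pres u v : pres_eq (fun _ _ : word 'I_k => False) u v ->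
  fred u = fred v.
Proof.
elim=> // {u v} [u v w _ -> _ ->|s l t] //.
rewrite !fred_cat; congr foldr; rewrite /=.
by rewrite -{1}[l]inv_letterK inv_letterK fconsK // reduced_fred.
Qed.

Lemma free_class_fcons l w : free_class (fcons l w) = free_class (l :: w).
Proof.
case: w => [|l' w] //=; case: ifP => // /eqP->.
by rewrite !unlock; apply/esym/word_classP/(PresCancel _ [::] l w).
Qed.

Lemma free_class_fred w : free_class (fred w) = free_class w.
Proof.
elim: w => //= l w IH; rewrite free_class_fcons.
by rewrite -[l :: fred w]cat1s -[l :: w]cat1s !free_class_cat IH.
Qed.

Lemma free_classP u v : free_class u = free_class v <-> fred u = fred v.
Proof.
split=> [|uv]; first by rewrite !unlock => /word_classP/fred_pres.
by rewrite -(free_class_fred u) uv free_class_fred.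
Qed.

Lemma fred_id w : reduced w -> fred w = w.
Proof.
elim: w => //= l w IH rw; rewrite IH; last by case: w rw {IH} => //= l' w /andP[].
by case: w rw {IH} => //= l' w /andP[/negPf->].
Qed.

Lemma fred_eqP u v : fred u = fred v -> free_class u = free_class v.
Proof. by move/free_classP. Qed.

Lemma reduced_cat l u l' v :
  reduced (rcons u l ++ l' :: v) =
    [&& reduced (rcons u l), ~~ cancelling l l' & reduced (l' :: v)].
Proof.
case: u => [|l0 u] //=; rewrite cat_path /= last_rcons.
by rewrite !rcons_path.
Qed.

Lemma reduced_inv w : reduced (inv_word w) = reduced w.
Proof.
rewrite /reduced /inv_word rev_sorted sorted_map; apply: eq_sorted => l l' /=.
by rewrite cancelling_inv cancelling_sym.
Qed.

Lemma reduced_catl u v : reduced (u ++ v) -> reduced u.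
Proof. by case: u => //= l u; rewrite cat_path => /andP[]. Qed.

Lemma reduced_catr u v : reduced (u ++ v) -> reduced v.
Proof.
case: u => //= l u; rewrite cat_path => /andP[_].
by case: v => //= l' v /andP[].
Qed.

Definition normal_form (g : free_group k) : word 'I_k := fred (repr g).

Lemma normal_formE w : normal_form (free_class w) = fred w.
Proof. by rewrite unlock; apply/fred_pres/pres_eq_repr. Qed.

Lemma normal_formK g : free_class (normal_form g) = g.
Proof. by rewrite free_class_fred unlock; apply: word_class_repr. Qed.

Lemma reduced_normal_form g : reduced (normal_form g).
Proof. exact: reduced_fred. Qed.

Lemma normal_form_inj : injective normal_form.
Proof. exact: can_inj normal_formK. Qed.

Lemma normal_form1 : normal_form 1 = [::].
Proof. by have := normal_formE [::]; rewrite free_class_eval. Qed.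

Lemma normal_formV g : normal_form g^-1 = inv_word (normal_form g).
Proof.
rewrite -{1}(normal_formK g) -free_class_inv normal_formE fred_id //.
by rewrite reduced_inv reduced_normal_form.
Qed.

End FreeReduction.

(** * Centralizers and square roots in free groups *)

Section Centralizer.
Variable k : nat.
Implicit Types (i : 'I_k) (g : free_group k) (u w : word 'I_k).

Lemma reduced_nseq m (l : 'I_k * bool) : reduced (nseq m l).
Proof.
elim: m => [|[|m] IH] //=; rewrite -/(path _ _ _); apply/andP; split => //.
by case: l {IH} => x []; rewrite /cancelling /inv_letter xpair_eqE eqxx.
Qed.

Lemma free_gen_exp i m : free_gen i ^+ m = free_class (nseq m (i, false)).
Proof.
elim: m => [|m IH]; first by rewrite free_class_eval.
by rewrite expgS IH -[nseq m.+1 _]cat1s free_class_cat free_class_letter.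
Qed.

(** Look at the last letter of the normal form of [g]. If it is a power of generator [i], it
    commutes with the power and can be stripped. Otherwise conjugating [free_gen i ^+ m] by [g]
    gives a word that is already reduced and too long. *)
Lemma commute_gen_exp i m g : 0 < m -> commute g (free_gen i ^+ m) ->
  all (fun l => l.1 == i) (normal_form g).
Proof.
move=> m0; rewrite -[g in commute g _]normal_formK.
elim/last_ind: (normal_form g) (reduced_normal_form g) => // s l IH red gc.
rewrite all_rcons; have [li|li] /= := eqVneq l.1 i.
  apply: IH; first by move: red; rewrite -cats1 => /reduced_catl.
  move: gc; rewrite -cats1 free_class_cat => gc.
  have xc : commute (free_class [:: l]) (free_gen i ^+ m).
    have ic : commute (free_gen i) (free_gen i ^+ m).
      exact/commuteX/commute_refl.
    case: l li {red gc} => x b /= ->; rewrite free_class_letter.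
    by case: b => //; apply/commute_sym/commuteV/commute_sym.
  apply/commute_sym/(@mulIg _ (free_class [:: l])).
  by rewrite -!mulgA -xc -gc mulgA.
exfalso; pose x := nseq m (i, false); move: gc.
rewrite free_gen_exp -/x /commute => gc.
have : free_class (rcons s l ++ x ++ inv_word (rcons s l)) = free_class x.
  by rewrite !free_class_cat mulgA gc free_class_inv mulgK.
have ncl b : cancelling l (i, b) = false.
  apply/negP=> /eqP e; move: li; rewrite -(inv_letterK l) -e.
  by rewrite /inv_letter /= eqxx.
have ix : x = (i, false) :: nseq m.-1 (i, false) by rewrite /x -{1}(prednK m0).
have xi : x = rcons (nseq m.-1 (i, false)) (i, false).
  by rewrite /x -{1}(prednK m0) -addn1 nseqD cats1.
have iu : inv_word (rcons s l) = inv_letter l :: inv_word s.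
  by rewrite -cats1 inv_word_cat.
move/free_classP; rewrite !fred_id ?reduced_nseq //.
  move/(congr1 size); rewrite !size_cat size_rcons; lia.
rewrite {1}ix cat_cons reduced_cat red ncl !andTb -cat_cons -ix iu xi.
rewrite reduced_cat -xi -iu reduced_inv red reduced_nseq andbT.
rewrite cancelling_sym -cancelling_inv.
by rewrite inv_letterK /inv_letter /= ncl.
Qed.

Lemma reduced_one_letter i u : reduced u -> all (fun l => l.1 == i) u ->
  exists b, u = nseq (size u) (i, b).
Proof.
elim: u => [|[x b] u IH] red; first by exists false.
case/andP=> /eqP /= xi iu; rewrite xi in red *.
have [b' ub'] := IH (@reduced_catr _ [:: (i, b)] _ red) iu.
case: u ub' {IH} iu red => [|[y c] u] ub'; first by exists b.
case: ub' => yi cb ub' _; rewrite yi cb /= /cancelling /inv_letter /=.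
rewrite xpair_eqE eqxx /= => /andP[bb' _]; exists b; rewrite ub' size_nseq.
by case: b b' bb' {cb ub'} => -[].
Qed.

(** Such a [g] commutes with its own square, hence is a power of the generator, and comparing
    lengths finishes. This brings [pure_alpha_center] from the squares of [a] and [b], which are
    pure, back to [a] and [b]. *)
Lemma square_root_gen i g : g * g = free_gen i * free_gen i -> g = free_gen i.
Proof.
move=> gg; have gi : commute g (free_gen i ^+ 2).
  by rewrite expg2 -gg; apply/commuteM; apply: commute_refl.
have /(reduced_one_letter (reduced_normal_form g)) [b ub] :=
  commute_gen_exp (ltn0Sn 1) gi.
move: gg; rewrite -[free_gen i * _]expg2 free_gen_exp -(normal_formK g) -free_class_cat ub.
rewrite -nseqD => /free_classP; rewrite !fred_id ?reduced_nseq // => e.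
have s1 : size (normal_form g) = 1%N by move/(congr1 size): e; rewrite !size_nseq; lia.
by rewrite s1 in e *; case: e => -> _; rewrite free_class_letter.
Qed.

End Centralizer.

Lemma free_center_trivial n (g : free_group n.+2) :
  (forall h, commute g h) -> g = 1.
Proof.
move=> gc; apply: normal_form_inj; rewrite normal_form1.
have := commute_gen_exp (ltn0Sn 0) (gc (free_gen ord_max ^+ 1)).
have := commute_gen_exp (ltn0Sn 0) (gc (free_gen ord0 ^+ 1)).
by case: (normal_form g) => //= l u /andP[/eqP-> _] /andP[].
Qed.

(** * The word problem in braid groups *)

(* The letter coded by z is the generator of index |z|-1 with the sign of z, *)
(* so that 1, -3 stand for sigma_1, sigma_3^-1.                              *)
Definition letter m (z : int) : 'I_m.+1 * bool :=
  match z with Posz k => (zmodp.inZp k.-1, false) | Negz k => (zmodp.inZp k, true) end.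

Definition wd m (s : seq int) : word 'I_m.+1 := [seq letter m z | z <- s].

Ltac case_ord i :=
  let lti := fresh in
  (case: i => [[|[|[|[|?]]]] lti]; try (exfalso; exact: (notF lti))).

Section WordReversing.
Variable n : nat.
Implicit Types (i j : 'I_n.-1) (u v w : word 'I_n.-1).

Lemma sigma_far i j : i.+1 < j -> sigma i * sigma j = sigma j * sigma i.
Proof.
move=> ij; have /word_classP := braid_relE (BraidFar ij).
by rewrite !word_class_eval /= /eval_letter /= !mulg1.
Qed.

Lemma sigma_near i j : j = i.+1 :> nat ->
  sigma i * sigma j * sigma i = sigma j * sigma i * sigma j.
Proof.
move=> ij; have /word_classP := braid_relE (BraidNear ij).
by rewrite !word_class_eval /= /eval_letter /= !mulg1 !mulgA.
Qed.

(* sigma_i^-1 sigma_j is a positive word followed by a negative word: moving *)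
(* the negative letters to the right solves the word problem (Dehornoy).     *)
Fixpoint reverse_pass w : word 'I_n.-1 :=
  match w with
  | ((i, true) as l) :: ((((j, false) as l') :: t) as w') =>
      if i == j :> nat then reverse_pass t
      else if (i.+1 < j) || (j.+1 < i) then l' :: l :: reverse_pass t
      else [:: l', (i, false), (j, true), l & reverse_pass t]
  | l :: w' => l :: reverse_pass w'
  | [::] => [::]
  end.

Lemma sigmaV_mul i j : (sigma i)^-1 * sigma j =
  if i == j :> nat then 1
  else if (i.+1 < j) || (j.+1 < i) then sigma j * (sigma i)^-1
  else sigma j * sigma i * (sigma j)^-1 * (sigma i)^-1.
Proof.
case: ifP => [/eqP/ordE->|/eqP nij]; first by rewrite mulVg.
case: ifP => ij.
  apply: (@mulgI _ (sigma i)); apply: (@mulIg _ (sigma i)).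
  rewrite mulVKg mulgA mulgVK.
  by case/orP: ij => /sigma_far ->.
apply: (@mulgI _ (sigma i)); rewrite mulVKg.
apply: (@mulIg _ (sigma i)); apply: (@mulIg _ (sigma j)).
rewrite !mulgA mulgVK mulgVK.
have [/sigma_near-> //|/sigma_near-> //] : j = i.+1 :> nat \/ i = j.+1 :> nat by lia.
Qed.

Lemma braid_class_reverse_pass w : braid_class (reverse_pass w) = braid_class w.
Proof.
have [m] := ubnP (size w); elim: m w => // m IH [|[i b] w] //= sw.
have stepE : braid_class ((i, b) :: reverse_pass w) = braid_class ((i, b) :: w).
  rewrite -(cat1s _ (reverse_pass w)) -[in RHS](cat1s _ w).
  by rewrite 2!braid_class_cat IH.
case: b stepE => //; case: w sw => [|[j []] t] // st _.
have tE : braid_class (reverse_pass t) = braid_class t by apply: IH; move: st => /=; lia.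
have -> : braid_class [:: (i, true), (j, false) & t]
        = (sigma i)^-1 * sigma j * braid_class t.
  rewrite -[_ :: _]/([:: (i, true)] ++ [:: (j, false)] ++ t).
  by rewrite !braid_class_cat !braid_class_letter mulgA.
rewrite -tE sigmaV_mul; case: ifP => _; first by rewrite mul1g.
case: ifP => _.
  rewrite -[_ :: _]/([:: (j, false)] ++ [:: (i, true)] ++ reverse_pass t).
  by rewrite !braid_class_cat !braid_class_letter mulgA.
rewrite -[_ :: _]/([:: (j, false)] ++ [:: (i, false)] ++
  [:: (j, true)] ++ [:: (i, true)] ++ reverse_pass t).
by rewrite !braid_class_cat !braid_class_letter !mulgA.
Qed.

(* The number of passes is only fuel: soundness holds for any number. *)
Definition reverse_word w := iter 200 reverse_pass w.

(** After one reversal the word has the form [u v^-1] with [u], [v] positive, and reversing can do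
    no more. Rotating it to [v^-1 u] is a conjugation, hence preserves triviality, and exposes it to
    a second reversal, which erases it when [u] and [v] are equal. *)
Definition braid_trivial w :=
  let w' := reverse_word w in let p := find (fun l => l.2) w' in
  nilp (reverse_word (drop p w' ++ take p w')).

Definition braid_eqb u v := braid_trivial (u ++ inv_word v).

Lemma braid_class_reverse_word w : braid_class (reverse_word w) = braid_class w.
Proof.
rewrite /reverse_word; elim: 200%N => //= m IH.
by rewrite braid_class_reverse_pass.
Qed.

Lemma braid_eqbP u v : braid_eqb u v -> braid_class u = braid_class v.
Proof.
rewrite /braid_eqb /braid_trivial; move wE: (u ++ _) => w.
set p := find _ (reverse_word w); move/nilP => e; apply: divg1_eq; rewrite -braid_class_inv -braid_class_cat wE.
rewrite -braid_class_reverse_word -(cat_take_drop p (reverse_word w)).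
have : braid_class (drop p (reverse_word w) ++ take p (reverse_word w)) = 1.
  by rewrite -braid_class_reverse_word e braid_class_eval.
rewrite !braid_class_cat => /mulg1_eq <-; exact: mulVg.
Qed.

End WordReversing.

(** * Braid actions on free groups *)

Section Substitution.
Variable m : nat.
Implicit Types (t : 'I_m -> word 'I_m) (u w : word 'I_m).

Definition subst t w : word 'I_m :=
  fred (word_subst t w).

Lemma free_lift_subst t w :
  free_lift (fun x => free_class (t x)) (free_class w) = free_class (subst t w).
Proof.
by rewrite free_liftE free_class_fred; apply: eval_free_class.
Qed.

Lemma free_lift_substK t t' :
  (forall x, subst t' (t x) == [:: (x, false)]) ->
  cancel (free_lift (fun x => free_class (t x)))
         (free_lift (fun x => free_class (t' x))).
Proof.
move=> tK g.
pose h : {multiplicative free_group m -> free_group m} :=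
  free_lift (fun x => free_class (t' x)) \o free_lift (fun x => free_class (t x)).
rewrite -[LHS]/(h g) -[RHS]/(idfun g).
apply: (free_ext (h' := idfun)) => x.
by rewrite /= free_lift_gen free_lift_subst (eqP (tK x)) -free_gen_class.
Qed.

Definition subst_aut t t'
    (tK : forall x, subst t' (t x) == [:: (x, false)])
    (t'K : forall x, subst t (t' x) == [:: (x, false)]) :
    automorphism (free_group m) :=
  Automorphism (@gmulfM _ _ (free_lift (fun x => free_class (t x))))
    (free_lift_substK tK) (free_lift_substK t'K).

Lemma aut_ext (f g : automorphism (free_group m)) :
  (forall x, f (free_gen x) = g (free_gen x)) -> f = g.
Proof.
move=> fg; apply: aut_eqP.
pose hf := isMultiplicative.Build _ _ f (aut_morph f).
pose hg := isMultiplicative.Build _ _ g (aut_morph g).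
exact: (@free_ext _ _ (HB.pack (f : _ -> _) hf) (HB.pack (g : _ -> _) hg)).
Qed.

End Substitution.

Section BraidAut.
Variables (n m : nat) (t t' : 'I_n.-1 -> 'I_m -> word 'I_m).
Hypothesis tK : forall i x, subst (t' i) (t i x) == [:: (x, false)].
Hypothesis t'K : forall i x, subst (t i) (t' i x) == [:: (x, false)].
Hypothesis t_far : forall (i j : 'I_n.-1) x, i.+1 < j ->
  subst (t i) (t j x) == subst (t j) (t i x).
Hypothesis t_near : forall (i j : 'I_n.-1) x, j = i.+1 :> nat ->
  subst (t i) (subst (t j) (t i x)) == subst (t j) (subst (t i) (t j x)).

Definition sigma_aut i := subst_aut (tK i) (t'K i).

Lemma sigma_aut_far (i j : 'I_n.-1) : i.+1 < j ->
  sigma_aut i * sigma_aut j = sigma_aut j * sigma_aut i.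
Proof.
move=> ij; apply: aut_ext => x /=.
by rewrite !free_lift_gen !free_lift_subst (eqP (t_far x ij)).
Qed.

Lemma sigma_aut_near (i j : 'I_n.-1) : j = i.+1 :> nat ->
  sigma_aut i * sigma_aut j * sigma_aut i = sigma_aut j * sigma_aut i * sigma_aut j.
Proof.
move=> ij; apply: aut_ext => x /=.
by rewrite !free_lift_gen !free_lift_subst (eqP (t_near x ij)).
Qed.

Definition braid_aut : braid n -> automorphism (free_group m) :=
  braid_lift sigma_aut_far sigma_aut_near.
HB.instance Definition _ := Multiplicative.on braid_aut.

(** The last letter of [w] acts first, as in the composition [aut_mul]; reducing after each letter
    keeps the words short during computation. *)
Definition act_word (w : word 'I_n.-1) (u : word 'I_m) :=
  foldr (fun l u => subst (if l.2 then t' l.1 else t l.1) u) u w.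

Lemma braid_autE w u :
  braid_aut (braid_class w) (free_class u) = free_class (act_word w u).
Proof.
rewrite /braid_aut braid_liftE.
elim: w => [|[i b] w IH] //=; rewrite IH /eval_letter.
by case: b => /=; apply: free_lift_subst.
Qed.

End BraidAut.

Section InnerAut.
Variable G : groupType.
Implicit Types g x : G.

Definition conj_by g x := g * x * g^-1.

Lemma conj_byM g : {morph conj_by g : x y / x * y}.
Proof. by move=> x y; rewrite /conj_by !mulgA mulgVK. Qed.

HB.instance Definition _ g := isMultiplicative.Build G G (conj_by g) (conj_byM g).

Lemma conj_byK g : cancel (conj_by g) (conj_by g^-1).
Proof. by move=> x; rewrite /conj_by !mulgA mulVg mul1g invgK mulgVK. Qed.

Lemma conj_byVK g : cancel (conj_by g^-1) (conj_by g).
Proof. by move=> x; rewrite /conj_by !mulgA mulgV mul1g invgK mulgK. Qed.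

Definition inner_aut g : automorphism G :=
  Automorphism (conj_byM g) (conj_byK g) (conj_byVK g).

Lemma inner_autM : {morph inner_aut : g h / g * h}.
Proof. by move=> g h; apply: aut_eqP => x /=; rewrite /conj_by invgM !mulgA. Qed.

HB.instance Definition _ :=
  isMultiplicative.Build G (automorphism G) inner_aut inner_autM.

End InnerAut.

Lemma inner_aut_inj k : injective (@inner_aut (free_group k.+2)).
Proof.
apply: multiplicative_inj => g /(congr1 (fun f : automorphism _ => aut_fun f)) g1.
apply: free_center_trivial => h; apply: (@mulIg _ g^-1).
by rewrite mulgK; apply: (congr1 (fun f => f h) g1).
Qed.

Definition Braid4 (s : seq int) : braid 4 := braid_class (n := 4) (wd 2 s).
Definition Braid3 (s : seq int) : braid 3 := braid_class (n := 3) (wd 1 s).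
Definition F2 (s : seq int) : free_group 2 := free_class (wd 1 s).
Definition F3 (s : seq int) : free_group 3 := free_class (wd 2 s).

Definition table m (T : seq (seq (seq int))) (i x : nat) : word 'I_m.+1 :=
  wd m (nth [::] (nth [::] T i) x).

(* The conjugation action of sigma_i on a = dfg_a and b = dfg_b, found by    *)
(* computer and checked in dfg_alpha_sigma.                                  *)
Definition alpha_table := [:: [:: [:: 1]; [:: 2; -1]];
                             [:: [:: 2]; [:: 2; -1; 2]];
                             [:: [:: 1]; [:: -1; 2]]]%Z.
Definition alpha_tableV := [:: [:: [:: 1]; [:: 2; 1]];
                              [:: [:: 1; -2; 1]; [:: 1]];
                              [:: [:: 1]; [:: 1; 2]]]%Z.

Definition alpha_img (i : 'I_4.-1) (x : 'I_2) := table 1 alpha_table i x.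
Definition alpha_imgV (i : 'I_4.-1) (x : 'I_2) := table 1 alpha_tableV i x.

Lemma alpha_imgK i x : subst (alpha_imgV i) (alpha_img i x) == [:: (x, false)].
Proof. by move: i x; do 2!case=> [[|[|[|?]]] ?] //; vm_compute. Qed.
Lemma alpha_imgVK i x : subst (alpha_img i) (alpha_imgV i x) == [:: (x, false)].
Proof. by move: i x; do 2!case=> [[|[|[|?]]] ?] //; vm_compute. Qed.
Lemma alpha_far (i j : 'I_4.-1) x : i.+1 < j ->
  subst (alpha_img i) (alpha_img j x) == subst (alpha_img j) (alpha_img i x).
Proof. by move: i j x; do 3!case=> [[|[|[|?]]] ?] //; vm_compute. Qed.
Lemma alpha_near (i j : 'I_4.-1) x : j = i.+1 :> nat ->
  subst (alpha_img i) (subst (alpha_img j) (alpha_img i x)) ==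
  subst (alpha_img j) (subst (alpha_img i) (alpha_img j x)).
Proof. by move: i j x; do 3!case=> [[|[|[|?]]] ?] //; vm_compute. Qed.

Definition alpha : braid 4 -> automorphism (free_group 2) :=
  braid_aut alpha_imgK alpha_imgVK alpha_far alpha_near.
HB.instance Definition _ := Multiplicative.on alpha.

(* Artin's action on the free group on x1, x2, x3, x4 modulo x1 x2 x3 x4 = 1, *)
(* sigma_i sending x_i to x_i x_(i+1) x_i^-1 and x_(i+1) to x_i.              *)
Definition artin_table := [:: [:: [:: 1; 2; -1]; [:: 1]; [:: 3]];
                             [:: [:: 1]; [:: 2; 3; -2]; [:: 2]];
                             [:: [:: 1]; [:: 2]; [:: -2; -1; -3]]]%Z.
Definition artin_tableV := [:: [:: [:: 2]; [:: -2; 1; 2]; [:: 3]];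
                              [:: [:: 1]; [:: 3]; [:: -3; 2; 3]];
                              [:: [:: 1]; [:: 2]; [:: -3; -2; -1]]]%Z.

Definition artin_img (i : 'I_4.-1) (x : 'I_3) := table 2 artin_table i x.
Definition artin_imgV (i : 'I_4.-1) (x : 'I_3) := table 2 artin_tableV i x.

Lemma artin_imgK i x : subst (artin_imgV i) (artin_img i x) == [:: (x, false)].
Proof. by move: i x; do 2!case=> [[|[|[|?]]] ?] //; vm_compute. Qed.
Lemma artin_imgVK i x : subst (artin_img i) (artin_imgV i x) == [:: (x, false)].
Proof. by move: i x; do 2!case=> [[|[|[|?]]] ?] //; vm_compute. Qed.
Lemma artin_far (i j : 'I_4.-1) x : i.+1 < j ->
  subst (artin_img i) (artin_img j x) == subst (artin_img j) (artin_img i x).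
Proof. by move: i j x; do 3!case=> [[|[|[|?]]] ?] //; vm_compute. Qed.
Lemma artin_near (i j : 'I_4.-1) x : j = i.+1 :> nat ->
  subst (artin_img i) (subst (artin_img j) (artin_img i x)) ==
  subst (artin_img j) (subst (artin_img i) (artin_img j x)).
Proof. by move: i j x; do 3!case=> [[|[|[|?]]] ?] //; vm_compute. Qed.

Definition artin : braid 4 -> automorphism (free_group 3) :=
  braid_aut artin_imgK artin_imgVK artin_far artin_near.
HB.instance Definition _ := Multiplicative.on artin.

Lemma eval_sigma (X : Type) n (f : X -> 'I_n.-1) (w : word X) :
  eval (fun x => sigma (f x)) w = braid_class [seq (f l.1, l.2) | l <- w].
Proof.
rewrite braid_class_eval; elim: w => //= -[x b] w ->.
by case: b.
Qed.

(** * Homomorphisms between braid groups, and the embedding of the free group *)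

Section Stabilization.
Variable n : nat.

Definition widen_letter (i : 'I_n) : 'I_n.+1 := widen_ord (leqnSn n) i.

Definition stab_word (w : word 'I_n) : word 'I_n.+1 :=
  [seq (widen_letter l.1, l.2) | l <- w].

Lemma stab_far (i j : 'I_n.+1.-1) : i.+1 < j ->
  @sigma n.+2 (widen_letter i) * @sigma n.+2 (widen_letter j)
  = @sigma n.+2 (widen_letter j) * @sigma n.+2 (widen_letter i).
Proof. exact: (@sigma_far n.+2 (widen_letter i) (widen_letter j)). Qed.

Lemma stab_near (i j : 'I_n.+1.-1) : j = i.+1 :> nat ->
  @sigma n.+2 (widen_letter i) * @sigma n.+2 (widen_letter j) * @sigma n.+2 (widen_letter i)
  = @sigma n.+2 (widen_letter j) * @sigma n.+2 (widen_letter i) * @sigma n.+2 (widen_letter j).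
Proof. exact: (@sigma_near n.+2 (widen_letter i) (widen_letter j)). Qed.

Definition stab : braid n.+1 -> braid n.+2 :=
  braid_lift stab_far stab_near.
HB.instance Definition _ := Multiplicative.on stab.

Lemma stabE w : stab (braid_class (n := n.+1) w) = braid_class (n := n.+2) (stab_word w).
Proof. by rewrite /stab braid_liftE; apply: eval_sigma. Qed.

End Stabilization.

Definition fold_letter (i : 'I_4.-1) : 'I_3.-1 := zmodp.inZp (val i == 1%N).

Lemma fold_far (i j : 'I_4.-1) : i.+1 < j ->
  sigma (fold_letter i) * sigma (fold_letter j)
  = sigma (fold_letter j) * sigma (fold_letter i).
Proof.
by case: i => [[|[|[|?]]] ?] //; case: j => [[|[|[|?]]] ?] // _.
Qed.

Lemma fold_near (i j : 'I_4.-1) : j = i.+1 :> nat ->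
  sigma (fold_letter i) * sigma (fold_letter j) * sigma (fold_letter i)
  = sigma (fold_letter j) * sigma (fold_letter i) * sigma (fold_letter j).
Proof.
move: i j; do 2!case=> [[|[|[|?]]] ?] //; first by move=> _; apply: sigma_near.
by move=> _; apply/esym/sigma_near.
Qed.

Definition fold_braid : braid 4 -> braid 3 :=
  braid_lift fold_far fold_near.
HB.instance Definition _ := Multiplicative.on fold_braid.

Definition fold_word (w : word 'I_4.-1) : word 'I_3.-1 :=
  [seq (fold_letter l.1, l.2) | l <- w].

Lemma fold_braidE w : fold_braid (braid_class (n := 4) w) = braid_class (n := 3) (fold_word w).
Proof. by rewrite /fold_braid braid_liftE; apply: eval_sigma. Qed.

(** Folding is split by [stab], so it is onto and reads off the factor [b] of a product
    [dfg w * stab b]. *)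
Lemma fold_stab (b : braid 3) : fold_braid (stab b) = b.
Proof.
elim/braidW: b => w; rewrite stabE fold_braidE; congr braid_class.
rewrite /fold_word -map_comp -[RHS]map_id; apply: eq_map => -[i b] /=.
by congr (_, _); apply: val_inj; case: i => -[|[|?]].
Qed.

Definition dfg_word (x : 'I_2) : word 'I_4.-1 :=
  wd 2 (nth [::] [:: [:: 1; -3]; [:: 2; 1; -3; -2]]%Z x).

Definition dfg : free_group 2 -> braid 4 :=
  free_lift (fun x => braid_class (n := 4) (dfg_word x)).
HB.instance Definition _ := Multiplicative.on dfg.

Lemma dfgE w : dfg (free_class w) = braid_class (n := 4) (word_subst dfg_word w).
Proof. by rewrite /dfg free_liftE; apply: eval_braid_class. Qed.

Lemma dfg_gen x : dfg (free_gen x) = braid_class (n := 4) (dfg_word x).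
Proof. exact: free_lift_gen. Qed.

Lemma dfg_gen_a : dfg (free_gen (@Ordinal 2 0 isT)) = dfg_a.
Proof.
rewrite dfg_gen /dfg_a /sigma1 /sigma3 !sigma_class.
rewrite -braid_class_inv -braid_class_cat.
by apply: braid_eqbP; vm_compute.
Qed.

Lemma dfg_gen_b : dfg (free_gen (@Ordinal 2 1 isT)) = dfg_b.
Proof.
rewrite dfg_gen /dfg_b /sigma1 /sigma2 /sigma3 !sigma_class.
rewrite -!braid_class_inv -!braid_class_cat.
by apply: braid_eqbP; vm_compute.
Qed.

Lemma dfg_alpha_sigma (i : 'I_4.-1) w :
  dfg (alpha (sigma i) w) = sigma i * dfg w * (sigma i)^-1.
Proof.
pose h1 : {multiplicative free_group 2 -> braid 4} :=
  dfg \o free_lift (fun x => free_class (alpha_img i x)).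
pose h2 : {multiplicative free_group 2 -> braid 4} := conj_by (sigma i) \o dfg.
have <- : h1 w = dfg (alpha (sigma i) w).
  by rewrite /alpha /braid_aut braid_lift_sigma.
rewrite -[RHS]/(h2 w); apply: free_ext => x.
rewrite /= /conj_by free_lift_gen dfg_gen dfgE sigma_class.
rewrite -braid_class_inv -!braid_class_cat; apply: braid_eqbP.
by clear h1 h2; case_ord i; case_ord x; vm_compute.
Qed.

Lemma dfg_alpha (g : braid 4) w : dfg (alpha g w) = g * dfg w * g^-1.
Proof.
move: g w; apply: presented_ind => [w|i w|g h IHg IHh w|g IH w].
- by rewrite multiplicative1 invg1 mulg1 mul1g.
- exact: dfg_alpha_sigma.
- by rewrite gmulfM /= IHg IHh invgM !mulgA.
apply: (@mulgI _ g); apply: (@mulIg _ g^-1).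
rewrite -IH multiplicativeV /= aut_invK invgK.
by rewrite !mulgA mulgV mul1g mulgK.
Qed.

Lemma alpha_dfg w : alpha (dfg w) = inner_aut w.
Proof.
pose h : {multiplicative _ -> _} := alpha \o dfg.
rewrite -[LHS]/(h w); apply: free_ext => x {w}.
rewrite /= dfg_gen; apply: aut_ext => y.
rewrite [in LHS](free_gen_class y) [LHS]braid_autE /= /conj_by !free_gen_class.
rewrite -free_class_inv -!free_class_cat; apply/fred_eqP/eqP.
by clear h; case_ord x; case_ord y; vm_compute.
Qed.

Lemma dfg_inj : injective dfg.
Proof.
by move=> u v /(congr1 alpha); rewrite !alpha_dfg => /inner_aut_inj.
Qed.

(** * The kernel of the conjugation action *)

Section Homology.

Import GRing.Theory.

(* The coordinates on H_1(F_2) dual to the classes of a and a b^-1, in which *)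
(* sigma_1 and sigma_2^-1 act by nonnegative matrices.                       *)
Definition coord (c : bool) (x : 'I_2) : int :=
  (if val x == 0%N then if c then 0 else 1 else if c then -1 else 1)%R.

Definition weight c (w : word 'I_2) : int :=
  foldr (fun l s => ((if l.2 then - coord c l.1 else coord c l.1) + s)%R) 0%R w.

Lemma weight_cat c u v : weight c (u ++ v) = (weight c u + weight c v)%R.
Proof. by elim: u => [|l u IH] /=; rewrite ?add0r // IH addrA. Qed.

Lemma weight_fcons c l w : weight c (fcons l w) = weight c (l :: w).
Proof.
case: w => [|l' w] //=; case: ifP => // /eqP->.
by case: l => x b; rewrite /inv_letter /= addrA; case: b; rewrite /= ?addNr ?subrr add0r.
Qed.

Lemma weight_fred c w : weight c (fred w) = weight c w.
Proof. by elim: w => //= l w IH; rewrite weight_fcons /= IH. Qed.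

Definition char (c : bool) (g : free_group 2) : int := weight c (normal_form g).

Lemma char_class c w : char c (free_class w) = weight c w.
Proof. by rewrite /char normal_formE weight_fred. Qed.

Lemma charM c g h : char c (g * h) = (char c g + char c h)%R.
Proof.
elim/freeW: g => u; elim/freeW: h => v.
by rewrite -free_class_cat !char_class weight_cat.
Qed.

Lemma char1 c : char c 1 = 0%R.
Proof. by rewrite /char normal_form1. Qed.

Lemma charV c g : char c g^-1 = (- char c g)%R.
Proof. by apply/eqP; rewrite -addr_eq0 -charM mulVg char1. Qed.

Lemma char_gen c x : char c (free_gen x) = coord c x.
Proof. by rewrite free_gen_class char_class /= addr0. Qed.

Record mx2 := Mx2 { m11 : int; m12 : int; m21 : int; m22 : int }.

Definition mulmx2 A B := Mx2
  (m11 A * m11 B + m12 A * m21 B)%R (m11 A * m12 B + m12 A * m22 B)%R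
  (m21 A * m11 B + m22 A * m21 B)%R (m21 A * m12 B + m22 A * m22 B)%R.

Definition det2 A := (m11 A * m22 A - m12 A * m21 A)%R.

Lemma det2M A B : det2 (mulmx2 A B) = (det2 A * det2 B)%R.
Proof. by rewrite /det2 /=; ring. Qed.

Definition scalar2 x := Mx2 x 0%R 0%R x.

Definition gen_a : free_group 2 := free_gen (@Ordinal 2 0 isT).
Definition gen_b : free_group 2 := free_gen (@Ordinal 2 1 isT).

Definition gen_ab : free_group 2 := gen_a * gen_b^-1.

Definition h1_mx (f : automorphism (free_group 2)) := Mx2
  (char false (f gen_a)) (char false (f gen_ab))
  (char true (f gen_a)) (char true (f gen_ab)).

Lemma aut1 (G : groupType) (f : automorphism G) : f 1 = 1.
Proof. by apply: (@mulgI _ (f 1)); rewrite -aut_morph !mulg1. Qed.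

Lemma autV (G : groupType) (f : automorphism G) x : f x^-1 = (f x)^-1.
Proof. by apply: (@mulgI _ (f x)); rewrite -aut_morph !mulgV aut1. Qed.

Lemma char_aut c (f : automorphism (free_group 2)) g :
  char c (f g) = (char false g * char c (f gen_a)
                  + char true g * char c (f gen_ab))%R.
Proof.
move: g; apply: presented_ind => [|x|g h IHg IHh|g IH].
- by rewrite aut1 !char1 !mul0r.
- rewrite -[gen _ x]/(free_gen x) /gen_ab aut_morph autV charM charV.
  rewrite !char_gen /gen_a /gen_b.
  have -> : x = if val x == 0%N then @Ordinal 2 0 isT else @Ordinal 2 1 isT.
    by apply: val_inj; case: x => [[|[|?]] ?].
  by case: ifP => _; rewrite /coord /=; ring.
- by rewrite aut_morph !charM IHg IHh; ring.
- by rewrite autV !charV IH; ring.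
Qed.

Lemma h1_mxM f g : h1_mx (f * g) = mulmx2 (h1_mx f) (h1_mx g).
Proof.
rewrite /h1_mx /mulmx2 /=.
by congr Mx2; rewrite -[LHS]/(char _ (f _)) char_aut; ring.
Qed.

Lemma h1_mx_inner g : h1_mx (inner_aut g) = scalar2 1.
Proof.
have cJ c x : char c (inner_aut g x) = char c x.
  by rewrite /= /conj_by !charM charV addrAC subrr add0r.
rewrite /h1_mx !cJ /gen_ab !charM !charV /gen_a /gen_b !char_gen.
by [].
Qed.

Lemma h1_mx1 : h1_mx 1 = scalar2 1.
Proof. by rewrite -(h1_mx_inner 1) multiplicative1. Qed.

End Homology.

(** * The three-strand braid group and its map to SL_2(Z) *)

Section Cyclic.
Variable G : groupType.
Implicit Types c g h : G.

Definition cyc c g := exists k, g = c ^+ k \/ g = c ^- k.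

Lemma cyc1 c : cyc c 1.
Proof. by exists 0%N; left. Qed.

Lemma cycMr c g : cyc c g -> cyc c (g * c).
Proof.
case=> k [->|->]; first by exists k.+1; left; rewrite expgSr.
case: k => [|k]; first by exists 1%N; left; rewrite expg0 invg1 mul1g.
by exists k; right; rewrite expgS invgM mulgVK.
Qed.

Lemma cycVr c g : cyc c g -> cyc c (g * c^-1).
Proof.
case=> k [->|->]; last by exists k.+1; right; rewrite expgS invgM.
case: k => [|k]; first by exists 1%N; right; rewrite expg0 mul1g.
by exists k; left; rewrite expgSr mulgK.
Qed.

Lemma cyc_sub (H : G -> Prop) c g : H 1 -> (forall x y, H x -> H y -> H (x * y)) ->
  (forall x, H x -> H x^-1) -> H c -> cyc c g -> H g.
Proof.
move=> H1 HM HV Hc [k gk]; have Hk : H (c ^+ k).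
  by elim: k {gk} => [|k IH] //; rewrite expgS; apply: HM.
by case: gk => ->; last apply: HV.
Qed.

End Cyclic.

Lemma braid_center n (z : braid n) :
  (forall i, commute z (sigma i)) -> forall g, commute z g.
Proof.
move=> zs; apply: presented_ind => [|i|g h|g]; [exact: commute1|exact: zs| |].
  exact: commuteM.
exact: commuteV.
Qed.

Lemma is_pure_class n (w : word 'I_n.-1) : is_pure (braid_class w) = pure_word w.
Proof. by rewrite unlock is_pureE. Qed.

Section BraidThree.

Let s1 : braid 3 := Braid3 [:: 1%Z].
Let s2 : braid 3 := Braid3 [:: 2%Z].
Let s : braid 3 := Braid3 [:: 1; 2; 1]%Z.
Let t : braid 3 := Braid3 [:: 1; 2]%Z.

Definition full_twist3 := Braid3 [:: 1; 2; 1; 2; 1; 2]%Z.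
Notation c := full_twist3.

Lemma full_twist3_central g : commute c g.
Proof.
move: g; apply: braid_center => i.
rewrite sigma_class /commute /c /Braid3 -!braid_class_cat; apply: braid_eqbP.
by case_ord i; vm_compute.
Qed.

Inductive positive : braid 3 -> Prop :=
| Positive1 : positive 1
| PositiveS1 g : positive g -> positive (g * s1)
| PositiveS2 g : positive g -> positive (g * s2^-1).

(** This is the normal form of the free product of Z/2 and Z/3: modulo the full twist [c], [s] has
    order 2 and [t] has order 3. In an alternating word the inner blocks [t * s] and [t * t * s] are
    [s2^-1] and [s1] modulo [c], so they form the positive part [p], while [x] and [y] are the
    incomplete blocks at the two ends. *)
Definition c_normal (g : braid 3) := exists z x p y,
  [/\ cyc c z, x = 1 \/ x = s, positive p, [\/ y = 1, y = t | y = t * t]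
    & g = z * x * p * y].

Lemma c_normal_central g : c_normal g -> c_normal (g * c) /\ c_normal (g * c^-1).
Proof.
case=> z [x [p [y [zc xs pp yt ->]]]].
split.
  exists (z * c), x, p, y; split=> //; first exact: cycMr.
  by rewrite -!mulgA; congr (_ * _); rewrite !mulgA -full_twist3_central !mulgA.
exists (z * c^-1), x, p, y; split=> //; first exact: cycVr.
have cV h : commute c^-1 h by apply/commute_sym/commuteV/commute_sym/full_twist3_central.
by rewrite -!mulgA; congr (_ * _); rewrite !mulgA -cV !mulgA.
Qed.

Lemma s_squared : s * s = c.
Proof. by rewrite -braid_class_cat; apply: braid_eqbP; vm_compute. Qed.

Lemma t_cubed : t * t * t = c.
Proof. by rewrite -!braid_class_cat; apply: braid_eqbP; vm_compute. Qed.

Lemma ts : t * s = s2^-1 * c.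
Proof. by rewrite -braid_class_inv -!braid_class_cat; apply: braid_eqbP; vm_compute. Qed.

Lemma tts : t * t * s = s1 * c.
Proof. by rewrite -!braid_class_cat; apply: braid_eqbP; vm_compute. Qed.

Lemma s1s : s1 * s = t * t.
Proof. by rewrite -!braid_class_cat; apply: braid_eqbP; vm_compute. Qed.

Lemma s2Vs : s2^-1 * s = t.
Proof. by rewrite -braid_class_inv -!braid_class_cat; apply: braid_eqbP; vm_compute. Qed.

Lemma c_normal_t g : c_normal g -> c_normal (g * t).
Proof.
case=> z [x [p [y [zc xs pp [->|->|->] ->]]]].
- by exists z, x, p, t; split=> //; [constructor 2|rewrite mulg1].
- by exists z, x, p, (t * t); split=> //; [constructor 3|rewrite !mulgA].
rewrite -mulgA t_cubed; apply: (c_normal_central _).1.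
by exists z, x, p, 1; split=> //; [constructor 1|rewrite mulg1].
Qed.

Lemma c_normal_s g : c_normal g -> c_normal (g * s).
Proof.
case=> z [x [p [y [zc xs pp [->|->|->] ->]]]]; last 2 first.
- rewrite -mulgA ts mulgA; apply: (c_normal_central _).1.
  exists z, x, (p * s2^-1), 1; split=> //; first exact: PositiveS2.
    by constructor 1.
  by rewrite mulg1 mulgA.
- rewrite -mulgA tts mulgA; apply: (c_normal_central _).1.
  exists z, x, (p * s1), 1; split=> //; first exact: PositiveS1.
    by constructor 1.
  by rewrite mulg1 mulgA.
(* With no trailing power of [t], the new [s] cancels the [s] hidden in the last positive letter,
   which leaves a power of [t]. *)
rewrite mulg1; case: pp => [|p' pp'|p' pp'].
- rewrite mulg1; case: xs => ->.
    exists z, s, 1, 1; split=> //; [by right|exact: Positive1|by constructor 1|].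
    by rewrite !mulg1.
  rewrite -mulgA s_squared; apply: (c_normal_central _).1.
  exists z, 1, 1, 1; split=> //; [by left|exact: Positive1|by constructor 1|].
  by rewrite !mulg1.
- exists z, x, p', (t * t); split=> //; first by constructor 3.
  by rewrite -!mulgA s1s.
- exists z, x, p', t; split=> //; first by constructor 2.
  by rewrite -!mulgA s2Vs.
Qed.

Lemma c_normalP g : c_normal g.
Proof.
(* Modulo the central [c], [t^-1] is [t * t] and [s^-1] is [s], so inverses cost only a power of
   [c]; and [s], [t] generate the group. *)
have PtV h : c_normal h -> c_normal (h * t^-1).
  move=> /c_normal_t/c_normal_t/c_normal_central[_].
  by rewrite -t_cubed -!mulgA !invgM !mulgA !mulgK.
have PsV h : c_normal h -> c_normal (h * s^-1).
  by move=> /c_normal_s/c_normal_central[_]; rewrite -s_squared invgM mulgA mulgK.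
have s1E : s1 = t^-1 * s.
  by rewrite -braid_class_inv -!braid_class_cat; apply: braid_eqbP; vm_compute.
have s2E : s2 = s * t^-1.
  by rewrite -braid_class_inv -!braid_class_cat; apply: braid_eqbP; vm_compute.
have letterE (i : 'I_3.-1) : sigma i = s1 \/ sigma i = s2.
  rewrite sigma_class; case_ord i; [left|right];
    by apply: braid_eqbP; vm_compute.
elim/braidW: g => w; elim/last_ind: w => [|w [i b] IH].
  exists 1, 1, 1, 1; split; [exact: cyc1|by left|exact: Positive1|by constructor 1|].
  by rewrite braid_class_eval !mulg1.
rewrite -cats1 braid_class_cat braid_class_letter.
by case: b; case: (letterE i) => ->; rewrite ?s1E ?s2E ?invgM ?invgK mulgA; auto using c_normal_t, c_normal_s.
Qed.

End BraidThree.

(** Up to a choice of basis this is the reduced Burau representation at -1, that is, the classical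
    map from B_3 to SL_2(Z). *)
Definition burau (g : braid 3) : mx2 := h1_mx (alpha (stab g)).

Lemma burauM g h : burau (g * h) = mulmx2 (burau g) (burau h).
Proof. by rewrite /burau !gmulfM h1_mxM. Qed.

Lemma burau1 : burau 1 = scalar2 1.
Proof. by rewrite /burau !multiplicative1 h1_mx1. Qed.

Lemma burau_class w : burau (braid_class (n := 3) w) =
  let u := act_word alpha_img alpha_imgV (stab_word (n := 2) w) in
  let v := fun x => u (wd 1 x) in
  Mx2 (weight false (v [:: 1%Z])) (weight false (v [:: 1; -2]%Z))
      (weight true (v [:: 1%Z])) (weight true (v [:: 1; -2]%Z)).
Proof.
have aE : gen_a = free_class (wd 1 [:: 1%Z]).
  by rewrite /gen_a free_gen_class; apply/fred_eqP/eqP; vm_compute.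
have abE : gen_ab = free_class (wd 1 [:: 1; -2]%Z).
  rewrite /gen_ab /gen_a /gen_b !free_gen_class -free_class_inv -free_class_cat.
  by apply/fred_eqP/eqP; vm_compute.
by rewrite /burau stabE /h1_mx aE abE /alpha !braid_autE !char_class.
Qed.

Lemma burau_letters :
  [/\ burau (Braid3 [:: 1%Z]) = Mx2 1%Z 1%Z 0%Z 1%Z,
      burau (Braid3 [:: 2%Z])^-1 = Mx2 1%Z 0%Z 1%Z 1%Z,
      burau (Braid3 [:: 1; 2; 1]%Z) = Mx2 0%Z 1%Z (-1)%Z 0%Z,
      burau (Braid3 [:: 1; 2]%Z) = Mx2 0%Z 1%Z (-1)%Z 1%Z
    & burau full_twist3 = Mx2 (-1)%Z 0%Z 0%Z (-1)%Z].
Proof. by rewrite -braid_class_inv !burau_class; split; vm_compute. Qed.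

(** Right multiplication by either letter adds one column to the other: nonnegativity persists, and
    an off-diagonal entry grows by a positive diagonal one. So only the empty positive word has a
    diagonal matrix. *)
Lemma positive_burau p : positive p ->
  [/\ 0 < m11 (burau p), 0 <= m12 (burau p), 0 <= m21 (burau p),
      0 < m22 (burau p) & p = 1%g \/ 0 < m12 (burau p) + m21 (burau p)]%R.
Proof.
have [e1 e2 _ _ _] := burau_letters.
elim=> [|g _|g _].
- by rewrite burau1 /=; split=> //; left.
- rewrite burauM e1; case: (burau g) => a b c d [/= *].
  by split; try right; lia.
- rewrite burauM e2; case: (burau g) => a b c d [/= *].
  by split; try right; lia.
Qed.

Lemma cyc_burau z : cyc full_twist3 z ->
  burau z = scalar2 (-1) \/ burau z = scalar2 1 /\ cyc (full_twist3 ^+ 2) z.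
Proof.
have [_ _ _ _ ec] := burau_letters.
have E k : burau (full_twist3 ^+ k) = scalar2 ((-1) ^+ k)%R.
  elim: k => [|k IH]; first exact: burau1.
  by rewrite expgS burauM ec IH /mulmx2 /scalar2 /= GRing.exprS; congr Mx2; ring.
have EV k : burau (full_twist3 ^- k) = scalar2 ((-1) ^+ k)%R.
  have := burauM (full_twist3 ^- k) (full_twist3 ^+ k).
  rewrite mulVg burau1 E -GRing.signr_odd; case: (burau _) => a b c d.
  by case: (odd k) => -[] /=; rewrite /scalar2 => *; congr Mx2; lia.
have cyc2 k : ~~ odd k -> full_twist3 ^+ k = (full_twist3 ^+ 2) ^+ k./2.
  by move=> ek; rewrite -expgnA mul2n even_halfK.
case=> k [->|->]; rewrite ?E ?EV -GRing.signr_odd; case: (boolP (odd k)) => ok.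
- by left.
- by right; split=> //; exists k./2; left; apply: cyc2.
- by left.
- by right; split=> //; exists k./2; right; rewrite (cyc2 k ok).
Qed.

Lemma burau_kernel g : burau g = scalar2 1 -> cyc (full_twist3 ^+ 2) g.
Proof.
have [_ _ es et _] := burau_letters.
have [z [x [p [y [zc xs pp yt gE]]]]] := c_normalP g.
case Ep: (burau p) (positive_burau pp) => [a11 a12 a21 a22] /= [p11 p12 p21 p22 p0].
(* The signs of the entries of [burau p] refute all combinations except [x = y = 1] with [z] a power
   of [full_twist3 ^+ 2]; there the off-diagonal zeros force [p = 1]. *)
move: gE; case: xs => ->; case: yt => -> ->; rewrite ?mulg1;
  rewrite !burauM ?es ?et Ep; case: (cyc_burau zc) => [->|[-> zc2]] /=;
  rewrite /scalar2 => -[] /= *; try (exfalso; lia).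
case: p0 => [->|]; last by lia.
by rewrite mulg1.
Qed.

(** Centrality is asked in the whole braid group, so that these elements also move past coset
    representatives that are not pure. *)
Definition central_pure n (z : braid n) := (forall g, commute z g) /\ is_pure z.

Lemma central_pure1 n : @central_pure n 1.
Proof. by split; [exact: (fun g => commute_sym (commute1 g))|exact: (is_pure_closed n).1]. Qed.

Lemma central_pureM n (z z' : braid n) :
  central_pure z -> central_pure z' -> central_pure (z * z').
Proof.
move=> [zc zp] [z'c z'p]; split; last exact: group_closedM (@is_pure_closed n) _ _ zp z'p.
by move=> g; apply/commute_sym/commuteM; apply/commute_sym.
Qed.

Lemma central_pureV n (z : braid n) : central_pure z -> central_pure z^-1.
Proof.
move=> [zc zp]; split; last exact: group_closedV (@is_pure_closed n) _ zp.
by move=> g; apply/commute_sym/commuteV/commute_sym.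
Qed.

Definition full_twist4 := Braid4 (flatten (nseq 4 [:: 1; 2; 3]))%Z.

Lemma pure_word_check n (w : word 'I_n.-1) :
  all (fun p => strand_end p w == p) (iota 0 n) -> pure_word w.
Proof.
move=> /allP wp; apply/pure_wordP=> p pn; apply/eqP/wp.
by rewrite mem_iota.
Qed.

Lemma full_twist4_central_pure : central_pure full_twist4.
Proof.
split; last by rewrite is_pure_class; apply: pure_word_check; vm_compute.
apply: braid_center => i.
rewrite sigma_class /commute /full_twist4 /Braid4 -!braid_class_cat; apply: braid_eqbP.
by case_ord i; vm_compute.
Qed.

Lemma alpha_center z : (forall g, commute z g) -> alpha z = 1.
Proof.
move=> zc; apply: aut_eqP => x; apply: dfg_inj.
by rewrite dfg_alpha zc mulgK.
Qed.

Lemma dfg_conj (g : braid 4) w : g * dfg w = dfg (alpha g w) * g.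
Proof. by rewrite dfg_alpha mulgVK. Qed.

Lemma dfg_stab g : exists w b, g = dfg w * stab b.
Proof.
(* The only generator outside the image of [stab]: [a] is [sigma1 * sigma3^-1] and the two factors
   commute. *)
have s3E : @sigma 4 (@Ordinal 3 2 isT) = dfg (gen_a^-1) * stab (@sigma 3 (@Ordinal 2 0 isT)).
  rewrite multiplicativeV /= /gen_a dfg_gen sigma_class [@sigma 3 _]sigma_class stabE.
  by rewrite -braid_class_inv -braid_class_cat; apply: braid_eqbP; vm_compute.
have s12E (i : 'I_4.-1) : i < 2 -> exists b, sigma i = stab b.
  move=> i2; exists (@sigma 3 (Ordinal i2)).
  rewrite [@sigma 3 _]sigma_class stabE sigma_class; congr braid_class.
  by congr [:: (_, _)]; apply: val_inj.
move: g; apply: presented_ind => [|i|g h [w [b ->]] [w' [b' ->]]|g [w [b ->]]].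
- by exists 1, 1; rewrite !multiplicative1 mulg1.
- rewrite -[gen _ i]/(@sigma 4 i); case: (ltnP i 2) => [/s12E[b ->]|i2].
    by exists 1, b; rewrite multiplicative1 mul1g.
  have -> : i = @Ordinal 3 2 isT by apply: val_inj; case: i i2 => -[|[|[|?]]].
  by eexists; eexists; exact: s3E.
- exists (w * alpha (stab b) w'), (b * b').
  by rewrite !gmulfM -!mulgA; congr (_ * _); rewrite !mulgA dfg_conj.
exists (alpha (stab b)^-1 w^-1), b^-1.
by rewrite invgM -!multiplicativeV dfg_conj.
Qed.

Lemma alpha_kernel g : alpha g = 1 -> central_pure g.
Proof.
(* It suffices to place [g] in this subgroup: there [alpha] sees only the inner automorphism of the
   free part, which is faithful. *)
pose D h := exists w z, central_pure z /\ h = dfg w * z.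
have D1 : D 1.
  by exists 1, 1; rewrite multiplicative1 mulg1; split=> //; apply: central_pure1.
have DM h h' : D h -> D h' -> D (h * h').
  move=> [w [z [zp ->]]] [w' [z' [z'p ->]]]; exists (w * w'), (z * z').
  split; first exact: central_pureM.
  by rewrite gmulfM -!mulgA; congr (_ * _); rewrite !mulgA zp.1.
have DV h : D h -> D h^-1.
  move=> [w [z [zp ->]]]; exists w^-1, z^-1; split; first exact: central_pureV.
  by rewrite invgM multiplicativeV (central_pureV zp).1.
have [w [b ->]] := dfg_stab g => a1.
have Db : D (stab b).
  have : cyc (full_twist3 ^+ 2) b.
    apply: burau_kernel; move: (congr1 h1_mx a1).
    rewrite gmulfM /= alpha_dfg h1_mxM h1_mx_inner h1_mx1 -/(burau b).
    by case: (burau b) => ? ? ? ?; rewrite /mulmx2 /scalar2 /= => -[*]; congr Mx2; lia.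
  apply: (cyc_sub (H := fun b => D (stab b))) => [|x y|x|].
  - by rewrite multiplicative1.
  - by rewrite gmulfM; apply: DM.
  - by rewrite multiplicativeV; apply: DV.
  (* The squared full twist on three strands acts trivially on homology but not on the free group:
     it acts as conjugation by this commutator of [a] and [b]. *)
  exists (F2 [:: 2; -1; -2; 1]%Z), full_twist4.
  split; first exact: full_twist4_central_pure.
  rewrite expg2 gmulfM /= /full_twist3 stabE dfgE -!braid_class_cat.
  by apply: braid_eqbP; vm_compute.
have [w' [z [zp gE]]] : D (dfg w * stab b).
  by apply: DM => //; exists w, 1; rewrite mulg1; split=> //; apply: central_pure1.
have w1 : inner_aut w' = 1.
  by move: a1; rewrite gE gmulfM /= alpha_dfg (alpha_center zp.1) mulg1.
have -> : dfg w * stab b = z; last by [].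
rewrite gE (_ : w' = 1) ?multiplicative1 ?mul1g //.
by apply: inner_aut_inj; rewrite w1 multiplicative1.
Qed.

(** * Automorphisms of the free group of rank 2 *)

Section LongestCommonPrefix.
Variable T : eqType.
Implicit Types u v w : seq T.

Fixpoint lcp u v : nat :=
  match u, v with
  | x :: u', y :: v' => if x == y then (lcp u' v').+1 else 0
  | _, _ => 0
  end.

Lemma lcpC u v : lcp u v = lcp v u.
Proof. by elim: u v => [|x u IH] [|y v] //=; rewrite eq_sym IH. Qed.

Lemma lcp_leql u v : lcp u v <= size u.
Proof. by elim: u v => [|x u IH] [|y v] //=; case: ifP => // _; apply: IH. Qed.

Lemma lcp_leqr u v : lcp u v <= size v.
Proof. by rewrite lcpC lcp_leql. Qed.

Lemma take_lcp u v : take (lcp u v) u = take (lcp u v) v.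
Proof. by elim: u v => [|x u IH] [|y v] //=; case: eqP => //= -> ; rewrite IH. Qed.

Lemma leq_lcp m u v : m <= size u -> m <= size v -> take m u = take m v ->
  m <= lcp u v.
Proof.
elim: m u v => // m IH [|x u] [|y v] //= mu mv [-> uv].
by rewrite eqxx ltnS; apply: IH.
Qed.

Lemma lcp_drop u v x u' y v' :
  drop (lcp u v) u = x :: u' -> drop (lcp u v) v = y :: v' -> x != y.
Proof.
elim: u v => [|a u IH] [|b v] //=; case: eqP => /= [_|ab]; first exact: IH.
by case=> <- _ [<- _]; apply/eqP.
Qed.

Lemma lcp_catl p u u' v : lcp (p ++ u) v < size p -> lcp (p ++ u') v = lcp (p ++ u) v.
Proof.
elim: p v => [|x p IH] [|y v] //=; case: ifP => // _.
by rewrite ltnS => /IH ->.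
Qed.

End LongestCommonPrefix.

Section FreeLength.
Variable k : nat.
Implicit Types (g h x y : free_group k) (u v w : word 'I_k).

Definition len g := size (normal_form g).

Lemma lenV g : len g^-1 = len g.
Proof. by rewrite /len normal_formV size_rev size_map. Qed.

Lemma len_eq0 g : len g = 0 -> g = 1.
Proof. by move/size0nil => g0; apply: normal_form_inj; rewrite g0 normal_form1. Qed.

Lemma normal_form_mulV x y : let c := lcp (normal_form x) (normal_form y) in
  normal_form (x^-1 * y) =
    inv_word (drop c (normal_form x)) ++ drop c (normal_form y).
Proof.
move=> c; rewrite -{1}(normal_formK x) -{1}(normal_formK y) -free_class_inv.
rewrite -free_class_cat normal_formE.
have [rx ry] := (reduced_normal_form x, reduced_normal_form y).
rewrite -{1}(cat_take_drop c (normal_form x)) -{1}(cat_take_drop c (normal_form y)).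
have cE := take_lcp (normal_form x) (normal_form y); rewrite -/c in cE.
have cancelE p u v : fred (inv_word (p ++ u) ++ p ++ v) = fred (inv_word u ++ v).
  rewrite inv_word_cat -catA; apply/free_classP.
  by rewrite !free_class_cat !free_class_inv mulKg.
rewrite cE cancelE fred_id //.
have rdx : reduced (inv_word (drop c (normal_form x))).
  by rewrite reduced_inv; apply: (@reduced_catr _ (take c (normal_form x))); rewrite cat_take_drop.
have rdy : reduced (drop c (normal_form y)).
  by apply: (@reduced_catr _ (take c (normal_form y))); rewrite cat_take_drop.
case dx: (drop c (normal_form x)) rdx => [|l u] //; case dy: (drop c (normal_form y)) rdy => [|l' v].
  by rewrite cats0.
rewrite -[l :: u]cat1s inv_word_cat -[inv_word [:: l]]/[:: inv_letter l] cats1 => r1 r2; rewrite reduced_cat r1 r2 andbT /=.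
rewrite /cancelling /= inv_letterK; have := lcp_drop dx dy.
by rewrite eq_sym.
Qed.

(** The common prefix is the Gromov product of [x] and [y] based at 1; inequalities between lengths
    thereby become inequalities between prefixes. *)
Lemma len_mulV x y :
  len (x^-1 * y) + (lcp (normal_form x) (normal_form y)).*2 = len x + len y.
Proof.
rewrite /len normal_form_mulV size_cat size_rev size_map !size_drop.
set c := lcp _ _; have cx : c <= size (normal_form x) := lcp_leql _ _.
by have cy : c <= size (normal_form y) := lcp_leqr _ _; lia.
Qed.

(** If [u] agreed with its inverse up to the middle, either its middle letter would be its own
    inverse, or its two middle letters would cancel. *)
Lemma lcp_inv_word u : reduced u -> 0 < size u -> (lcp u (inv_word u)).*2 < size u.
Proof.
move=> ru u0; rewrite ltnNge; apply/negP=> uc.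
have [x0 _] : {x0 : 'I_k * bool | True} by case: u u0 {ru uc} => // l; exists l.
have nthE i : i < lcp u (inv_word u) -> nth x0 u i = inv_letter (nth x0 u (size u - i.+1)).
  move=> ic; rewrite -(nth_take x0 ic) take_lcp nth_take // /inv_word.
  have iu : i < size u by apply: leq_trans ic (lcp_leql _ _).
  rewrite nth_rev size_map // (nth_map x0) //; lia.
have inv_neq (l : 'I_k * bool) : l != inv_letter l.
  by case: l => x [] /=; rewrite /inv_letter xpair_eqE eqxx.
have [ou|eu] := boolP (odd (size u)).
  have := nthE (size u)./2; have -> : size u - (size u)./2.+1 = (size u)./2 by lia.
  move=> /(_ ltac:(lia)) e; by have := inv_neq (nth x0 u (size u)./2); rewrite -e eqxx.
have := nthE (size u)./2.-1.
have -> : size u - (size u)./2.-1.+1 = (size u)./2.-1.+1 by lia.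
move=> /(_ ltac:(lia)) e.
move/(sortedP x0)/(_ (size u)./2.-1 ltac:(lia)): ru.
by rewrite /cancelling e inv_letterK eqxx.
Qed.

End FreeLength.

Section NielsenReduced.
Variables (k : nat) (U : 'I_k -> free_group k).
Implicit Types (l p q : 'I_k * bool) (w : word 'I_k).

Let X l := normal_form (eval_letter U l).

Lemma X_inv l : X (inv_letter l) = inv_word (X l).
Proof. by rewrite /X eval_inv_letter normal_formV. Qed.

(** In a reduced word [l] is preceded by some [inv_letter p] and followed by some [q] as here: the
    cancellations on the two sides never use up the whole image of [l]. *)
Hypothesis nielsen : forall l p q, p != l -> q != inv_letter l ->
  lcp (X p) (X l) + lcp (X (inv_letter l)) (X q) < size (X l).

Lemma inv_word_size (Y : Type) (u : word Y) : size (inv_word u) = size u.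
Proof. by rewrite size_rev size_map. Qed.

(* Multiplying by one more letter cancels only inside the remainder of the  *)
(* last factor, and leaves at least one letter of it.                       *)
Lemma nielsen_product w l : reduced (rcons w l) ->
  exists W C S, [/\ normal_form (eval U (rcons w l)) = W ++ S, X l = C ++ S,
    exists2 p, p != l & size C <= lcp (X p) (X l) & size w <= size W].
Proof.
elim/last_ind: w l => [|w l IH] q rw.
  exists [::], [::], (X q); split; rewrite ?eval_cat //= ?mulg1 //.
  exists (inv_letter q) => //.
  by case: q {rw} => x [] /=; rewrite /inv_letter xpair_eqE eqxx.
have [rwl lq] : reduced (rcons w l) /\ q != inv_letter l.
  move: rw; rewrite -cats1 reduced_cat => /and3P[-> /=].
  by rewrite /cancelling.
have [W [C [S [gE lE [p pl Cp] wW]]]] := IH l rwl.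
set g := eval U (rcons w l) in gE.
have d_lt := nielsen pl lq; set d := lcp (X (inv_letter l)) (X q) in d_lt.
have sX : size (X l) = size C + size S by rewrite lE size_cat.
have Sd : d < size S by lia.
have lcpE : lcp (normal_form g^-1) (X q) = d.
  rewrite normal_formV gE inv_word_cat /d X_inv lE inv_word_cat.
  by apply: lcp_catl; rewrite inv_word_size -inv_word_cat -lE -X_inv.
exists (W ++ take (size S - d) S), (take d (X q)), (drop d (X q)).
split; rewrite ?cat_take_drop //.
- rewrite -cats1 eval_cat /= mulg1 -/g -{1}(invgK g) normal_form_mulV -/(X q) lcpE.
  congr (_ ++ _); rewrite normal_formV gE.
  rewrite inv_word_cat drop_cat inv_word_size Sd inv_word_cat inv_wordK.
  congr (_ ++ _); rewrite /inv_word drop_rev map_rev revK size_map -map_take.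
  by rewrite -map_comp map_id_in // => i _ /=; rewrite inv_letterK.
- exists (inv_letter l); first by rewrite eq_sym.
  by rewrite size_take -/d; case: ltnP.
- rewrite size_rcons size_cat size_take; case: ifP; lia.
Qed.

Lemma nielsen_len w : reduced w -> size w <= len (eval U w).
Proof.
elim/last_ind: w => // w l _ rw; rewrite size_rcons.
have [W [C [S [gE lE [p pl Cp] wW]]]] := nielsen_product rw.
have sX : size (X l) = size C + size S by rewrite lE size_cat.
have ll : l != inv_letter l.
  by case: (l) => x [] /=; rewrite /inv_letter xpair_eqE eqxx.
have := nielsen pl ll.
by rewrite /len gE size_cat; lia.
Qed.

End NielsenReduced.

Section AutFreeWords.
Variables (k : nat) (f : automorphism (free_group k)).

Lemma aut_eval w : f (free_class w) = eval (fun i => f (free_gen i)) w.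
Proof.
elim: w => [|[i b] w IH]; first by rewrite free_class_eval aut1.
rewrite -cat1s free_class_cat aut_morph IH free_class_letter /= /eval_letter.
by case: b => //=; rewrite autV.
Qed.

Lemma aut_letter l : f (free_class [:: l]) = eval_letter (fun i => f (free_gen i)) l.
Proof. by rewrite aut_eval /= mulg1. Qed.

End AutFreeWords.

Lemma len_class k (w : word 'I_k) : len (free_class w) <= size w.
Proof.
rewrite /len normal_formE; elim: w => //= l w; case: (fred w) => //= l' u.
by case: ifP => //=; lia.
Qed.

Lemma free_class_inv_letter k (l : 'I_k * bool) :
  free_class [:: inv_letter l] = (free_class [:: l])^-1.
Proof. by rewrite -free_class_inv. Qed.

Lemma len_letter k (l : 'I_k * bool) : len (free_class [:: l]) = 1%N.
Proof. by rewrite /len normal_formE. Qed.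

Lemma ord2_cases (l p q : 'I_2 * bool) : p.1 != l.1 -> q.1 != l.1 ->
  q = p \/ q = inv_letter p.
Proof.
case: l p q => [[[|[|?]] ?] b] [[[|[|?]] ?] c] [[[|[|?]] ?] d] //= _ _;
  rewrite /inv_letter /=; case: c; case: d; (try by left; congr (_, _); apply: val_inj);
  by right; congr (_, _); apply: val_inj.
Qed.

Lemma same_letter (l p : 'I_2 * bool) : p.1 = l.1 -> p = l \/ p = inv_letter l.
Proof.
case: l p => [i b] [j c] /= ->; rewrite /inv_letter /=.
by case: b; case: c; [left|right|right|left].
Qed.

Definition free_letter (l : 'I_2 * bool) : free_group 2 := free_class [:: l].
Local Notation L := free_letter.

Lemma free_letterV l : L (inv_letter l) = (L l)^-1.
Proof. exact: free_class_inv_letter. Qed.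

(** Each elementary Nielsen move comes from one braid generator: [sigma1] and [sigma3] multiply [b]
    by [a^-1] on the right and on the left, and conjugates of generators do likewise for [a]. *)
Definition transvection (l p : 'I_2 * bool) : word 'I_4.-1 :=
  wd 2 (if val l.1 == 0%N then
          match l.2, p.2 with
          | false, false => [:: -1; -2; 1]
          | false, true => [:: -1; 2; 1]
          | true, false => [:: 2; 3; -2]
          | true, true => [:: 2; -3; -2]
          end
        else
          match l.2, p.2 with
          | false, false => [:: 3]
          | false, true => [:: -3]
          | true, false => [:: -1]
          | true, true => [:: 1]
          end)%Z.

Lemma transvectionE l p : l.1 != p.1 ->
  let g := alpha (braid_class (n := 4) (transvection l p)) in
  g (L l) = (L p)^-1 * L l /\ g (L p) = L p.
Proof.
move=> lp /=; rewrite -free_letterV /free_letter -free_class_cat.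
rewrite /alpha !braid_autE; move: lp.
by case: l => [i b]; case: p => [j c]; case_ord i; case_ord j => //= _;
  case: b; case: c; split; apply/fred_eqP/eqP; vm_compute.
Qed.

Definition total_len (f : automorphism (free_group 2)) := len (f gen_a) + len (f gen_b).

Lemma total_len_letters f (l p : 'I_2 * bool) : l.1 != p.1 ->
  total_len f = len (f (L l)) + len (f (L p)).
Proof.
have lenL l' : len (f (L l')) = len (f (free_gen l'.1)).
  by case: l' => i b; rewrite /free_letter free_class_letter; case: b; rewrite // autV lenV.
rewrite !lenL /total_len /gen_a /gen_b; move: l.1 p.1 => i j.
case: i => [[|[|?]] ?] //; case: j => [[|[|?]] ?] // _; last rewrite addnC;
  by congr (len (f (free_gen _)) + len (f (free_gen _))); apply: val_inj.
Qed.

(** * Length-minimal automorphisms have Nielsen-reduced images *)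

Section Minimal.
Variable f : automorphism (free_group 2).
Hypothesis f_min : forall g : braid 4, total_len f <= total_len (f * alpha g).

Let X l := normal_form (f (L l)).

Lemma XV l : X (inv_letter l) = inv_word (X l).
Proof. by rewrite /X free_letterV autV normal_formV. Qed.

Lemma X_size l : 0 < size (X l).
Proof.
rewrite lt0n; apply/eqP=> /len_eq0/(congr1 (aut_inv f)).
rewrite aut_funK => L1; have := len_letter l.
by rewrite -/(L l) L1 -(aut1 f) aut_funK /len normal_form1.
Qed.

(** Otherwise the transvection sending [l] to [p^-1 l] would shorten [f]. *)
Lemma lcp_half (l p : 'I_2 * bool) : l.1 != p.1 -> (lcp (X p) (X l)).*2 <= size (X p).
Proof.
move=> lp; have [gl gp] := transvectionE lp.
have := f_min (braid_class (transvection l p)).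
rewrite !(total_len_letters _ lp) /= gl gp aut_morph autV.
have lia_aux (a b x y : nat) : a + b = y + x -> x + y <= a + y -> b <= y by lia.
exact: lia_aux (len_mulV (f (L p)) (f (L l))).
Qed.

Lemma lcp_self l : (lcp (X l) (X (inv_letter l))).*2 < size (X l).
Proof. by rewrite XV; apply: lcp_inv_word (X_size l); apply: reduced_normal_form. Qed.

(** Each side cancels at most half of [X l], so only the case of two exact halves is delicate. A
    transvection alone need not shorten anything there. Instead of the usual lexicographic
    tie-break, the proof conjugates as well, inner automorphisms being available through [dfg]. *)
Lemma minimal_nielsen (l p q : 'I_2 * bool) : p != l -> q != inv_letter l ->
  lcp (X p) (X l) + lcp (X (inv_letter l)) (X q) < size (X l).
Proof.
move=> pl ql; have selfV := lcp_self l; have szV : size (X (inv_letter l)) = size (X l).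
  by rewrite XV inv_word_size.
have V1 : (inv_letter l).1 = l.1 by [].
have lia2 (a b s : nat) : a.*2 < s -> b.*2 <= s -> a + b < s by lia.
have [/same_letter[e|pE]|pl1] := eqVneq p.1 l.1; first by rewrite e eqxx in pl.
  rewrite pE lcpC; apply: (lia2 _ _ _ selfV).
  have [/same_letter[qE|e]|ql1] := eqVneq q.1 l.1.
  - by rewrite qE lcpC; apply: ltnW.
  - by rewrite e eqxx in ql.
  by rewrite -szV; apply: lcp_half.
have hp : (lcp (X p) (X l)).*2 <= size (X l).
  by rewrite lcpC; apply: lcp_half.
have [/same_letter[qE|e]|ql1] := eqVneq q.1 l.1.
- by rewrite qE addnC; apply: lia2 hp; rewrite lcpC.
- by rewrite e eqxx in ql.
have hq : (lcp (X (inv_letter l)) (X q)).*2 <= size (X l).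
  by rewrite -szV; apply: lcp_half.
rewrite ltnNge; apply/negP=> bad; set h := lcp (X p) (X l) in hp bad.
have [h2 hq2] : size (X l) = h.*2 /\ lcp (X (inv_letter l)) (X q) = h.
  move: hp hq bad; move: (lcp _ (X q)) (size _) h => a b c; lia.
have takep : take h (X p) = take h (X l) by apply: take_lcp.
have takeq : take h (X (inv_letter l)) = take h (X q) by rewrite -hq2; apply: take_lcp.
have hl : h <= size (X l) by rewrite h2; lia.
have hV : h <= size (X (inv_letter l)) by rewrite szV.
have pl' : l.1 != p.1 by rewrite eq_sym.
have hp2 : h.*2 <= size (X p) by apply: lcp_half.
(* If [q = p], the first halves of [X l] and of its inverse agree, against [lcp_self]. If [q] is the
   inverse of [p], then [X p] begins with the first half [H] of [X l] and ends with its second half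
   [K]. *)
have [qp|qp] := ord2_cases pl1 ql1.
  have : h <= lcp (X l) (X (inv_letter l)).
    by apply: leq_lcp; rewrite // takeq qp takep.
  by move: selfV; rewrite h2; move: (lcp _ _) => a; lia.
pose H := take h (X l); pose K := drop h (X l); pose R := take (size (X p) - h.*2) (drop h (X p)).
have lE : X l = H ++ K by rewrite cat_take_drop.
have take_inv (u : word 'I_2) : take h (inv_word u) = inv_word (drop (size u - h) u).
  by rewrite /inv_word take_rev size_map map_drop.
have KE : K = drop (size (X p) - h) (X p).
  apply: (can_inj (@inv_wordK _)); rewrite -take_inv -XV -qp -takeq XV take_inv.
  by congr (inv_word (drop _ _)); rewrite h2; lia.
have pE' : X p = H ++ R ++ K.
  rewrite KE /H -takep /R -[X in _ = _ ++ _ ++ X](_ : drop (size (X p) - h.*2) (drop h (X p)) = _).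
    by rewrite !cat_take_drop.
  by rewrite drop_drop; congr drop; lia.
have fl : f (L l) = free_class H * free_class K.
  by rewrite -free_class_cat -lE normal_formK.
have fp : f (L p) = free_class H * free_class R * free_class K.
  by rewrite -!free_class_cat -catA -pE' normal_formK.
(* After conjugation by [H^-1] and the move from [p] to [p * l^-1], the images become [K H], as long
   as [X l], and [R], shorter than [X p] by the full length of [X l]: this contradicts
   minimality. *)
pose u := aut_inv f (free_class H)^-1.
have fu x : f (u * x * u^-1) = (free_class H)^-1 * f x * free_class H.
  by rewrite !aut_morph autV /u aut_invK invgK.
have [|tp tl] := @transvectionE (inv_letter p) (inv_letter l) => //.
have := f_min (dfg u * braid_class (n := 4) (transvection (inv_letter p) (inv_letter l))).
set t := alpha (braid_class _) in tp tl *.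
have tl' : t (L l) = L l by apply: invg_inj; rewrite -autV -free_letterV.
have tp' : t (L p) = L p * (L l)^-1.
  by apply: invg_inj; rewrite -autV -(free_letterV p) tp !free_letterV invgM.
rewrite gmulfM /= alpha_dfg -/t !(total_len_letters _ pl') /= /conj_by tl' tp'.
rewrite !fu aut_morph autV fl fp !mulgA mulVg !mul1g invgM !mulgA mulgK mulgVK.
rewrite -!free_class_cat -catA -lE -pE' !normal_formK.
have := len_class (K ++ H); have := len_class R.
have := X_size l; rewrite -/(len (f (L l))) -/(len (f (L p))).
have sE : size (K ++ H) = len (f (L l)) by rewrite size_cat addnC -size_cat -lE.
have sR : (size R + h.*2)%N = len (f (L p)).
  have := congr1 size pE'; have := congr1 size lE; rewrite !size_cat => e1 e2.
  by rewrite -[RHS]/(size (X p)) e2; move: e1; rewrite h2 => ->; lia.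
rewrite sE; have : len (f (L l)) = h.*2 := h2.
move: sR; move: (len _) (len _) (len _) (len _) (size _) => *; lia.
Qed.

End Minimal.

Definition flip_word (x : 'I_2) : word 'I_2 := [:: (x, val x == 0%N)].

Lemma flip_wordK x : subst flip_word (flip_word x) == [:: (x, false)].
Proof. by case_ord x; vm_compute. Qed.

Definition flip : automorphism (free_group 2) := subst_aut flip_wordK flip_wordK.

Lemma flipE w : flip (free_class w) = free_class (subst flip_word w).
Proof. exact: free_lift_subst. Qed.

Lemma aut_mulE (G : groupType) (f g : automorphism G) x : (f * g) x = f (g x).
Proof. by []. Qed.

Definition aut_by_braid (f : automorphism (free_group 2)) :=
  exists g, f = alpha g \/ f = flip * alpha g.

Lemma aut_by_braidMr f g : aut_by_braid (f * alpha g) -> aut_by_braid f.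
Proof.
have fE : f = f * alpha g * alpha g^-1 by rewrite multiplicativeV mulgK.
case=> h [e|e]; exists (h * g^-1); rewrite fE e gmulfM; first by left.
by right; rewrite mulgA.
Qed.

(** There are eight signed permutations of the basis; the Boolean marks the four of determinant -1,
    which need [flip]. *)
Lemma aut_by_braid_letters l p : l.1 != p.1 ->
  exists2 f, aut_by_braid f & f (free_letter l) = gen_a /\ f (free_letter p) = gen_b.
Proof.
move=> lp.
have [s [b H]] : exists s b,
    [&& fred ((if b then subst flip_word else id) (act_word alpha_img alpha_imgV (wd 2 s) [:: l])) == wd 1 [:: 1%Z]
      & fred ((if b then subst flip_word else id) (act_word alpha_img alpha_imgV (wd 2 s) [:: p])) == wd 1 [:: 2%Z]].
  move: lp; case: l => [i c]; case: p => [j d]; case_ord i; case_ord j => //= _; case: c; case: d.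
  - by exists [:: 1; 2; 1; 3; 2; 1]%Z, false; vm_compute.
  - by exists [::], true; vm_compute.
  - by exists [:: 1; 2; 1; 3; 2; 1]%Z, true; vm_compute.
  - by exists [::], false; vm_compute.
  - by exists [:: -1; -3; -2]%Z, true; vm_compute.
  - by exists [:: 2; 1; 3]%Z, false; vm_compute.
  - by exists [:: -1; -3; -2]%Z, false; vm_compute.
  - by exists [:: 2; 1; 3]%Z, true; vm_compute.
have genE : free_class (wd 1 [:: 1%Z]) = gen_a /\ free_class (wd 1 [:: 2%Z]) = gen_b.
  by rewrite /gen_a /gen_b !free_gen_class; split; apply/fred_eqP/eqP; vm_compute.
exists ((if b then flip else 1) * alpha (Braid4 s)).
  by exists (Braid4 s); case: b {H}; [right|left; rewrite mul1g].
move: H genE; rewrite /free_letter /alpha !aut_mulE !braid_autE => /andP[/eqP ea /eqP eb] [<- <-].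
rewrite -ea -eb !free_class_fred.
by case: b {ea eb}; rewrite ?flipE.
Qed.

Theorem aut_free_group2 f : aut_by_braid f.
Proof.
have [m] := ubnP (total_len f); elim: m f => // m IH f fm.
have [[g lt_g]|min_f] := pselect (exists g, total_len (f * alpha g) < total_len f).
  by apply: (@aut_by_braidMr _ g); apply: IH; lia.
have {}min_f g : total_len f <= total_len (f * alpha g).
  by rewrite leqNgt; apply/negP=> lt_g; apply: min_f; exists g.
(* By [nielsen_len] a word is no longer than its image, so an element of length one is the image of
   a single letter: the minimal [f] is a signed permutation of the basis. *)
have letterP y : len y = 1%N -> exists l, f (free_letter l) = y.
  move=> y1; pose w := normal_form (aut_inv f y).
  have fw : f (free_class w) = y by rewrite /w normal_formK aut_invK.
  have : size w <= 1.
    apply: leq_trans (_ : len y <= 1); last by rewrite y1.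
    rewrite -fw aut_eval; apply: nielsen_len (reduced_normal_form _) => l p q.
    by rewrite -!aut_letter; apply: minimal_nielsen.
  case: w fw => [|l [|l' w]] // fw _; last by exists l.
  by move: y1; rewrite -fw free_class_eval aut1 /len normal_form1.
have [l fl] : exists l, f (free_letter l) = gen_a.
  by apply: letterP; rewrite /gen_a free_gen_class len_letter.
have [p fp] : exists l, f (free_letter l) = gen_b.
  by apply: letterP; rewrite /gen_b free_gen_class len_letter.
have lp : l.1 != p.1.
  apply/eqP=> /same_letter lp.
  suff : gen_a = gen_b \/ gen_a = gen_b^-1.
    by rewrite /gen_a /gen_b !free_gen_class -free_class_inv => -[] /free_classP.
  by case: lp => lp; [left|right]; rewrite -fl -fp lp // free_letterV autV.
have [h [g hg] [hl hp]] := aut_by_braid_letters lp.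
have -> : f = h; last by exists g.
have agree x : f (free_letter x) = h (free_letter x) -> f (free_gen x.1) = h (free_gen x.1).
  case: x => i b; rewrite /free_letter free_class_letter; case: b => //.
  by rewrite !autV => /invg_inj.
apply: aut_ext => i; have := agree l; have := agree p; rewrite fl fp hl hp.
move=> /(_ erefl) ep /(_ erefl) el.
have [->|->] // : i = l.1 \/ i = p.1.
by move: lp {el ep agree fl fp hl hp}; case: l => [j c]; case: p => [j' d] /=;
  case_ord i; case_ord j; case_ord j' => // _; (try by left; apply: val_inj);
  by right; apply: val_inj.
Qed.

(** * The index of the pure braid quotient *)

Section QuotientLift.
Variables (G H : groupType) (N : normal_subgroup G) (h : {multiplicative G -> H}).
Hypothesis hN : forall x, N x -> h x = 1.

Definition quotient_lift of (forall x, N x -> h x = 1) : quotient_group N -> H :=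
  fun q => h (repr q).

Lemma quotient_liftE x : quotient_lift hN (proj N x) = h x.
Proof.
rewrite /quotient_lift; apply: (@mulgI _ (h (repr (proj N x)))^-1).
by rewrite mulVg -multiplicativeV -gmulfM hN //; apply: repr_projP.
Qed.

Lemma quotient_liftM : {morph quotient_lift hN : x y / x * y}.
Proof.
elim/projW=> x; elim/projW=> y.
by rewrite -projM !quotient_liftE gmulfM.
Qed.

HB.instance Definition _ :=
  isMultiplicative.Build (quotient_group N) H (quotient_lift hN) quotient_liftM.

End QuotientLift.

Lemma braid_ofM n (x y : pure_braid n) : braid_of (x * y) = braid_of x * braid_of y.
Proof. exact: valM. Qed.

HB.instance Definition _ n :=
  isMultiplicative.Build (pure_braid n) (braid n) (@braid_of n) (@braid_ofM n).

Lemma braid_of_inj n : injective (@braid_of n).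
Proof. exact: val_inj. Qed.

Definition pure_alpha : pure_braid 4 -> automorphism (free_group 2) :=
  alpha \o @braid_of 4.
HB.instance Definition _ := Multiplicative.on pure_alpha.

Lemma dfg_square_pure x : is_pure (dfg (free_gen x * free_gen x)).
Proof.
rewrite free_gen_class -free_class_cat dfgE is_pure_class; apply: pure_word_check.
by case_ord x; vm_compute.
Qed.

(** [z] is only known to commute with pure braids. The squares of [a] and [b] are pure, hence fixed
    by [z], and uniqueness of square roots gives that [a] and [b] are fixed. *)
Lemma pure_alpha_center z : center (pure_braid 4) z -> pure_alpha z = 1.
Proof.
move=> zc; apply: aut_ext => x; apply: square_root_gen.
rewrite -aut_morph; apply: dfg_inj; rewrite dfg_alpha.
have := zc (PureBraid (dfg_square_pure x)) => /(congr1 (@braid_of 4)).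
by rewrite !braid_ofM /= => ->; rewrite mulgK.
Qed.

Definition dfg_action : K4 -> automorphism (free_group 2) := quotient_lift pure_alpha_center.
HB.instance Definition _ := Multiplicative.on dfg_action.

Lemma dfg_actionE p : dfg_action (proj _ p) = alpha (braid_of p).
Proof. exact: quotient_liftE. Qed.

Lemma dfg_action_inj : injective dfg_action.
Proof.
apply: multiplicative_inj; elim/projW=> p; rewrite /= dfg_actionE => /alpha_kernel[pc _].
rewrite -(multiplicative1 (proj (center (pure_braid 4)))); apply/projP.
rewrite mulg1; apply: nsgV => x; apply: braid_of_inj.
by rewrite !braid_ofM pc.
Qed.

Lemma range_dfg_action f : range dfg_action f <-> exists2 g, is_pure g & alpha g = f.
Proof.
split=> [[k _ <-]|[g gp <-]].
  by move: k; elim/projW=> p; exists (braid_of p); rewrite ?dfg_actionE //; case: p.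
by exists (proj _ (PureBraid gp)); rewrite ?dfg_actionE.
Qed.

Definition strand_ends (w : word 'I_4.-1) := [seq strand_end p w | p <- iota 0 4].

(** The standard words for the 24 permutations along the tower S_2 < S_3 < S_4. *)
Definition coset_words : seq (seq int) :=
  [seq u ++ w | u <- [seq u ++ v | u <- [:: [::]; [:: 1]],
                                   v <- [:: [::]; [:: 2]; [:: 2; 1]]],
                w <- [:: [::]; [:: 3]; [:: 3; 2]; [:: 3; 2; 1]]]%Z.

Lemma strand_ends_eq (w w' : word 'I_4.-1) : strand_ends w = strand_ends w' <->
  forall p, p < 4 -> strand_end p w = strand_end p w'.
Proof.
split=> [e p p4|e].
  move: (congr1 (fun s => nth 0%N s p) e).
  by rewrite !(nth_map 0%N) ?size_iota // nth_iota.
by apply/eq_in_map => p; rewrite mem_iota => /andP[_ p4]; apply: e.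
Qed.

Lemma pure_quotient_ends (s w : word 'I_4.-1) :
  is_pure ((braid_class (n := 4) s)^-1 * braid_class (n := 4) w) <->
  strand_ends s = strand_ends w.
Proof.
rewrite -braid_class_inv -braid_class_cat is_pure_class; split.
  move/pure_wordP=> sw; apply/strand_ends_eq=> p p4.
  have := sw _ (_ : strand_end p s < 4); rewrite strand_end_cat strand_end_inv => -> //.
  exact: (@strand_end_le 3 p s).
move/strand_ends_eq=> sw; apply/pure_wordP=> p p4; rewrite strand_end_cat -sw.
  by rewrite -{2}[s]inv_wordK strand_end_inv.
exact: (@strand_end_le 3 p (inv_word s)).
Qed.

Lemma strand_ends_rcons (w : word 'I_4.-1) l :
  strand_ends (rcons w l) = map (cross l.1) (strand_ends w).
Proof.
rewrite /strand_ends -map_comp; apply: eq_map => p /=.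
by rewrite -cats1 strand_end_cat; case: l.
Qed.

Lemma strand_ends_coset (w : word 'I_4.-1) :
  strand_ends w \in [seq strand_ends (wd 2 s) | s <- coset_words].
Proof.
elim/last_ind: w => [|w [i b] IH]; first by vm_compute.
rewrite strand_ends_rcons; move: (strand_ends w) IH; apply/allP.
by case_ord i; vm_compute.
Qed.

Lemma strand_ends_coset_uniq : uniq [seq strand_ends (wd 2 s) | s <- coset_words].
Proof. by vm_compute. Qed.

Lemma det_alpha g : det2 (h1_mx (alpha g)) = 1%R.
Proof.
move: g; apply: presented_ind => [|i|g h IHg IHh|g IH].
- by rewrite multiplicative1 h1_mx1.
- rewrite -[gen _ i]/(@sigma 4 i) /h1_mx /gen_ab /gen_a /gen_b !free_gen_class.
  rewrite -free_class_inv -free_class_cat sigma_class /alpha !braid_autE !char_class.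
  by apply/eqP; case_ord i; vm_compute.
- by rewrite gmulfM h1_mxM det2M IHg IHh.
- rewrite multiplicativeV; have := congr1 det2 (h1_mxM (alpha g)^-1 (alpha g)).
  by rewrite mulVg h1_mx1 det2M IH GRing.mulr1 => <-.
Qed.

Lemma det_flip : det2 (h1_mx flip) = (-1)%R.
Proof.
rewrite /h1_mx /gen_ab /gen_a /gen_b !free_gen_class.
rewrite -free_class_inv -free_class_cat !flipE !char_class.
by apply/eqP; vm_compute.
Qed.

Lemma flip_neq_alpha g : flip <> alpha g.
Proof.
move/(congr1 (fun f => det2 (h1_mx f))); rewrite det_alpha det_flip.
by move/eqP.
Qed.

(** The kernel of [alpha] is pure, so purity can be read off the action, and distinct cosets of P_4
    stay distinct among automorphisms. *)
Lemma alpha_pure g h : is_pure h -> alpha g = alpha h -> is_pure g.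
Proof.
move=> hp e; have [_ gp] : central_pure (g * h^-1).
  by apply: alpha_kernel; rewrite gmulfM multiplicativeV /= e mulgV.
by rewrite -(mulgVK h g); apply: group_closedM (@is_pure_closed 4) _ _ gp hp.
Qed.

Lemma range_dfg_action_index : has_index (range dfg_action) 48.
Proof.
(* An index below 48 encodes a permutation, by its residue modulo 24, and the use of [flip], by the
   comparison with 24. *)
pose S (k : nat) := Braid4 (nth [::] coset_words (k %% 24)).
pose T (i : 'I_48) := (if i < 24 then 1 else flip) * alpha (S i).
exists T => f.
have TV (i : 'I_48) (c : automorphism (free_group 2)) g :
    c = (if i < 24 then 1 else flip) ->
    (T i)^-1 * (c * alpha g) = alpha ((S i)^-1 * g).
  by move=> ->; rewrite /T invgM -mulgA mulKg gmulfM multiplicativeV.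
have T_alpha (i : 'I_48) g h : (T i)^-1 * alpha g = alpha h -> i < 24.
  case: ltnP => // i24 /(canRL (mulVKg _)).
  rewrite /T ltnNge i24 /= -mulgA -gmulfM => e.
  case: (@flip_neq_alpha (g * (S i * h)^-1)).
  by rewrite gmulfM /= e multiplicativeV mulgK.
have T_flip (i : 'I_48) g h : (T i)^-1 * (flip * alpha g) = alpha h -> 24 <= i.
  case: leqP => // i24 /(canRL (mulVKg _)).
  rewrite /T ifT // mul1g -gmulfM => e.
  case: (@flip_neq_alpha (S i * h * g^-1)).
  by rewrite gmulfM /= -e multiplicativeV mulgK.
have S_pure (i : 'I_48) (k : nat) w : k < 24 -> i %% 24 = k ->
    nth [::] [seq strand_ends (wd 2 s) | s <- coset_words] k = strand_ends w ->
    is_pure ((S i)^-1 * braid_class (n := 4) w).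
  move=> k24 ik kw; apply/pure_quotient_ends; rewrite -kw ik.
  by rewrite (nth_map [::]).
have S_uniq (i : 'I_48) (k : nat) w : k < 24 ->
    nth [::] [seq strand_ends (wd 2 s) | s <- coset_words] k = strand_ends w ->
    is_pure ((S i)^-1 * braid_class (n := 4) w) -> i %% 24 = k.
  move=> k24 kw /pure_quotient_ends; rewrite -kw /S => e.
  apply/eqP; rewrite -(nth_uniq [::] _ _ strand_ends_coset_uniq).
  - by rewrite -e (nth_map [::]) //; apply: ltn_pmod.
  - by rewrite size_map; apply: ltn_pmod.
  - by rewrite size_map.
have [g fE] := aut_free_group2 f; move: g fE; elim/braidW=> w fE.
pose ends := [seq strand_ends (wd 2 s) | s <- coset_words].
pose k := index (strand_ends w) ends.
have k24 : k < 24.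
  by have := strand_ends_coset w; rewrite -index_mem size_map.
have kw : nth [::] ends k = strand_ends w by apply/nth_index/strand_ends_coset.
case: fE => ->.
  have k48 : k < 48 by lia.
  exists (Ordinal k48); split.
    apply/range_dfg_action; exists ((S (Ordinal k48))^-1 * braid_class (n := 4) w).
      by apply: S_pure kw => //=; lia.
    by rewrite -(TV _ 1) ?mul1g //= k24.
  move=> i /range_dfg_action[h hp e]; have i24 := T_alpha _ _ _ (esym e).
  apply: val_inj => /=; rewrite -(S_uniq i k w k24 kw); first lia.
  by apply: alpha_pure hp _; rewrite e -(TV _ 1) ?mul1g // i24.
have k48 : k + 24 < 48 by lia.
exists (Ordinal k48); split.
  apply/range_dfg_action; exists ((S (Ordinal k48))^-1 * braid_class (n := 4) w).
    by apply: S_pure kw => //=; lia.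
  rewrite -(TV _ flip) //=; case: ltnP => //; lia.
move=> i /range_dfg_action[h hp e]; have i24 := T_flip _ _ _ (esym e).
apply: val_inj => /=; rewrite -(S_uniq i k w k24 kw).
  by have := ltn_ord i; lia.
by apply: alpha_pure hp _; rewrite e -(TV _ flip) // ltnNge i24.
Qed.

(** * The kernels of the strand-forgetting maps *)

Section Fiber.
Variable m : nat.
Let n := m.+1.

(* coset_word j moves the last strand to position j, and fiber_word k is the *)
(* loop of the last strand around strand k.                                  *)
Definition coset_word (j : nat) : word 'I_n :=
  [seq (zmodp.inZp i, true) | i <- rev (iota j (n - j))].

Definition fiber_word (k : 'I_n) : word 'I_n :=
  coset_word k.+1 ++ [:: (k, false); (k, false)] ++ inv_word (coset_word k.+1).

Definition fiber : free_group n -> braid n.+1 :=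
  free_lift (fun k => braid_class (n := n.+1) (fiber_word k)).
HB.instance Definition _ := Multiplicative.on fiber.

Lemma fiberE w : fiber (free_class w) = braid_class (n := n.+1) (word_subst fiber_word w).
Proof. by rewrite /fiber free_liftE; apply: eval_braid_class. Qed.

Section Hurwitz.

(* The Hurwitz action of the braid group on sequences in the rack of the     *)
(* conjugates of the free generators; the last strand carries a label None   *)
(* acting trivially, whose first component records its motion.               *)
Definition label := (free_group n * option 'I_n)%type.

(** With the inverse of the generator, a loop around strand [j] multiplies the label of the last
    strand by [free_gen j] on the right; see [moved_loop]. *)
Definition label_action (y : label) : free_group n :=
  if y.2 is Some i then y.1^-1 * (free_gen i)^-1 * y.1 else 1.

Definition relabel (h : free_group n) (y : label) : label := (y.1 * h^-1, y.2).

Lemma label_action_relabel h y :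
  label_action (relabel h y) = h * label_action y * h^-1.
Proof.
case: y => g [i|]; rewrite /label_action /= ?mulg1 ?mulgV //.
by rewrite invgM invgK !mulgA.
Qed.

Lemma relabelM h h' y : relabel (h * h') y = relabel h (relabel h' y).
Proof. by rewrite /relabel /= invgM mulgA. Qed.

Lemma relabel1 y : relabel 1 y = y.
Proof. by case: y => g i; rewrite /relabel /= invg1 mulg1. Qed.

Definition hurwitz_letter (l : 'I_n * bool) (t : nat -> label) (p : nat) : label :=
  let i : nat := l.1 in
  if l.2 then
    if p == i then t i.+1
    else if p == i.+1 then relabel (label_action (t i.+1))^-1 (t i) else t p
  else if p == i then relabel (label_action (t i)) (t i.+1)
    else if p == i.+1 then t i else t p.

Definition hurwitz (w : word 'I_n) (t : nat -> label) : nat -> label :=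
  foldl (fun t l => hurwitz_letter l t) t w.

Lemma hurwitz_cat u v t : hurwitz (u ++ v) t = hurwitz v (hurwitz u t).
Proof. exact: foldl_cat. Qed.

Lemma hurwitz_letterK l t : hurwitz_letter (inv_letter l) (hurwitz_letter l t) = t.
Proof.
apply: funext => p; case: l => i []; rewrite /hurwitz_letter /= !eqxx;
  have -> : (i.+1 == i :> nat) = false by lia.
- case: eqP => [->|_]; last by case: eqP => [->|].
  by rewrite -relabelM mulgV relabel1.
- case: eqP => [->|_] //; case: eqP => [->|//].
  by rewrite -relabelM mulVg relabel1.
Qed.

(** The relation between adjacent generators amounts to self-distributivity of the rack,
    [label_action_relabel]; the other relation only compares positions. *)
Lemma hurwitz_pres u v t : pres_eq (@braid_rel n.+1) u v -> hurwitz u t = hurwitz v t.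
Proof.
move=> uv; elim: uv t => {u v} // [u v w _ IH1 _ IH2 t|s u v w uv t|s l w t].
- by rewrite IH1.
- rewrite !hurwitz_cat; congr hurwitz; move: (hurwitz s t) => {}t.
  apply: funext => p; case: uv; rewrite [n.+1.-1]/= => i j ij;
    rewrite /hurwitz /= /hurwitz_letter /=.
    have [-> ->] : (j == i :> nat) = false /\ (j.+1 == i) = false by lia.
    have [-> ->] : (j == i.+1 :> nat) = false /\ (j.+1 == i.+1) = false by lia.
    have [-> ->] : (i == j :> nat) = false /\ (i.+1 == j) = false by lia.
    have [-> ->] : (i == j.+1 :> nat) = false /\ (i.+1 == j.+1) = false by lia.
    by do !case: eqP => //; lia.
  rewrite ij !eqxx.
  have e1 : (i.+1 == i :> nat) = false by lia.
  have e2 : (i.+2 == i :> nat) = false by lia.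
  have e3 : (i == i.+1 :> nat) = false by lia.
  have e4 : (i.+2 == i.+1) = false by lia.
  have e5 : (i == i.+2 :> nat) = false by lia.
  have e6 : (i.+1 == i.+2) = false by lia.
  rewrite ?(e1, e2, e3, e4, e5, e6).
  do !case: eqP => //; (try lia) => *.
  by rewrite label_action_relabel -!relabelM mulgVK.
- by rewrite !hurwitz_cat /= hurwitz_letterK.
Qed.

(* All strands in order, the last one moved to position j. *)
Definition moved (j : nat) (g : free_group n) (p : nat) : label :=
  if p == j then (g, None) else (1, insub (unbump j p)).

Lemma moved_down (j : 'I_n) g : hurwitz_letter (j, true) (moved j.+1 g) = moved j g.
Proof.
apply: funext => p; rewrite /hurwitz_letter /moved /= eqxx.
have -> : (j == j.+1 :> nat) = false by lia.
have -> : unbump j.+1 j = unbump j j.+1 by rewrite /unbump; lia.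
rewrite /label_action /= invg1 relabel1.
case: eqP => [//|pj]; case: eqP => [->|pj1] //.
by have -> : unbump j.+1 p = unbump j p by rewrite /unbump; lia.
Qed.

Lemma moved_up (j : 'I_n) g : hurwitz_letter (j, false) (moved j g) = moved j.+1 g.
Proof. by rewrite -(moved_down j g); apply: (hurwitz_letterK (j, true)). Qed.

Lemma moved_loop (j : 'I_n) g :
  hurwitz_letter (j, false) (moved j.+1 g) = moved j (g * free_gen j).
Proof.
apply: funext => p; rewrite /hurwitz_letter /moved /= eqxx.
have -> : (j == j.+1 :> nat) = false by lia.
have -> : unbump j.+1 j = j by rewrite /unbump; lia.
rewrite valK /label_action /relabel /= invg1 mulg1 mul1g invgK.
case: eqP => [//|pj]; case: eqP => [->|pj1].
  by have -> : unbump j j.+1 = j; rewrite ?valK // /unbump; lia.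
by have -> : unbump j.+1 p = unbump j p by rewrite /unbump; lia.
Qed.

Lemma coset_wordS (j : 'I_n) : coset_word j = rcons (coset_word j.+1) (j, true).
Proof.
rewrite /coset_word -cats1 -[[:: (j, true)]]/[seq (i, true) | i <- [:: j]].
have -> : n - j = (n - j.+1).+1 by rewrite subnSK.
rewrite /= rev_cons map_rcons cats1; congr rcons; congr (_, _).
by apply: val_inj => /=; rewrite modn_small.
Qed.

Lemma coset_word_last : coset_word n = [::].
Proof. by rewrite /coset_word subnn. Qed.

Lemma ord_down_ind (P : nat -> Prop) :
  P n -> (forall j : 'I_n, P j.+1 -> P j) -> forall j, j <= n -> P j.
Proof.
move=> Pn Pj j jn; rewrite -(subKn jn).
elim: (n - j) (leq_subr j n) => [|d IH] dn; first by rewrite subn0.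
have lt_dn : n - d.+1 < n by rewrite ltn_subrL.
by apply: (Pj (Ordinal lt_dn)); rewrite /= subnSK //; apply: IH; apply: ltnW.
Qed.

Lemma hurwitz_coset j g : j <= n -> hurwitz (coset_word j) (moved n g) = moved j g.
Proof.
move: j; apply: ord_down_ind => [|j IH]; first by rewrite coset_word_last.
by rewrite coset_wordS -cats1 hurwitz_cat IH; apply: moved_down.
Qed.

Lemma hurwitz_invK w t t' : hurwitz w t = t' -> hurwitz (inv_word w) t' = t.
Proof.
move=> <-; rewrite -hurwitz_cat; exact: hurwitz_pres (pres_eq_mulV _ w).
Qed.

Lemma hurwitz_fiber_word k g :
  hurwitz (fiber_word k) (moved n g) = moved n (g * free_gen k).
Proof.
rewrite !hurwitz_cat hurwitz_coset //.
rewrite -[hurwitz [:: _; _] _]/(hurwitz_letter (k, false)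
  (hurwitz_letter (k, false) (moved k.+1 g))).
by rewrite moved_loop moved_up; apply/hurwitz_invK/hurwitz_coset.
Qed.

Lemma hurwitz_fiber u g :
  hurwitz (word_subst fiber_word u) (moved n g) = moved n (g * free_class u).
Proof.
elim: u g => [|[k b] u IH] g; first by rewrite free_class_eval mulg1.
rewrite -[word_subst _ _]/((if b then inv_word (fiber_word k) else fiber_word k)
  ++ word_subst fiber_word u).
rewrite hurwitz_cat -[(k, b) :: u]cat1s free_class_cat mulgA -IH; congr hurwitz.
rewrite free_class_letter; case: b; last exact: hurwitz_fiber_word.
by apply: hurwitz_invK; rewrite hurwitz_fiber_word mulgVK.
Qed.

End Hurwitz.

Lemma fiber_inj : injective fiber.
Proof.
apply: multiplicative_inj; elim/freeW=> u; rewrite /= fiberE => u1.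
have /hurwitz_pres e : pres_eq (@braid_rel n.+1) (word_subst fiber_word u) [::].
  by apply/braid_classP; rewrite u1 braid_class_nil.
have := congr1 (fun t => (t n).1) (e (moved n 1)).
by rewrite hurwitz_fiber /= /moved eqxx mul1g.
Qed.

End Fiber.

(** * Schreier rewriting for the loops of the last strand *)

Section PureFiber.
Variable m : nat.
Let n := m.+1.

Lemma strand_end_stab p (w : word 'I_m) : strand_end p (stab_word w) = strand_end p w.
Proof. by elim: w p => [|[i b] w IH] p //=; rewrite IH. Qed.

Lemma strand_end_stab_last (w : word 'I_m) : strand_end m.+1 (stab_word w) = m.+1.
Proof.
elim: w => [|[i b] w IH] //=; have := ltn_ord i.
move=> im; have -> // : cross i m.+1 = m.+1.
by rewrite /cross; do !case: eqP; lia.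
Qed.

Lemma stab_pure (b : braid m.+1) : is_pure b -> is_pure (stab b).
Proof.
elim/braidW: b => w; rewrite stabE !is_pure_class => /pure_wordP wp.
apply/pure_wordP=> p; rewrite ltnS leq_eqVlt => /predU1P[->|pn].
  exact: strand_end_stab_last.
by rewrite strand_end_stab wp.
Qed.

Lemma coset_word_end j : j <= n ->
  strand_end n (coset_word m j) = j /\ forget_word n (coset_word m j) = [::].
Proof.
move: j; apply: ord_down_ind => [|j [IH1 IH2]]; first by rewrite coset_word_last.
rewrite coset_wordS -cats1 strand_end_cat forget_cat IH1 IH2 /= /cross eqxx.
by rewrite orbT; have -> : (j.+1 == j :> nat) = false by lia.
Qed.

(** Every crossing of [coset_word m j] involves the last strand, so the conjugating word disappears
    when that strand is erased. This reduces forgetting any strand to forgetting the last. *)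
Lemma forget_coset_conj j (w : word 'I_n) : j <= n -> pure_word (n := n.+1) w ->
  braid_class (n := n) (forget_word n (coset_word m j ++ w ++ inv_word (coset_word m j)))
  = braid_class (n := n) (forget_word j w).
Proof.
move=> jn /pure_wordP wp; have [e f] := coset_word_end jn.
rewrite !forget_cat e f wp ?ltnS //= braid_class_cat.
have := @forget_pres n n _ _ (leqnn n) (pres_eq_mulV (@braid_rel n.+1) (coset_word m j)).
rewrite forget_cat e f /= => inv1.
have -> : braid_class (n := n) (forget_word j (inv_word (coset_word m j))) = 1.
  by rewrite -braid_class_nil; apply/braid_classP.
exact: mulg1.
Qed.

Lemma fiber_word_pure (k : 'I_n) : pure_word (n := n.+1) (fiber_word k).
Proof.
apply/pure_wordP=> p pn; rewrite !strand_end_cat /= crossK.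
exact: strand_end_inv.
Qed.

Lemma fiber_pure (k : 'I_n) : is_pure (braid_class (n := n.+1) (fiber_word k)).
Proof. by rewrite is_pure_class fiber_word_pure. Qed.

Definition pure_fiber : free_group n -> pure_braid n.+1 :=
  free_lift (fun k => PureBraid (fiber_pure k)).
HB.instance Definition _ := Multiplicative.on pure_fiber.

Lemma pure_fiberE u : braid_of (pure_fiber u) = fiber u.
Proof.
pose h : {multiplicative free_group n -> braid n.+1} := @braid_of n.+1 \o pure_fiber.
rewrite -[LHS]/(h u); apply: free_ext => k.
by rewrite /h /= /pure_fiber /fiber !free_lift_gen.
Qed.

Lemma forget_fiber u : forget_strand ord_max (pure_fiber u) = 1.
Proof.
pose h : {multiplicative free_group n -> pure_braid n} :=
  @forget_strand n ord_max \o pure_fiber.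
pose h1 : {multiplicative free_group n -> pure_braid n} := free_lift (fun=> 1).
have -> : 1 = h1 u.
  move: u; apply: presented_ind => [|k|x y|x]; rewrite ?multiplicative1 //.
  - by rewrite /h1 /= free_lift_gen.
  - by rewrite gmulfM => <- <-; rewrite mulg1.
  - by rewrite multiplicativeV => <-; rewrite invg1.
rewrite -[LHS]/(h u); apply: free_ext => k.
rewrite /h /h1 /= /pure_fiber !free_lift_gen; apply: braid_of_inj.
rewrite (forget_strandE ord_max (w := fiber_word k)); last by rewrite /= unlock.
have := @forget_coset_conj k.+1 [:: (k, false); (k, false)] (ltn_ord k).
rewrite unlock => ->.
  have c : cross k k.+1 = k by rewrite /cross; do !case: eqP; lia.
  by rewrite /= c !eqxx orbT braid_class_nil -[RHS]/(braid_of 1) multiplicative1.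
by apply/pure_wordP=> p pn /=; rewrite crossK.
Qed.

(** One row of the coset table: a letter crosses the representative [coset_word m j] at the cost of
    a fiber word. Together with [normal_step] this is the finite data of the rewriting, verified by
    computation for three and four strands. *)
Hypothesis exit_step : forall (i : 'I_n) e j, j <= n -> exists u,
  braid_eqb (n := n.+1) (coset_word m j ++ [:: (i, e)])
    (word_subst (@fiber_word m) u ++ stab_word (forget_word j [:: (i, e)])
     ++ coset_word m (cross i j)).
Hypothesis normal_step : forall (i : 'I_m) e (k : 'I_n), exists u,
  braid_eqb (n := n.+1) (stab_word [:: (i, e)] ++ fiber_word k)
    (word_subst (@fiber_word m) u ++ stab_word [:: (i, e)]).

Lemma fiber_normal (b : braid m.+1) (u : free_group n) :
  exists u', stab b * fiber u = fiber u' * stab b.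
Proof.
elim/braidW: b u; elim=> [|[i e] w IH] u.
  by exists u; rewrite braid_class_nil multiplicative1 mul1g mulg1.
have letter_normal x : exists x', stab (braid_class (n := m.+1) [:: (i, e)]) * fiber x
    = fiber x' * stab (braid_class (n := m.+1) [:: (i, e)]).
  rewrite stabE; move: x; apply: presented_ind => [|k|x y [x' ex] [y' ey]|x [x' ex]].
  - by exists 1; rewrite multiplicative1 mul1g mulg1.
  - have [v /braid_eqbP] := normal_step i e k.
    rewrite [LHS]braid_class_cat [RHS]braid_class_cat -fiberE => vE.
    exists (free_class v); rewrite /= -vE; congr (_ * _).
    exact: free_lift_gen.
  - by exists (x' * y'); rewrite !gmulfM mulgA ex -mulgA ey mulgA.
  exists x'^-1; rewrite !multiplicativeV.
  apply: (@mulgI _ (fiber x')); apply: (@mulIg _ (fiber x)).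
  by rewrite mulVKg !mulgA mulgVK ex.
have [u1 e1] := IH u; have [u2 e2] := letter_normal u1.
exists u2; rewrite -cat1s braid_class_cat gmulfM -mulgA e1 mulgA e2.
by rewrite -mulgA.
Qed.

Lemma fiber_exit (w : word 'I_n) j : j <= n -> exists u,
  braid_class (n := n.+1) (coset_word m j ++ w) =
  fiber u * stab (braid_class (n := n) (forget_word j w))
    * braid_class (n := n.+1) (coset_word m (strand_end j w)).
Proof.
elim: w j => [|[i e] w IH] j jn.
  by exists 1; rewrite cats0 multiplicative1 mul1g /= braid_class_nil multiplicative1 mul1g.
have [u1 /braid_eqbP e1] := exit_step i e jn.
have [u2 e2] := IH (cross i j) (@cross_le n j i jn).
have [u3 e3] := fiber_normal (braid_class (n := n) (forget_word j [:: (i, e)])) u2.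
exists (free_class u1 * u3).
have -> : braid_class (n := n.+1) (coset_word m j ++ (i, e) :: w)
    = braid_class (n := n.+1) (coset_word m j ++ [:: (i, e)]) * braid_class (n := n.+1) w.
  by rewrite -braid_class_cat -catA.
rewrite e1 2!braid_class_cat -fiberE -stabE -!mulgA -braid_class_cat e2.
have -> : braid_class (n := n) (forget_word j ((i, e) :: w))
    = braid_class (n := n) (forget_word j [:: (i, e)])
      * braid_class (n := n) (forget_word (cross i j) w).
  by rewrite -braid_class_cat -cat1s forget_cat.
by rewrite !gmulfM !mulgA; congr (_ * _ * _); rewrite -!mulgA /= -e3.
Qed.

Lemma pure_decomposition (p : pure_braid n.+1) : exists u,
  braid_of p = fiber u * stab (braid_of (forget_strand ord_max p)).
Proof.
have [w pE] : exists w, braid_of p = braid_class (n := n.+1) w.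
  by exists (repr (braid_of p)); rewrite unlock word_class_repr.
have pw : pure_word (n := n.+1) w by rewrite -is_pure_class -pE; case: (p).
have [u e] := fiber_exit w (leqnn n).
exists u; rewrite (@forget_strandE n ord_max p w); last by rewrite pE unlock.
move: e; rewrite coset_word_last (pure_wordP _ pw) // coset_word_last -pE => ->.
by rewrite braid_class_nil mulg1 unlock.
Qed.

End PureFiber.

(* forget_word goes through the opaque insub; this version computes. *)
Fixpoint erase_word m (i : nat) (w : word 'I_m.+2) : word 'I_m.+1 :=
  if w is (j, e) :: w' then
    let rest := erase_word (cross j i) w' in
    if (i == j) || (i == j.+1) then rest
    else (zmodp.inZp (unbump i j), e) :: rest
  else [::].

Lemma forget_wordE m i (w : word 'I_m.+2) : i <= m.+2 ->
  forget_word i w = erase_word i w.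
Proof.
elim: w i => [|[j e] w IH] i im //=; rewrite IH; last exact: (@cross_le m.+2).
case: ifP => // /norP[/eqP ij /eqP ij1].
have lt_u := unbump_lt im ij ij1; rewrite (insubT (fun k => k < m.+1) lt_u).
by congr ((_, _) :: _); apply: val_inj; rewrite /= modn_small.
Qed.

Lemma exit_step_small m (i : 'I_m.+2) e j : m < 2 -> j <= m.+2 -> exists u,
  braid_eqb (n := m.+3) (coset_word m.+1 j ++ [:: (i, e)])
    (word_subst (@fiber_word m.+1) u ++ stab_word (forget_word j [:: (i, e)])
     ++ coset_word m.+1 (cross i j)).
Proof.
move=> m3 jm.
(* For one sign of the crossing, the moving strand merely lengthens or shortens its coset word; for
   the other it closes up a loop around strand [i]. *)
exists (if (e == false) && (j == i.+1) || (e == true) && (j == i) then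
          [:: (i, e)] else [::]).
rewrite forget_wordE //; case: m i m3 jm => [|[|m]] // i _; move: j => [|[|[|[|j]]]] // _;
  case: e; case_ord i; vm_compute; reflexivity.
Qed.

Lemma normal_step_small m (i : 'I_m.+1) e (k : 'I_m.+2) : m < 2 -> exists u,
  braid_eqb (n := m.+3) (stab_word [:: (i, e)] ++ fiber_word k)
    (word_subst (@fiber_word m.+1) u ++ stab_word [:: (i, e)]).
Proof.
move=> m3; pose x : 'I_m.+2 := zmodp.inZp i; pose y : 'I_m.+2 := zmodp.inZp i.+1.
(* These are Artin's formulas: a crossing exchanges the loops around its two strands, one of them up
   to conjugation. *)
exists (if k == i :> nat then
          if e then [:: (y, false)] else [:: (x, true); (y, false); (x, false)]
        else if k == i.+1 :> nat then
          if e then [:: (y, false); (x, false); (y, true)] else [:: (x, false)]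
        else [:: (k, false)]).
rewrite {}/x {}/y.
case: m i k m3 => [|[|m]] // i k _; case: e; case_ord i; case_ord k; vm_compute; reflexivity.
Qed.

Lemma pure_decomposition_small m (p : pure_braid m.+3) : m < 2 -> exists u,
  braid_of p = fiber (m := m.+1) u * stab (braid_of (forget_strand ord_max p)).
Proof.
move=> m2; apply: pure_decomposition => [i e j jm|i e k].
  exact: exit_step_small.
exact: normal_step_small.
Qed.

Lemma central_pure_center n (z : pure_braid n) : central_pure (braid_of z) ->
  center (pure_braid n) z.
Proof. by move=> [zc _] x; apply: braid_of_inj; rewrite !braid_ofM zc. Qed.

Lemma full_twist3_central_pure : central_pure full_twist3.
Proof.
split; first exact: full_twist3_central.
by rewrite is_pure_class; apply: pure_word_check; vm_compute.
Qed.

Lemma cyc_central_pure z : cyc full_twist3 z -> central_pure z.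
Proof.
apply: cyc_sub; [exact: central_pure1|exact: central_pureM|exact: central_pureV|].
exact: full_twist3_central_pure.
Qed.

(** B_2 is generated by [sigma_1], whose square is the full twist on three strands up to loops of
    the third strand; only the parity [e] of the exponent remains. *)
Lemma stab_two_strands (b : braid 2) : exists (u : free_group 2) z (e : bool),
  cyc full_twist3 z /\ stab b = fiber (m := 1) u * z * Braid3 (nseq e 1%Z).
Proof.
pose s1 := Braid3 [:: 1%Z]; pose u0 := F2 [:: -1; -2]%Z.
have B0 : Braid3 (nseq false 1%Z) = 1 by apply: braid_class_nil.
have ss : s1 * s1 = fiber (m := 1) u0 * full_twist3.
  by rewrite fiberE -!braid_class_cat; apply: braid_eqbP; vm_compute.
have zM z h : cyc full_twist3 z -> commute z h.
  by move/cyc_central_pure => [].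
elim/braidW: b => w; elim/last_ind: w => [|w [i b] [u [z [e [zc IH]]]]].
  exists 1, 1, false; split; first exact: cyc1.
  by rewrite B0 braid_class_nil !multiplicative1 !mulg1.
have -> : stab (braid_class (n := 2) (rcons w (i, b)))
    = stab (braid_class (n := 2) w) * (if b then s1^-1 else s1).
  rewrite -cats1 braid_class_cat gmulfM; congr (_ * _).
  rewrite /= stabE /s1; case: b; rewrite -?braid_class_inv;
  by apply: braid_eqbP; case_ord i; vm_compute.
rewrite IH; case: b; case: e {IH}.
- exists u, z, false; split=> //; rewrite B0 mulg1; exact: mulgK.
- exists (u * u0^-1), (z * full_twist3^-1), true; split; first exact: cycVr.
  rewrite B0 mulg1 -/s1 gmulfM multiplicativeV.
  have -> : s1^-1 = (fiber (m := 1) u0)^-1 * full_twist3^-1 * s1.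
    have : s1^-1 * s1^-1 = full_twist3^-1 * (fiber (m := 1) u0)^-1 by rewrite -!invgM ss.
    move/(canRL (mulgK _)) => ->; rewrite invgK; congr (_ * _).
    by apply/commuteV/commute_sym/commuteV/commute_sym/full_twist3_central.
  rewrite !mulgA; congr (_ * _ * _); rewrite -!mulgA; congr (_ * _).
  exact: zM.
- exists (u * u0), (z * full_twist3), false; split; first exact: cycMr.
  rewrite B0 mulg1 -/s1 -mulgA ss gmulfM !mulgA; congr (_ * _).
  by rewrite -!mulgA; congr (_ * _); apply: zM.
- by exists u, z, true; split=> //; rewrite B0 mulg1.
Qed.

Lemma pure3_decomposition (p : pure_braid 3) : exists u z,
  cyc full_twist3 z /\ braid_of p = fiber (m := 1) u * z.
Proof.
have [v pE] := @pure_decomposition_small 0 p isT.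
have [u [z [e [zc sE]]]] := stab_two_strands (braid_of (forget_strand ord_max p)).
exists (v * u), z; split=> //; rewrite pE sE gmulfM !mulgA.
case: e sE => sE; last first.
  by rewrite (_ : Braid3 _ = 1) ?mulg1 //; apply: braid_class_nil.
exfalso; have pp : is_pure (braid_of p) by case: (p).
have : is_pure (Braid3 [:: 1%Z]).
  have -> : Braid3 [:: 1%Z] = z^-1 * (fiber (m := 1) (v * u))^-1 * braid_of p.
    by rewrite pE sE gmulfM !invgM !mulgA !mulgVK mulVg mul1g.
  have PM := group_closedM (@is_pure_closed 3); have PV := group_closedV (@is_pure_closed 3).
  apply: (PM _ _ _ pp); apply: PM; apply: PV; first by case: (cyc_central_pure zc).
  by rewrite -pure_fiberE; case: (pure_fiber _).
rewrite is_pure_class => /pure_wordP/(_ 0 isT); by vm_compute.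
Qed.

Lemma pure_fiber_inj m : injective (@pure_fiber m).
Proof. by move=> u v /(congr1 (@braid_of _)); rewrite !pure_fiberE => /fiber_inj. Qed.

(** Free groups of rank at least two have trivial center; hence an embedded one stays embedded
    modulo the center. *)
Lemma fiber_center k n (f : {multiplicative free_group k.+2 -> pure_braid n}) u :
  injective f -> center (pure_braid n) (f u) -> u = 1.
Proof.
move=> f_inj fc; apply: free_center_trivial => v; apply: f_inj.
by rewrite !gmulfM; apply: fc.
Qed.

Lemma center3 z : center (pure_braid 3) z -> cyc full_twist3 (braid_of z).
Proof.
move=> zc; have [u [c [cc zE]]] := pure3_decomposition z.
have u1 : u = 1.
  apply: (fiber_center (@pure_fiber_inj 1)) => x; apply: braid_of_inj.
  have := congr1 (@braid_of 3) (zc x); rewrite !braid_ofM pure_fiberE zE.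
  have [cc' _] := cyc_central_pure cc.
  by rewrite -mulgA cc' mulgA mulgA => /mulIg.
by rewrite zE u1 multiplicative1 mul1g.
Qed.

(** * The base group: P_3 modulo its center is free of rank 2 *)

Definition free_pure_quotient3 : free_group 2 -> pure_quotient 3 :=
  proj (center (pure_braid 3)) \o @pure_fiber 1.
HB.instance Definition _ := Multiplicative.on free_pure_quotient3.

Lemma proj_eq1 (G : groupType) (N : normal_subgroup G) x : proj N x = 1 <-> N x.
Proof.
rewrite -(multiplicative1 (proj N)); split=> [/esym/projP|Nx].
  by rewrite invg1 mul1g.
by apply/esym/projP; rewrite invg1 mul1g.
Qed.

Lemma free_pure_quotient3_inj : injective free_pure_quotient3.
Proof.
apply: multiplicative_inj => u /proj_eq1.
exact: fiber_center (@pure_fiber_inj 1).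
Qed.

Lemma free_pure_quotient3_onto q : exists u, free_pure_quotient3 u = q.
Proof.
move: q; elim/projW=> p; have [u [z [zc pE]]] := pure3_decomposition p.
exists u; apply/projP => x; apply: braid_of_inj.
have -> : (pure_fiber u)^-1 * p = PureBraid (cyc_central_pure zc).2.
  by apply: braid_of_inj; rewrite braid_ofM multiplicativeV pE /= pure_fiberE mulKg.
by rewrite !braid_ofM /=; apply: (cyc_central_pure zc).1.
Qed.

Definition pure_quotient3_free (q : pure_quotient 3) : free_group 2 :=
  projT1 (cid (free_pure_quotient3_onto q)).

Lemma pure_quotient3_freeK : cancel pure_quotient3_free free_pure_quotient3.
Proof. by move=> q; rewrite /pure_quotient3_free; case: cid. Qed.

Lemma pure_quotient3_freeM : {morph pure_quotient3_free : x y / x * y}.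
Proof.
move=> x y; apply: free_pure_quotient3_inj.
by rewrite gmulfM /= !pure_quotient3_freeK.
Qed.

HB.instance Definition _ :=
  isMultiplicative.Build (pure_quotient 3) (free_group 2) pure_quotient3_free pure_quotient3_freeM.

Lemma pure_quotient3_free_eq1 q : pure_quotient3_free q = 1 <-> q = 1.
Proof.
split=> [e|->]; last exact: multiplicative1.
by rewrite -(pure_quotient3_freeK q) e multiplicative1.
Qed.

Lemma pure_quotient3_free_onto u : exists q, pure_quotient3_free q = u.
Proof.
exists (free_pure_quotient3 u); apply: free_pure_quotient3_inj.
exact: pure_quotient3_freeK.
Qed.

(** * A criterion for exactness common to the five extensions *)

Section ExactSequence.
Variables (f : {multiplicative free_group 3 -> pure_braid 4}).
Variables (q : {multiplicative K4 -> pure_quotient 3}).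
Hypothesis f_inj : injective f.
Hypothesis qf : forall u, q (proj _ (f u)) = 1.
Hypothesis f_onto : forall g : pure_braid 4, q (proj _ g) = 1 ->
  exists u z, central_pure z /\ braid_of g = braid_of (f u) * z.
Hypothesis q_onto : forall x, exists k, q k = x.

Definition fiber_map : {multiplicative free_group 3 -> K4} :=
  proj (center (pure_braid 4)) \o f.
Definition base_map : {multiplicative K4 -> free_group 2} :=
  pure_quotient3_free \o q.

Lemma kernel_base_map : kernel base_map = kernel q.
Proof. by apply/seteqP; split=> k /= /pure_quotient3_free_eq1. Qed.

Lemma fiber_base_exact : short_exact fiber_map base_map.
Proof.
split.
- by apply: multiplicative_inj => u /proj_eq1; apply: fiber_center.
- rewrite kernel_base_map; apply/seteqP; split=> k /=.
    by case=> u _ <-; rewrite /kernel /=; apply: qf.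
  move: k; elim/projW=> g; rewrite /kernel /= => /f_onto[u [z [zc gE]]].
  exists u => //=; apply/projP; apply: central_pure_center.
  by rewrite braid_ofM multiplicativeV gE mulKg.
move=> x; have [y <-] := pure_quotient3_free_onto x.
by have [k <-] := q_onto y; exists k.
Qed.

End ExactSequence.

Lemma pure_conj n (g p : braid n) : is_pure p -> is_pure (g * p * g^-1).
Proof.
elim/braidW: g => u; elim/braidW: p => w.
rewrite -braid_class_inv -!braid_class_cat !is_pure_class => /pure_wordP wp.
case: n u w wp => [|n] u w wp; first by apply/pure_wordP.
apply/pure_wordP=> p pn; rewrite !strand_end_cat wp; first exact: strand_end_inv.
exact: (@strand_end_le n p u).
Qed.

Definition conj_pure n (g : braid n) (p : pure_braid n) : pure_braid n :=
  PureBraid (pure_conj g (valP p : is_pure (braid_of p))).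

Lemma conj_pureM n (g : braid n) : {morph conj_pure g : x y / x * y}.
Proof.
move=> x y; apply: braid_of_inj; rewrite braid_ofM.
exact: (conj_byM g (braid_of x) (braid_of y)).
Qed.

HB.instance Definition _ n (g : braid n) :=
  isMultiplicative.Build (pure_braid n) (pure_braid n) (conj_pure g) (conj_pureM g).

Lemma conj_pure_inj n (g : braid n) : injective (conj_pure g).
Proof.
move=> x y /(congr1 (@braid_of n)) /= e; apply: braid_of_inj.
exact: (can_inj (conj_byK g) e).
Qed.

(** The full twist on four strands is the one on three strands times the loop of the last strand
    around all the others. *)
Lemma stab_full_twist3 : stab full_twist3 =
  fiber (m := 2) (F3 [:: -1; -2; -3]%Z) * full_twist4.
Proof.
by rewrite stabE fiberE -braid_class_cat; apply: braid_eqbP; vm_compute.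
Qed.

Definition fiber_central (g : braid 4) :=
  exists u t, central_pure t /\ g = fiber (m := 2) u * t.

(** Triviality in the quotient of P_3 leaves a power of the full twist after forgetting a strand; it
    has to be absorbed into the fiber and the center. *)
Lemma fiber_cyc (z : braid 3) : cyc full_twist3 z -> fiber_central (stab z).
Proof.
apply: (cyc_sub (H := fun z => fiber_central (stab z))).
- by exists 1, 1; rewrite !multiplicative1 mulg1; split=> //; apply: central_pure1.
- move=> x y [u [t [tc e]]] [v [s [sc e']]]; exists (u * v), (t * s).
  split; first exact: central_pureM.
  by rewrite !gmulfM /= e e' -!mulgA; congr (_ * _); rewrite !mulgA tc.1.
- move=> x [u [t [tc e]]]; exists u^-1, t^-1; split; first exact: central_pureV.
  by rewrite !multiplicativeV /= e invgM (central_pureV tc).1.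
exists (F3 [:: -1; -2; -3]%Z), full_twist4.
by split; [exact: full_twist4_central_pure|exact: stab_full_twist3].
Qed.

Section StrandForgetting.
Variable i : 'I_4.

Let c : braid 4 := braid_class (n := 4) (coset_word 2 i).

Definition strand_fiber : {multiplicative free_group 3 -> pure_braid 4} :=
  conj_pure c^-1 \o @pure_fiber 2.

Lemma strand_fiber_inj : injective strand_fiber.
Proof. exact: inj_comp (@conj_pure_inj _ _) (@pure_fiber_inj 2). Qed.

Lemma forget_strand_conj (g : pure_braid 4) :
  forget_strand i g = forget_strand ord_max (conj_pure c g).
Proof.
apply: braid_of_inj.
have [w gE] : exists w, braid_of g = braid_class (n := 4) w.
  by exists (repr (braid_of g)); rewrite unlock word_class_repr.
rewrite (@forget_strandE 3 i g w); last by rewrite gE unlock.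
rewrite (@forget_strandE 3 ord_max _
  (coset_word 2 i ++ w ++ inv_word (coset_word 2 i))); last first.
  by rewrite /= gE /c -braid_class_inv -!braid_class_cat catA unlock.
have := @forget_coset_conj 2 i w (ltn_ord i : i <= 3).
rewrite !unlock => -> //.
by rewrite -is_pure_class -gE; case: (g).
Qed.

Lemma forget_strand_fiber u : forget_quotient i (proj _ (strand_fiber u)) = 1.
Proof.
rewrite forget_quotientE forget_strand_conj.
have -> : conj_pure c (strand_fiber u) = pure_fiber u.
  by apply: braid_of_inj; apply: (conj_byVK c).
by rewrite forget_fiber multiplicative1.
Qed.

Lemma strand_fiber_onto (g : pure_braid 4) : forget_quotient i (proj _ g) = 1 ->
  exists u z, central_pure z /\ braid_of g = braid_of (strand_fiber u) * z.
Proof.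
rewrite forget_quotientE forget_strand_conj => /proj_eq1/center3/fiber_cyc[u [z [zc zE]]].
have [v gE] := @pure_decomposition_small 1 (conj_pure c g) isT.
exists (v * u), z; split=> //.
rewrite -[LHS](conj_byK c) -[conj_by c _]/(braid_of (conj_pure c g)) gE zE.
rewrite /= /conj_by pure_fiberE gmulfM !mulgA -!(mulgA _ z) zc.1.
by rewrite !mulgA.
Qed.

Lemma forget_quotient_onto (x : pure_quotient 3) : exists k, forget_quotient i k = x.
Proof.
move: x; elim/projW=> p; have [g <-] := forget_strand_onto i p.
by exists (proj _ g); rewrite forget_quotientE.
Qed.

End StrandForgetting.

(** * The fifth extension *)

(* The permutation of the three splittings of the strands into pairs; the    *)
(* splitting pairing q with 3 is numbered q.                                 *)
Definition splitting (x y : nat) : nat :=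
  if x == 3 then y else if y == 3 then x else 3 - x - y.

(** On permutations, folding is the surjection from S_4 to S_3 whose kernel is the Klein four-group;
    hence it preserves purity. *)
Lemma strand_end_fold (w : word 'I_4.-1) x y : x < 4 -> y < 4 -> x != y ->
  strand_end (splitting x y) (fold_word w)
  = splitting (strand_end x w) (strand_end y w).
Proof.
elim: w x y => //= -[i b] w IH x y x4 y4 xy /=.
rewrite -IH; first last.
- by apply: contra_neq xy => /(can_inj (crossK i)).
- exact: (@cross_le 3 y i).
- exact: (@cross_le 3 x i).
congr strand_end; move: x4 y4 xy; rewrite /cross /splitting.
by case_ord i; case: x => [|[|[|[|?]]]] //; case: y => [|[|[|[|?]]]].
Qed.

Lemma fold_pure (g : braid 4) : is_pure g -> is_pure (fold_braid g).
Proof.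
elim/braidW: g => w; rewrite fold_braidE !is_pure_class => /pure_wordP wp.
apply/pure_wordP=> p p3; have np3 : p != 3 by lia.
have := @strand_end_fold w p 3 (ltnW p3) isT np3.
rewrite (wp p (ltnW p3)) (wp 3 isT); have -> : splitting p 3 = p by rewrite /splitting eqxx; case: eqP => // ->.
by [].
Qed.

Definition fold_pure_braid (p : pure_braid 4) : pure_braid 3 :=
  PureBraid (fold_pure (valP p : is_pure (braid_of p))).

Lemma fold_pure_braidM : {morph fold_pure_braid : x y / x * y}.
Proof.
move=> x y; apply: braid_of_inj; rewrite braid_ofM.
rewrite -[LHS]/(fold_braid (braid_of (x * y))) [braid_of (x * y)]braid_ofM.
by rewrite gmulfM.
Qed.

HB.instance Definition _ := isMultiplicative.Build (pure_braid 4) (pure_braid 3)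
  fold_pure_braid fold_pure_braidM.

Lemma fold_pure_braid_onto p : exists p', fold_pure_braid p' = p.
Proof.
exists (PureBraid (stab_pure (valP p : is_pure (braid_of p)))).
by apply: braid_of_inj => /=; apply: fold_stab.
Qed.

Lemma fold_center z : center (pure_braid 4) z ->
  proj (center (pure_braid 3)) (fold_pure_braid z) = 1.
Proof.
move=> zc; apply/proj_eq1 => x; have [y <-] := fold_pure_braid_onto x.
by rewrite -!gmulfM zc.
Qed.

Definition fold_quotient : {multiplicative K4 -> pure_quotient 3} :=
  quotient_lift (h := proj (center (pure_braid 3)) \o fold_pure_braid) fold_center.

Lemma fold_quotientE p : fold_quotient (proj _ p) = proj _ (fold_pure_braid p).
Proof. exact: quotient_liftE. Qed.

Lemma fold_quotient_onto x : exists k, fold_quotient k = x.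
Proof.
move: x; elim/projW=> p; have [g <-] := fold_pure_braid_onto p.
by exists (proj _ g); rewrite fold_quotientE.
Qed.

(* The inverse of the full twist of the three strands other than strand i; in *)
(* the sphere with five marked points it surrounds strand i and the fifth    *)
(* point, so that these loops generate the fifth fiber.                      *)
Definition outer_word (i : nat) : word 'I_4.-1 :=
  let c := wd 2 (nth [::] [:: [:: 1; 2; 3]; [:: 2; 3]; [:: 3]]%Z i) in
  c ++ wd 2 [:: -2; -1; -2; -1; -2; -1]%Z ++ inv_word c.

Lemma outer_pure (i : 'I_4) : is_pure (braid_class (n := 4) (outer_word i)).
Proof. by rewrite is_pure_class; apply: pure_word_check; case_ord i; vm_compute. Qed.

Definition outer_twist (i : 'I_4) : pure_braid 4 := PureBraid (outer_pure i).

(** Three of the four twists form a basis: the one for strand 3 is the inverse of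
    [stab full_twist3], hence by the identity in [outer_central_stab] the inverse of the product of
    the others modulo the center. *)
Definition outer_fiber : free_group 3 -> pure_braid 4 :=
  free_lift (fun k => outer_twist (widen_ord (isT : 3 <= 4) k)).
HB.instance Definition _ := Multiplicative.on outer_fiber.

Lemma outer_fiberE w : braid_of (outer_fiber (free_class w)) =
  braid_class (n := 4) (word_subst (fun k : 'I_3 => outer_word k) w).
Proof.
by rewrite /outer_fiber free_liftE eval_morph; apply: eval_braid_class.
Qed.

Lemma artin_outer u : artin (braid_of (outer_fiber u)) = inner_aut u.
Proof.
pose h : {multiplicative free_group 3 -> automorphism (free_group 3)} :=
  artin \o (@braid_of 4 \o outer_fiber).
rewrite -[LHS]/(h u); apply: free_ext => k {u}.
rewrite /h /= /outer_fiber free_lift_gen /=; apply: aut_ext => y.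
rewrite [in LHS](free_gen_class y) [LHS]braid_autE /= /conj_by !free_gen_class.
rewrite -free_class_inv -!free_class_cat; apply/fred_eqP/eqP.
by clear h; case_ord k; case_ord y; vm_compute.
Qed.

Lemma outer_fiber_inj : injective outer_fiber.
Proof.
by move=> u v /(congr1 (fun p => artin (braid_of p))); rewrite !artin_outer => /inner_aut_inj.
Qed.

Lemma full_twist3V_center (p : pure_braid 3) :
  braid_of p = full_twist3^-1 -> center (pure_braid 3) p.
Proof.
by move=> pE; apply: central_pure_center; rewrite pE; apply/central_pureV/full_twist3_central_pure.
Qed.

(** The twist folds to [full_twist3^-1], which is trivial only modulo the center; in particular it
    does not lie in the subgroup generated by [a] and [b]. *)
Lemma fold_outer (i : 'I_4) : fold_quotient (proj _ (outer_twist i)) = 1.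
Proof.
rewrite fold_quotientE; apply/proj_eq1/full_twist3V_center.
rewrite /= fold_braidE -braid_class_inv; apply: braid_eqbP.
by case_ord i; vm_compute.
Qed.

Lemma fold_outer_fiber u : fold_quotient (proj _ (outer_fiber u)) = 1.
Proof.
pose h : {multiplicative free_group 3 -> pure_quotient 3} :=
  fold_quotient \o (proj (center (pure_braid 4)) \o outer_fiber).
rewrite -[LHS]/(h u); move: u; apply: presented_ind => [|k|x y ex ey|x ex].
- exact: multiplicative1.
- rewrite /h /= /outer_fiber; have -> := @free_lift_gen 3 _ _ k; exact: fold_outer.
- by rewrite gmulfM ex ey mulg1.
- by rewrite multiplicativeV ex invg1.
Qed.

Lemma fold_dfg w : fold_braid (dfg w) = 1.
Proof.
pose h : {multiplicative free_group 2 -> braid 3} := fold_braid \o dfg.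
rewrite -[LHS]/(h w); move: w; apply: presented_ind => [|k|x y ex ey|x ex].
- exact: multiplicative1.
- rewrite /h /=; have -> := dfg_gen k; rewrite fold_braidE -braid_class_nil.
  by apply: braid_eqbP; clear h; case_ord k; vm_compute.
- by rewrite gmulfM ex ey mulg1.
- by rewrite multiplicativeV ex invg1.
Qed.

Definition outer_central (g : braid 4) :=
  exists u z, central_pure z /\ g = braid_of (outer_fiber u) * z.

Lemma outer_central1 : outer_central 1.
Proof. by exists 1, 1; rewrite !multiplicative1 mulg1; split=> //; apply: central_pure1. Qed.

Lemma outer_centralM g h : outer_central g -> outer_central h -> outer_central (g * h).
Proof.
move=> [u [t [tc e]]] [v [s [sc e']]]; exists (u * v), (t * s).
split; first exact: central_pureM.
by rewrite !gmulfM /= e e' -!mulgA; congr (_ * _); rewrite !mulgA tc.1.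
Qed.

Lemma outer_centralV g : outer_central g -> outer_central g^-1.
Proof.
move=> [u [t [tc e]]]; exists u^-1, t^-1; split; first exact: central_pureV.
by rewrite !multiplicativeV /= e invgM (central_pureV tc).1.
Qed.

Lemma outer_central_pure g : outer_central g -> is_pure g.
Proof.
move=> [u [t [[_ tp] ->]]]; apply: group_closedM (@is_pure_closed 4) _ _ _ tp.
by case: (outer_fiber u).
Qed.

(** Only the exponents -1, 0 and 1 occur in [outer_coset_table], so only the sign of [e] counts. *)
Definition full_twist4_word (e : int) : word 'I_4.-1 :=
  let w := wd 2 (flatten (nseq 4 [:: 1; 2; 3]))%Z in
  match e with 0%Z => [::] | Posz _ => w | Negz _ => inv_word w end.

Lemma full_twist4_word_central e : central_pure (braid_class (n := 4) (full_twist4_word e)).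
Proof.
case: e => [[|k]|k] /=.
- by rewrite braid_class_nil; apply: central_pure1.
- exact: full_twist4_central_pure.
- by rewrite braid_class_inv; apply/central_pureV/full_twist4_central_pure.
Qed.

(** The elements [1], [a^-1], [b^-1], [b^-1 * a], which represent the Klein four-group, the image of
    the free group in S_4. *)
Definition four_group_word (j : nat) : word 'I_4.-1 :=
  word_subst dfg_word (wd 1 (nth [::] [:: [::]; [:: -1]; [:: -2]; [:: -2; 1]]%Z j)).

Local Notation R j := (braid_class (n := 4) (four_group_word j)).

Lemma outer_coset_word (j : 'I_4) l (k : 'I_4) u e :
  braid_eqb (n := 4) (four_group_word j ++ word_subst dfg_word [:: l])
    (word_subst (fun k : 'I_3 => outer_word k) u ++ full_twist4_word e ++ four_group_word k) ->
  exists2 h, outer_central h & R j * dfg (free_class [:: l]) = h * R k.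
Proof.
move=> /braid_eqbP; rewrite [LHS]braid_class_cat [RHS]braid_class_cat braid_class_cat.
rewrite -outer_fiberE -dfgE => ->; rewrite mulgA.
eexists; last by [].
by exists (free_class u), (braid_class (n := 4) (full_twist4_word e)); split=> //; apply: full_twist4_word_central.
Qed.

(* For the letters a, b, a^-1, b^-1 in turn and each coset j, the coset k,   *)
(* the word u and the power e of the full twist for outer_coset_word.        *)
Definition outer_coset_table : seq (seq (nat * seq int * int)) :=
  [:: [:: (1%N, [:: 1; 2], 1); (0%N, [::], 0); (3%N, [::], 0); (2%N, [:: -1; -2], -1)];
      [:: (2%N, [:: 1; 2; 3; -2], 1); (3%N, [:: -3; -2], -1); (0%N, [::], 0); (1%N, [:: -1; 2], 0)];
      [:: (1%N, [::], 0); (0%N, [:: -2; -1], -1); (3%N, [:: 2; 1], 1); (2%N, [::], 0)];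
      [:: (2%N, [::], 0); (3%N, [:: -2; 1], 0); (0%N, [:: 2; -3; -2; -1], -1); (1%N, [:: 2; 3], 1)]]%Z.

Lemma outer_coset_step (l : 'I_2 * bool) (j : 'I_4) : exists (k : 'I_4) h,
  outer_central h /\ R j * dfg (free_class [:: l]) = h * R k.
Proof.
pose T := nth (0%N, [::], 0%Z) (nth [::] outer_coset_table (l.1 + l.2.*2)) j.
have [|h hc e] := @outer_coset_word j l (zmodp.inZp T.1.1) (wd 2 T.1.2) T.2.
  by rewrite {}/T; case: l => [x b]; case: b; case_ord x; case_ord j; vm_compute.
by exists (zmodp.inZp T.1.1), h.
Qed.

Lemma outer_coset_dfg w : exists (k : 'I_4) h,
  outer_central h /\ dfg w = h * R k.
Proof.
elim/freeW: w => w; elim/last_ind: w => [|w l [k [h [hc e]]]].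
  exists ord0, 1; split; first exact: outer_central1.
  by rewrite free_class_eval multiplicative1 mul1g (_ : four_group_word _ = [::]) // braid_class_nil.
have [k' [h' [hc' e']]] := outer_coset_step l k.
exists k', (h * h'); split; first exact: outer_centralM.
by rewrite -cats1 free_class_cat gmulfM /= e -!mulgA e'.
Qed.

Lemma outer_central_stab (z : braid 3) : cyc full_twist3 z -> outer_central (stab z).
Proof.
apply: (cyc_sub (H := fun z => outer_central (stab z))).
- by rewrite multiplicative1; apply: outer_central1.
- by move=> x y; rewrite gmulfM; apply: outer_centralM.
- by move=> x; rewrite multiplicativeV; apply: outer_centralV.
(* The exponents match under folding: each of the three twists gives [full_twist3^-1] and
   [full_twist4] gives [full_twist3 ^+ 2], so the total is -3 + 4 = 1. *)
exists (F3 [:: 1; 2; 3]%Z), (full_twist4 * full_twist4).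
split; first by apply: central_pureM; apply: full_twist4_central_pure.
rewrite stabE outer_fiberE -!braid_class_cat; apply: braid_eqbP.
by vm_compute.
Qed.

(** Decompose [g^-1] as [dfg w * stab b]. Here [b] is its image under folding, hence a power of the
    full twist, and [outer_central_stab] handles it. The free part is a fiber element up to the
    center and one of four representatives, and purity of [g] leaves only the trivial one. *)
Lemma outer_fiber_onto (g : pure_braid 4) : fold_quotient (proj _ g) = 1 ->
  outer_central (braid_of g).
Proof.
rewrite fold_quotientE => /proj_eq1/center3 /= gc.
have [w [b gE]] := dfg_stab (braid_of g)^-1.
have bE : b = fold_braid (braid_of g)^-1 by rewrite gE gmulfM /= fold_dfg mul1g fold_stab.
have bc : outer_central (stab b)^-1.
  by apply: outer_centralV; rewrite bE multiplicativeV multiplicativeV; apply/outer_centralV/outer_central_stab.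
have [k [h [hc e]]] := outer_coset_dfg w^-1.
have gE' : braid_of g = (stab b)^-1 * h * R k.
  by rewrite -mulgA -e multiplicativeV -invgM -gE invgK.
have hp := outer_centralM bc hc.
suff k0 : k = ord0.
  by rewrite gE' k0 (_ : four_group_word _ = [::]) // braid_class_nil mulg1.
have : is_pure (R k).
  rewrite -(mulKg ((stab b)^-1 * h) (R k)) -gE'.
  apply: group_closedM (@is_pure_closed 4) _ _ _ _.
    exact/outer_central_pure/outer_centralV.
  by case: (g).
(* The Klein four-group acts freely on the strands, so following strand 0 is enough. *)
rewrite is_pure_class => /pure_wordP/(_ 0 isT).
by clear; case_ord k => //= _; apply: val_inj.
Qed.

Lemma forget_outer_diag (i : 'I_4) : forget_quotient i (proj _ (outer_twist i)) = 1.
Proof.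
rewrite forget_quotientE; apply/proj_eq1/full_twist3V_center.
rewrite (@forget_strandE 3 i _ (outer_word i)) /=; last by rewrite unlock.
rewrite forget_wordE; last exact: (ltn_ord i : i <= 3).
have := @braid_eqbP 3 (erase_word i (outer_word i)) (inv_word (wd 1 [:: 1; 2; 1; 2; 1; 2]%Z)).
rewrite braid_class_inv unlock => -> //.
by case_ord i; vm_compute.
Qed.

(** Erasing one of the three twisted strands leaves a full twist of two strands out of three up to
    conjugation and inversion. Its Burau matrix is not diagonal, whereas powers of [full_twist3]
    have scalar matrices. *)
Lemma forget_outer (i j : 'I_4) : i != j -> forget_quotient j (proj _ (outer_twist i)) <> 1.
Proof.
move=> ij; rewrite forget_quotientE => /proj_eq1/center3.
rewrite (@forget_strandE 3 j _ (outer_word i)) /=; last by rewrite unlock.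
rewrite forget_wordE; last exact: (ltn_ord j : j <= 3).
have -> : word_class (@braid_rel 3) (erase_word j (outer_word i))
  = braid_class (n := 3) (erase_word j (outer_word i)) by rewrite unlock.
set v := braid_class _; have offdiag : ((m12 (burau v) != 0) || (m21 (burau v) != 0))%R.
  by rewrite burau_class; move: ij; clear; case_ord i; case_ord j; vm_compute.
by case/cyc_burau=> [|[]] e; move: offdiag; rewrite e.
Qed.

(** * The five extensions *)

Definition extension_fiber (j : 'I_5) : {multiplicative free_group 3 -> K4} :=
  if unlift ord_max j is Some i then fiber_map (strand_fiber i) else fiber_map outer_fiber.

Definition extension_base (j : 'I_5) : {multiplicative K4 -> free_group 2} :=
  if unlift ord_max j is Some i then base_map (@forget_quotient 3 i)
  else base_map fold_quotient.

Lemma extension_exact j : short_exact (extension_fiber j) (extension_base j).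
Proof.
rewrite /extension_fiber /extension_base; case: unliftP => [i|] _.
  apply: fiber_base_exact.
  - exact: strand_fiber_inj.
  - exact: forget_strand_fiber.
  - exact: strand_fiber_onto.
  - exact: forget_quotient_onto.
apply: fiber_base_exact.
- exact: outer_fiber_inj.
- exact: fold_outer_fiber.
- exact: outer_fiber_onto.
- exact: fold_quotient_onto.
Qed.

Lemma kernel_extension_base j : kernel (extension_base j) =
  if unlift ord_max j is Some i then kernel (@forget_quotient 3 i)
  else kernel fold_quotient.
Proof. by rewrite /extension_base; case: unliftP => [i|] _; apply: kernel_base_map. Qed.

Definition outer_class (i : 'I_4) : K4 := proj _ (outer_twist i).

Lemma kernel_forget_twist (i j : 'I_4) : kernel (@forget_quotient 3 j) (outer_class i) <-> i = j.
Proof.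
split=> [e|->]; last exact: forget_outer_diag.
by apply/eqP; apply: contraPT e => /forget_outer.
Qed.

Lemma kernel_fold_twist i : kernel fold_quotient (outer_class i).
Proof. exact: fold_outer. Qed.

Lemma kernel_fold_forget j : kernel fold_quotient <> kernel (@forget_quotient 3 j).
Proof.
move=> e; have h i : i = j by apply/kernel_forget_twist; rewrite -e; apply: kernel_fold_twist.
by have := h ord0; rewrite -(h ord_max).
Qed.

Lemma kernel_forget_inj (i j : 'I_4) :
  kernel (@forget_quotient 3 i) = kernel (@forget_quotient 3 j) -> i = j.
Proof. by move=> e; apply/kernel_forget_twist; rewrite -e; apply/kernel_forget_twist. Qed.

Lemma kernel_extension_inj : injective (fun j => kernel (extension_base j)).
Proof.
move=> j j' /=; rewrite !kernel_extension_base.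
case: unliftP => [i ->|->]; case: unliftP => [i' ->|->] //.
- by move/kernel_forget_inj => ->.
- by move/esym/kernel_fold_forget.
- by move/kernel_fold_forget.
Qed.

Lemma card_strand_forgetting :
  #|[pred j | `[< arises_from_strand_forgetting (kernel (extension_base j)) >]]| = 4.
Proof.
rewrite (eq_card (B := predC1 ord_max)) ?cardC1 ?card_ord // => j.
rewrite !inE; apply/asboolP/idP; rewrite kernel_extension_base.
  case: unliftP => [i ->|->]; first by rewrite eq_sym neq_lift.
  by case=> i /kernel_fold_forget.
by case: unliftP => [i -> _|->]; [exists i|rewrite eqxx].
Qed.

Theorem theorem1p2 :
  (exists (iota : {multiplicative free_group 2 -> braid 4})
          (rho : {multiplicative K4 -> automorphism (free_group 2)}),
      [/\ conjugation_action iota rho,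
          injective rho
        & has_index (range rho) 48])
  /\
  (exists (f : 'I_5 -> {multiplicative free_group 3 -> K4})
          (p : 'I_5 -> {multiplicative K4 -> free_group 2}),
      [/\ forall j, short_exact (f j) (p j),
          injective (fun j => kernel (p j))
        & #|[pred j | `[< arises_from_strand_forgetting (kernel (p j)) >]]| = 4]).
Proof.
split.
  exists dfg, dfg_action; split; [split|exact: dfg_action_inj|exact: range_dfg_action_index].
  - by split; [exact: dfg_gen_a|exact: dfg_gen_b].
  - exact: dfg_inj.
  - by move=> g w; exists (alpha g w); apply/esym/dfg_alpha.
  - by move=> p w; rewrite /= dfg_actionE; apply: dfg_alpha.
exists extension_fiber, extension_base; split.
- exact: extension_exact.
- exact: kernel_extension_inj.
- exact: card_strand_forgetting.
Qed.
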